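(* Let $(W,S)$ be an odd-angled Coxeter system. Then $W$ contains no proper finite index reflection subgroup if and only if each connected component of the divisibility diagram $\mathrm{Cox}_{\mathrm{div}}(W)$ contains, as a (full) subdiagram, one of the following diagrams: (A) three vertices; two edges labeled $k$ and $l$ with $k,l\ge 5$; the third pair of vertices is either not joined or joined by an edge labeled $m\ge 5$; (B) three vertices, with the three edges labeled $p$, $l$ and $3$, where $p\ge 7$ and $l\ge 5$; (C) four vertices $v_1,v_2,v_3,v_4$; $v_1v_2$ is labeled $k\ge5$, $v_3v_4$ is labeled $l\ge 5$, $v_2v_3$ is labeled $3$, and each of the pairs $v_1v_3$, $v_1v_4$, $v_2v_4$ is either joined by an edge labeled $3$ or not joined; (D) four vertices $v_1,v_2,v_3,v_4$; $v_1v_2$, $v_2v_3$, $v_3v_4$ are labeled $5$, $v_1v_3$ and $v_2v_4$ are labeled $3$, and $v_1,v_4$ are either joined by an edge labeled $3$ or $5$, or not joined; (E) four vertices $v_1,v_2,v_3,v_4$; $v_1v_2$, $v_1v_3$, $v_1v_4$ are labeled $5$, and $v_2v_3$, $v_2v_4$, $v_3v_4$ are labeled $3$; (F) $n\ge 5$ vertices $v_1,\dots,v_n$; $v_1v_2$ is labeled $k\ge5$, $v_{n-1}v_n$ is labeled $l\ge 5$, $v_iv_{i+1}$ is labeled $3$ for $2\le i\le n-2$, each of the pairs $v_1v_3$ and $v_{n-2}v_n$ is either joined by an edge labeled $3$ or not joined, and all other pairs are not joined.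
   Context: A Coxeter system $(W,S)$ consists of a nonempty finite set $S=\{s_1,\dots,s_r\}$ and the group $W=\langle S\mid (s_is_j)^{m_{ij}}=1\ \forall i,j\rangle$, where $m_{ii}=1$ and $m_{ij}=m_{ji}\in\{2,3,4,\dots\}\cup\{\infty\}$ for $i\ne j$ ($m_{ij}=\infty$ means no relation is imposed on $s_is_j$). It is odd-angled if every $m_{ij}$ with $i\neq j$ is odd or infinite. A reflection of $W$ is an element conjugate in $W$ to an element of $S$. A reflection subgroup is a proper subgroup (index greater than $1$) generated by reflections; the trivial subgroup counts as generated by the empty set of reflections. The divisibility diagram $\mathrm{Cox}_{\mathrm{div}}(W)$ is the labeled graph with vertices corresponding to the elements of $S$; the vertices of $s_i\ne s_j$ are joined by an edge labeled by the smallest divisor $k>1$ of $m_{ij}$ if $m_{ij}<\infty$, and are not joined if $m_{ij}=\infty$. All labels are thus (for odd-angled systems) finite odd primes. A subdiagram always means a full (induced) subdiagram, obtained by removing some vertices and all edges emanating from them. *)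

(* Defs.v *)
From HB Require Import structures.
From mathcomp Require Import all_boot.
From mathcomp Require Import generic_quotient.
From mathcomp Require Import mathcomp_extra boolp classical_sets functions cardinality.

Set Implicit Arguments.
Unset Strict Implicit.
Unset Printing Implicit Defensive.

Local Open Scope group_scope.
Local Open Scope quotient_scope.

Section Presentation.
Variable X : choiceType.

(* The letter (x, true) stands for x, the letter (x, false) for its inverse. *)
Definition word : choiceType := seq (X * bool).

Definition word_inv (u : word) : word := rev [seq (a.1, ~~ a.2) | a <- u].

Variable R : set word.

Inductive pres_rel : word -> word -> Prop :=
| pres_refl u : pres_rel u u
| pres_sym u v : pres_rel u v -> pres_rel v u
| pres_trans u v w : pres_rel u v -> pres_rel v w -> pres_rel u w
| pres_cancel u v x b : pres_rel (u ++ [:: (x, b); (x, ~~ b)] ++ v) (u ++ v)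
| pres_relator u v r : R r -> pres_rel (u ++ r ++ v) (u ++ v).

Definition pres_eqb : rel word := fun u v => `[< pres_rel u v >].

Lemma pres_eqb_refl : reflexive pres_eqb.
Proof. by move=> u; apply/asboolP; apply: pres_refl. Qed.

Lemma pres_eqb_sym : symmetric pres_eqb.
Proof. by move=> u v; apply/asboolP/asboolP; apply: pres_sym. Qed.

Lemma pres_eqb_trans : transitive pres_eqb.
Proof.
move=> v u w /asboolP uv /asboolP vw.
by apply/asboolP; apply: pres_trans uv vw.
Qed.

Canonical pres_equiv := EquivRel pres_eqb pres_eqb_refl pres_eqb_sym pres_eqb_trans.

Definition presented_group := {eq_quot pres_equiv}.

HB.instance Definition _ := Choice.on presented_group.
HB.instance Definition _ := EqQuotient.on presented_group.

Definition pres_pi (u : word) : presented_group := \pi u.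

Lemma pres_piP u v : reflect (pres_rel u v) (pres_pi u == pres_pi v).
Proof. by rewrite piE; apply: asboolP. Qed.

Lemma pres_piE u v : pres_rel u v -> pres_pi u = pres_pi v.
Proof. by move/pres_piP/eqP. Qed.

Lemma pres_repr u : pres_rel (repr (pres_pi u)) u.
Proof. by apply/pres_piP; rewrite /pres_pi reprK. Qed.

Lemma pres_pi_repr (g : presented_group) : pres_pi (repr g) = g.
Proof. exact: reprK. Qed.

Lemma pres_catl w u v : pres_rel u v -> pres_rel (w ++ u) (w ++ v).
Proof.
elim=> {u v} [u|u v _|u v t _ IH1 _ IH2|u v x b|u v r Rr].
- exact: pres_refl.
- exact: pres_sym.
- exact: pres_trans IH1 IH2.
- by rewrite !(catA w); apply: pres_cancel.
- by rewrite !(catA w); apply: pres_relator.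
Qed.

Lemma pres_catr w u v : pres_rel u v -> pres_rel (u ++ w) (v ++ w).
Proof.
elim=> {u v} [u|u v _|u v t _ IH1 _ IH2|u v x b|u v r Rr].
- exact: pres_refl.
- exact: pres_sym.
- exact: pres_trans IH1 IH2.
- by rewrite -!catA; apply: pres_cancel.
- by rewrite -!catA; apply: pres_relator.
Qed.

Lemma word_invK : involutive word_inv.
Proof.
move=> u; rewrite /word_inv map_rev revK -map_comp -[RHS]map_id.
by apply: eq_map => -[x b] /=; rewrite negbK.
Qed.

Lemma pres_catV u : pres_rel (u ++ word_inv u) [::].
Proof.
elim/last_ind: u => [|u [x b] IH]; first exact: pres_refl.
rewrite /word_inv map_rcons rev_rcons -cats1 -catA /=.
exact: pres_trans (pres_cancel u _ x b) IH.
Qed.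

Lemma pres_Vcat u : pres_rel (word_inv u ++ u) [::].
Proof. by have := pres_catV (word_inv u); rewrite word_invK. Qed.

Definition pres_mul (g h : presented_group) := pres_pi (repr g ++ repr h).
Definition pres_one : presented_group := pres_pi [::].
Definition pres_inv (g : presented_group) := pres_pi (word_inv (repr g)).

Lemma pres_mulA : associative pres_mul.
Proof.
move=> f g h; apply: pres_piE.
apply: pres_trans (pres_catl _ (pres_repr _)) _.
by rewrite catA; apply/pres_catr/pres_sym/pres_repr.
Qed.

Lemma pres_mul1 : left_id pres_one pres_mul.
Proof.
move=> g; rewrite -[RHS]pres_pi_repr; apply: pres_piE.
exact: pres_catr (pres_repr [::]).
Qed.

Lemma pres_mulr1 : right_id pres_one pres_mul.
Proof.
move=> g; rewrite -[RHS]pres_pi_repr; apply: pres_piE.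
by rewrite -[X in pres_rel _ X]cats0; apply/pres_catl/pres_repr.
Qed.

Lemma pres_mulV : left_inverse pres_one pres_inv pres_mul.
Proof.
move=> g; apply: pres_piE.
exact: pres_trans (pres_catr _ (pres_repr _)) (pres_Vcat _).
Qed.

Lemma pres_mulrV : right_inverse pres_one pres_inv pres_mul.
Proof.
move=> g; apply: pres_piE.
exact: pres_trans (pres_catl _ (pres_repr _)) (pres_catV _).
Qed.

HB.instance Definition _ := isGroup.Build presented_group
  pres_mulA pres_mul1 pres_mulr1 pres_mulV pres_mulrV.

End Presentation.

(* None encodes the entry infinity. *)
Record coxeter_matrix (S : finType) := CoxeterMatrix {
  cox_entry :> S -> S -> option nat;
  cox_diag : forall i, cox_entry i i = Some 1%N;
  cox_sym : forall i j, cox_entry i j = cox_entry j i;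
  cox_ge2 : forall i j k, i != j -> cox_entry i j = Some k -> (2 <= k)%N
}.

Definition odd_angled (S : finType) (m : coxeter_matrix S) : Prop :=
  forall i j k, i != j -> m i j = Some k -> odd k.

Definition coxeter_relators (S : finType) (m : coxeter_matrix S) :
    set (word S) :=
  [set r | exists i j k, m i j = Some k /\
     r = flatten (nseq k [:: (i, true); (j, true)])]%classic.

Definition coxeter_group (S : finType) (m : coxeter_matrix S) : groupType :=
  presented_group (coxeter_relators m).

Definition cox_gen (S : finType) (m : coxeter_matrix S) (i : S) :
  coxeter_group m := pres_pi (coxeter_relators m) [:: (i, true)].

Section Subgroups.
Local Open Scope classical_set_scope.

Definition is_subgroup (G : groupType) (H : set G) : Prop :=
  [/\ H 1,
      forall x y, H x -> H y -> H (x * y) &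
      forall x, H x -> H x^-1].

Definition generated_subgroup (G : groupType) (A : set G) : set G :=
  smallest (@is_subgroup G) A.

Definition left_cosets (G : groupType) (H : set G) : set (set G) :=
  range (fun g : G => [set g * h | h in H]).

Definition finite_index (G : groupType) (H : set G) : Prop :=
  finite_set (left_cosets H).

Definition is_reflection (S : finType) (m : coxeter_matrix S)
    (t : coxeter_group m) : Prop :=
  exists (i : S) (g : coxeter_group m), t = cox_gen m i ^ g.

(* Properness, i.e. index greater than 1, is part of the notion. *)
Definition reflection_subgroup (S : finType) (m : coxeter_matrix S)
    (H : set (coxeter_group m)) : Prop :=
  H != setT /\
  exists2 A : set (coxeter_group m),
    A `<=` @is_reflection S m & H = generated_subgroup A.

End Subgroups.

(* A labeled graph on T: the label of the edge xy, None if x and y are not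
   joined. *)
Definition diagram (T : finType) := T -> T -> option nat.

(* pdiv k is the smallest prime divisor of k > 1, hence its smallest divisor
   greater than 1 (see pdiv_min_dvd). *)
Definition cox_div (S : finType) (m : coxeter_matrix S) : diagram S :=
  fun i j => if i == j then None else omap pdiv (m i j).

Definition components (T : finType) (d : diagram T) : {set {set T}} :=
  equivalence_partition (connect (fun x y => isSome (d x y))) [set: T].

Section Subdiagrams.
Variables (T : finType) (d : diagram T).

Definition joined (P : pred nat) (x y : T) : bool := oapp P false (d x y).
Definition not_joined (x y : T) : bool := d x y == None.

Definition contains_A (C : {set T}) : Prop :=
  exists v1 v2 v3 : T,
    [/\ uniq [:: v1; v2; v3], {subset [:: v1; v2; v3] <= C},
        joined (leq 5) v1 v2, joined (leq 5) v2 v3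
      & not_joined v1 v3 || joined (leq 5) v1 v3].

Definition contains_B (C : {set T}) : Prop :=
  exists v1 v2 v3 : T,
    [/\ uniq [:: v1; v2; v3], {subset [:: v1; v2; v3] <= C},
        joined (leq 7) v1 v2, joined (leq 5) v2 v3 & joined (pred1 3) v1 v3].

Definition contains_C (C : {set T}) : Prop :=
  exists v1 v2 v3 v4 : T,
    [/\ uniq [:: v1; v2; v3; v4], {subset [:: v1; v2; v3; v4] <= C},
        [&& joined (leq 5) v1 v2, joined (leq 5) v3 v4
          & joined (pred1 3) v2 v3],
        not_joined v1 v3 || joined (pred1 3) v1 v3
      & (not_joined v1 v4 || joined (pred1 3) v1 v4) &&
        (not_joined v2 v4 || joined (pred1 3) v2 v4)].

Definition contains_D (C : {set T}) : Prop :=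
  exists v1 v2 v3 v4 : T,
    [/\ uniq [:: v1; v2; v3; v4], {subset [:: v1; v2; v3; v4] <= C},
        [&& joined (pred1 5) v1 v2, joined (pred1 5) v2 v3
          & joined (pred1 5) v3 v4],
        joined (pred1 3) v1 v3 && joined (pred1 3) v2 v4
      & not_joined v1 v4 || joined (pred2 3 5) v1 v4].

Definition contains_E (C : {set T}) : Prop :=
  exists v1 v2 v3 v4 : T,
    [/\ uniq [:: v1; v2; v3; v4], {subset [:: v1; v2; v3; v4] <= C},
        [&& joined (pred1 5) v1 v2, joined (pred1 5) v1 v3
          & joined (pred1 5) v1 v4]
      & [&& joined (pred1 3) v2 v3, joined (pred1 3) v2 v4
          & joined (pred1 3) v3 v4]].

(* The vertices are v 1, ..., v n; the values of v outside 1..n are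
   irrelevant. *)
Definition contains_F (C : {set T}) : Prop :=
  exists (n : nat) (v : nat -> T),
    [/\ (5 <= n)%N,
        {in [pred i | 1 <= i <= n] &, injective v}
          /\ (forall i, 1 <= i <= n -> v i \in C),
        joined (leq 5) (v 1) (v 2) && joined (leq 5) (v n.-1) (v n),
        forall i, 2 <= i <= n - 2 -> joined (pred1 3) (v i) (v i.+1)
      & [/\ not_joined (v 1) (v 3) || joined (pred1 3) (v 1) (v 3),
            not_joined (v (n - 2)) (v n)
              || joined (pred1 3) (v (n - 2)) (v n)
          & forall i j, 1 <= i < j -> j <= n ->
              j != i.+1 -> (i, j) != (1, 3) -> (i, j) != (n - 2, n) ->
              not_joined (v i) (v j)]]%N.

End Subdiagrams.

(* Main.v *)
From HB Require Import structures.
Require Import Defs.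
From mathcomp Require Import all_boot all_algebra all_field zify ring.
From mathcomp Require Import mathcomp_extra boolp classical_sets functions cardinality.

Set Implicit Arguments.
Unset Strict Implicit.
Unset Printing Implicit Defensive.

(** Let [H] be a reflection subgroup.  Call a mirror of [H] a reflection lying in
    [H].  The elements of [W] separated from [1] by no mirror of [H] form the
    fundamental chamber of [H]; they represent the cosets of [H], so for finite
    index they are the vertices of a finite graph: the element [p] is joined to
    [p s] by an edge of colour [s] if [p s] is again in the chamber, and carries
    a loop of colour [s] otherwise ([chamber_action]).  The relations
    [(s t)^k = 1] hold in this action, so the orbits of two colours with an odd
    [m s t] are even cycles or paths with loops at both ends; the half length of
    a cycle and the number of vertices of a path divide [m s t], and are at least
    the label of the edge [s t] unless they are [1].

    In the direction from diagrams to subgroups, restrict to an orbit [Y] of the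
    colours of one of the six subdiagrams, and suppose that it has more than one
    point.  Two counts collide.  Counting, at each vertex, the edges leading
    towards [1] gives [1 <= V - E + F], where [F] is the number of bicoloured
    cycles which are full, that is, whole cosets of their dihedral group
    ([euler_inequality]).  On the other hand the large labels make paths and
    cycles long and hence rare ([pair_inequality], [tops_le_cyclic]), while no
    vertex carries all the loops, so that any spanning tree of colours sees an
    end of a nontrivial path at each loop ([tree_bound]).  Averaging the tree
    bound over suitable trees refutes the Euler inequality ([no_A], [no_B],
    [no_C_sparse], [no_D], [no_E], [no_F]).  For four vertices of type C with
    all six pairs joined the averages do not suffice and the inequality is
    refuted by moving weights between neighbouring vertices ([no_full_C]).  So
    one colour of the subdiagram acts trivially, with it its whole component
    because the labels are odd ([rigid_component]), and [H] is not proper.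

    Conversely, a finite set with an action of [W] whose moving points follow the
    Cayley graph gives a proper reflection subgroup, the stabilizer of a point
    ([reflection_subgroup_of_action]).  If a component contains none of the six
    subdiagrams, then without A and B two adjacent edges labelled at least [5]
    are labelled exactly [5] and close up to a triangle by a [3]; without C and F
    the edges labelled at least [5] are connected to each other, because a
    shortest chain between two groups of them would give one of these two
    diagrams; without D and E there are then at most two such edges.  For none,
    one and two of them a star, a path with leaves and a wheel are the required
    actions ([star_subgroup], [path_subgroup], [wheel_subgroup]). *)

(** * Actions of a Coxeter group, and the walls that an element crosses *)

Section CoxeterAction.
Local Open Scope group_scope.
Variables (S : finType) (m : coxeter_matrix S).
Local Notation W := (coxeter_group m).
Local Notation gen := (cox_gen m).

Section Action.
Variables (T : Type) (sigma : S -> T -> T).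

Definition cox_rels : Prop := forall i j k, m i j = Some k ->
  forall x, iter k (fun y => sigma j (sigma i y)) x = x.

Definition word_act (w : word S) (x : T) : T :=
  foldl (fun y a => sigma a.1 y) x w.

(** Words act from the left to the right, hence this is a right action
    ([cox_actM]). *)
Definition cox_act (g : W) (x : T) : T := word_act (repr g) x.

Hypothesis sigma_rels : cox_rels.

Lemma sigmaK s : involutive (sigma s).
Proof. by move=> x; apply: (sigma_rels (cox_diag m s)). Qed.

Lemma word_act_cat u v x : word_act (u ++ v) x = word_act v (word_act u x).
Proof. by rewrite /word_act foldl_cat. Qed.

(** The universal property of the presentation; letters are involutions, so
    their signs can be ignored. *)
Lemma word_act_rel u v x : pres_rel (coxeter_relators m) u v ->
  word_act u x = word_act v x.
Proof.
move=> uv; elim: uv x => {u v} [//|u v _ IH|u v w _ IH1 _ IH2|u v s b|u v r Rr] x.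
- by rewrite IH.
- by rewrite IH1.
- by rewrite !word_act_cat /= sigmaK.
case: Rr => i [j [k [mij ->]]]; rewrite !word_act_cat; congr (word_act v _).
rewrite -[RHS](sigma_rels mij (word_act u x)).
by elim: k {mij} (word_act u x) => //= k IH y; rewrite IH -iterSr.
Qed.

Lemma cox_act1 x : cox_act 1 x = x.
Proof. exact: (word_act_rel x (pres_repr _ [::])). Qed.

Lemma cox_actM g h x : cox_act (g * h) x = cox_act h (cox_act g x).
Proof. by rewrite /cox_act -word_act_cat; apply/word_act_rel/pres_repr. Qed.

Lemma cox_act_gen s x : cox_act (gen s) x = sigma s x.
Proof. exact: (word_act_rel x (pres_repr _ [:: (s, true)])). Qed.

End Action.

Lemma gen_sqr s : gen s * gen s = 1.
Proof.
apply: pres_piE; apply: pres_trans (pres_catl _ (pres_repr _ _)) _.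
apply: pres_trans (pres_catr _ (pres_repr _ _)) _.
rewrite -[X in pres_rel _ X]cats0 -[X in pres_rel _ X]cat0s.
rewrite -[X in pres_rel _ X]cat0s; apply: (@pres_relator _ _ [::] [::]).
by exists s, s, 1%N; rewrite cox_diag.
Qed.

Lemma genV s : (gen s)^-1 = gen s.
Proof. by apply: mulg1_eq; apply: gen_sqr. Qed.

Lemma genK s (g : W) : gen s * (gen s * g) = g.
Proof. by rewrite mulgA gen_sqr mul1g. Qed.

Lemma mulgenK s (g : W) : g * gen s * gen s = g.
Proof. by rewrite -mulgA gen_sqr mulg1. Qed.

Definition gprod (l : seq S) : W := \prod_(s <- l) gen s.

Lemma gprod_nil : gprod [::] = 1.
Proof. by rewrite /gprod big_nil. Qed.

Lemma gprod_cons s l : gprod (s :: l) = gen s * gprod l.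
Proof. by rewrite /gprod big_cons. Qed.

Lemma gprod_cat l1 l2 : gprod (l1 ++ l2) = gprod l1 * gprod l2.
Proof. by rewrite /gprod big_cat. Qed.

Lemma gprod_rcons l s : gprod (rcons l s) = gprod l * gen s.
Proof. by rewrite -cats1 gprod_cat gprod_cons gprod_nil mulg1. Qed.

Lemma gprodV l : (gprod l)^-1 = gprod (rev l).
Proof.
elim: l => [|s l IH]; first by rewrite gprod_nil invg1.
by rewrite gprod_cons invgM IH rev_cons gprod_rcons genV.
Qed.

Lemma pres_pi_cat (u v : word S) :
  pres_pi (coxeter_relators m) (u ++ v) =
  (pres_pi (coxeter_relators m) u : W) * (pres_pi (coxeter_relators m) v : W).
Proof.
apply: pres_piE; apply: pres_sym.
apply: pres_trans (pres_catl _ (pres_repr _ _)) _.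
exact: pres_catr (pres_repr _ _).
Qed.

Lemma gprodP (g : W) : exists l, g = gprod l.
Proof.
rewrite -[g]pres_pi_repr; elim: (repr g) => [|[s b] u [l IH]].
  by exists [::]; rewrite gprod_nil.
exists (s :: l); rewrite gprod_cons -IH -cat1s pres_pi_cat; congr (_ * _).
case: b => //; rewrite -[RHS]genV; apply/esym/mulg1_eq.
rewrite -pres_pi_cat; apply: pres_piE.
exact: (@pres_cancel _ _ [::] [::]).
Qed.

Lemma gen_rel i j k : m i j = Some k -> (gen i * gen j) ^+ k = 1.
Proof.
move=> mij.
have -> : (gen i * gen j) ^+ k =
    pres_pi (coxeter_relators m) (flatten (nseq k [:: (i, true); (j, true)])).
  elim: {mij} k => [|k IH]; first by rewrite expg0.
  rewrite expgS IH; set u := flatten _.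
  by rewrite -[flatten _]/([:: (i, true)] ++ ([:: (j, true)] ++ u))
             !pres_pi_cat mulgA.
apply: pres_piE; rewrite -[flatten _]cat0s -[flatten _]cats0.
apply: (@pres_relator _ _ [::] [::]); by exists i, j, k.
Qed.

Lemma is_reflectionP (t : W) :
  is_reflection t <-> exists (s : S) g, t = g * gen s * g^-1.
Proof.
split=> [[s [g ->]]|[s [g ->]]].
  by exists s, g^-1; rewrite invgK conjgE mulgA.
by exists s, g^-1; rewrite conjgE invgK mulgA.
Qed.

(** The letter [s] conjugates the reflection and flips the sign when it meets its
    own wall.  The sign accumulated along a word for [g] is the parity of the
    crossings of a wall, and depends on [g] only by [hit_rels]. *)
Definition hit (s : S) (x : W * bool) : W * bool :=
  (x.1 ^ gen s, x.2 (+) (x.1 == gen s)).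

Lemma dihedral_invert (i j : S) n :
  gen i * (gen i * gen j) ^+ n * gen i = (gen i * gen j) ^- n.
Proof.
elim: n => [|n IH]; first by rewrite expg0 mulg1 gen_sqr invg1.
rewrite [in LHS]expgS [in RHS]expgSr invgM -IH invgM !genV.
by rewrite !mulgA gen_sqr mul1g mulgenK.
Qed.

Lemma dihedral_conjl (i j : S) n (z := gen i * gen j) :
  z ^+ n * gen i * z ^- n = z ^+ n.*2 * gen i.
Proof.
by rewrite -dihedral_invert -/z -!mulgA genK [in LHS]mulgA -expgnDr addnn.
Qed.

Lemma dihedral_conjr (i j : S) n (z := gen i * gen j) :
  (z ^+ n * gen i) * gen j * (z ^+ n * gen i)^-1 = z ^+ n.*2.+1 * gen i.
Proof.
have zV := dihedral_invert i j n.
rewrite -/z in zV; rewrite invgM genV -!mulgA.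
rewrite [gen i * (gen j * _)]mulgA -/z; clearbody z.
by rewrite -zV -!mulgA genK !mulgA -expgSr -expgnDr addSn addnn.
Qed.

Lemma conj_eq (r g x : W) : (r ^ g == x) = (r == g * x * g^-1).
Proof.
by rewrite conjgE; apply/eqP/eqP=> [<-|->]; rewrite ?mulVKg ?mulgK ?mulgVK ?mulKg.
Qed.

(** Along the word [(ij)^k] the reflection [r] is hit once for each [n < 2k] with
    [r = (ij)^n i].  As [(ij)^k = 1], each of these occurs twice, so the sign does
    not change. *)
Lemma hit_rels : cox_rels hit.
Proof.
move=> i j k mij [r e].
set z := gen i * gen j.
have zk : z ^+ k = 1 by apply: gen_rel.
pose hits n : nat := (r == z ^+ n * gen i).
have E l : iter l (fun y => hit j (hit i y)) (r, e) =
    (r ^ (z ^+ l), e (+) odd (\sum_(n < l.*2) hits n)%N).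
  elim: l => [|l IH]; first by rewrite /= expg0 conjg1 big_ord0 addbF.
  rewrite iterS IH /hit /= doubleS !big_ord_recr /= expgSr conjgM conjgM.
  congr pair; rewrite !oddD !oddb !addbA; congr (_ (+) _); last first.
    by rewrite -!conjgM conj_eq dihedral_conjr.
  by rewrite conj_eq dihedral_conjl.
rewrite E zk conjg1 -addnn big_split_ord /=.
rewrite [X in (_ + X)%N](_ : _ = \sum_(n < k) hits n)%N; last first.
  by apply: eq_bigr => n _; rewrite /hits expgnDr zk mul1g.
by rewrite addnn odd_double addbF.
Qed.

(** For a reflection [r]: the wall of [r] separates [1] and [g]. *)
Definition crosses (g r : W) : bool := (cox_act hit g (r, false)).2.

Lemma cox_act_hit g r e : cox_act hit g (r, e) = (r ^ g, e (+) crosses g r).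
Proof.
have [l ->] := gprodP g; rewrite /crosses.
elim: l r e => [|s l IH] r e.
  by rewrite gprod_nil !(cox_act1 hit_rels) conjg1 addbF.
rewrite gprod_cons !(cox_actM hit_rels) !(cox_act_gen hit_rels) /hit /=.
by rewrite IH [in RHS]IH conjgM /= addbA.
Qed.

Lemma crosses1 r : crosses 1 r = false.
Proof. by rewrite /crosses (cox_act1 hit_rels). Qed.

(** The cocycle identity, which makes all later use of walls formal. *)
Lemma crossesM g h r : crosses (g * h) r = crosses g r (+) crosses h (r ^ g).
Proof. by rewrite {1}/crosses (cox_actM hit_rels) !cox_act_hit. Qed.

Lemma crosses_gen s r : crosses (gen s) r = (r == gen s).
Proof. by rewrite /crosses (cox_act_gen hit_rels). Qed.

Lemma crossesV g r : crosses g^-1 r = crosses g (r ^ g^-1).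
Proof.
have := crossesM g^-1 g r.
by rewrite mulVg crosses1; case: crosses => [] /=; case: crosses.
Qed.

End CoxeterAction.

(** * Products of two generators with an infinite label have infinite order *)

Section Representation.
Import GRing.Theory Num.Theory.
Variables (S : finType) (m : coxeter_matrix S).
Hypothesis m_odd : odd_angled m.
Local Notation W := (coxeter_group m).
Local Notation gen := (cox_gen m).
Local Open Scope ring_scope.

Section Game.
Variables (F : numFieldType) (w_ : nat -> F).
Hypothesis w_root : forall k, odd k -> (1 < k)%N ->
  [/\ w_ k ^+ k = 1, w_ k ^+ 2 != 1 & w_ k != 0].

(** The usual form has the entries [- 2 cos (pi / k)].  For the two facts
    below, any [k]-th root of unity [w] with [w^2 <> 1] serves as well, and it
    can be taken in any field with enough roots of unity. *)
Definition cox_form (i j : S) : F :=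
  if i == j then 2
  else if m i j is Some k then - (w_ k + (w_ k)^-1) else - 2.

Lemma cox_formC i j : cox_form i j = cox_form j i.
Proof. by rewrite /cox_form eq_sym cox_sym. Qed.

(** The contragredient of the reflection representation: [c u] is the value of
    a linear form at the simple root [u]. *)
Definition game (s : S) (c : {ffun S -> F}) : {ffun S -> F} :=
  [ffun u => c u - cox_form u s * c s].

Lemma iter_eigen (T : Type) (f : T -> T) (L : T -> F) q k x :
  (forall y, L (f y) = q * L y) -> L (iter k f x) = q ^+ k * L x.
Proof.
move=> Lf; elim: k => [|k IH] /=; first by rewrite expr0 mul1r.
by rewrite Lf IH exprS mulrA.
Qed.

(** The composite [f] of two moves has the eigenvectors [la], [mu] with the
    eigenvalues [w^2], [w^-2] in the plane of [i] and [j], and each coordinate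
    [u] has a combination [nu] fixed by [f].  All eigenvalues are [k]-th roots
    of unity, so the [k]-th power is the identity. *)
Lemma game_rels : cox_rels m game.
Proof.
move=> i j k mij c; have [eq_ij|neq_ij] := eqVneq i j.
  move: mij; rewrite {}eq_ij cox_diag => -[<-] /=; apply/ffunP=> u.
  by rewrite !ffunE /cox_form eqxx; ring.
have k_odd := m_odd neq_ij mij; have k_ge2 := cox_ge2 neq_ij mij.
have [wk w2 w_neq0] := w_root k_odd k_ge2; set w := w_ k in wk w2 w_neq0.
have bij : cox_form i j = - (w + w^-1) by rewrite /cox_form (negbTE neq_ij) mij.
have bji : cox_form j i = - (w + w^-1) by rewrite cox_formC.
have bii s : cox_form s s = 2 by rewrite /cox_form eqxx.
pose f := fun y => game j (game i y); rewrite -/f; set c' := iter k f c.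
pose la (y : {ffun S -> F}) := y j + w * y i.
pose mu (y : {ffun S -> F}) := y j + w^-1 * y i.
have w2k : (w ^+ 2) ^+ k = 1 by rewrite exprAC wk expr1n.
have laE : la c' = la c.
  rewrite (@iter_eigen _ f la (w ^+ 2)) ?w2k ?mul1r // => y.
  by rewrite /la !ffunE bij bji !bii; field.
have muE : mu c' = mu c.
  rewrite (@iter_eigen _ f mu (w ^- 2)) ?exprVn ?w2k ?invr1 ?mul1r // => y.
  by rewrite /mu !ffunE bij bji !bii; field.
have w_diff : w - w^-1 != 0.
  apply: contra w2; rewrite subr_eq0 => /eqP wV.
  by rewrite expr2 {2}wV mulfV.
have ciE : c' i = c i.
  apply: (mulfI w_diff); have : la c' - mu c' = la c - mu c by rewrite laE muE.
  by rewrite /la /mu => H; transitivity (c' j + w * c' i - (c' j + w^-1 * c' i)); [ring|rewrite H; ring].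
have cjE : c' j = c j by move: laE; rewrite /la ciE => /addIr.
apply/ffunP=> u.
pose b := cox_form i j; have den : 4 - b ^+ 2 != 0.
  have -> : 4 - b ^+ 2 = - (w - w^-1) ^+ 2 by rewrite /b bij; field.
  by rewrite oppr_eq0 sqrf_eq0.
(* Solve for the combination fixed by both moves. *)
pose al := (b * cox_form u j - 2 * cox_form u i) / (4 - b ^+ 2).
pose be := (b * cox_form u i - 2 * cox_form u j) / (4 - b ^+ 2).
pose nu (y : {ffun S -> F}) := y u + al * y i + be * y j.
have nuE : nu c' = nu c.
  rewrite (@iter_eigen _ f nu 1) ?expr1n ?mul1r // => y.
  rewrite /nu !ffunE !bii [cox_form j i]cox_formC -/b mul1r /al /be; field.
  by rewrite den.
by move: nuE; rewrite /nu ciE cjE => /addIr /addIr.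
Qed.

Lemma gen_neq s t : s != t -> gen s <> gen t.
Proof.
move=> neq_st gst.
pose c : {ffun S -> F} := [ffun u => (u == s)%:R].
have : cox_act game (gen s) c = cox_act game (gen t) c by rewrite gst.
rewrite !(cox_act_gen game_rels) => /ffunP/(_ s).
rewrite !ffunE !eqxx [t == s]eq_sym (negbTE neq_st) mulr0 subr0 /cox_form eqxx.
rewrite mulr1 => /eqP; rewrite subr_eq -subr_eq0 opprD addrA subrr sub0r.
by rewrite oppr_eq0 pnatr_eq0.
Qed.

Lemma cox_act_iter (T : Type) (sigma : S -> T -> T) i j n x :
  cox_rels m sigma ->
  cox_act (m := m) sigma ((gen i * gen j) ^+ n)%g x =
  iter n (fun y => sigma j (sigma i y)) x.
Proof.
move=> rels; elim: n => [|n IH]; first by rewrite expg0 (cox_act1 rels).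
by rewrite expgSr !(cox_actM rels) !(cox_act_gen rels) IH.
Qed.

(** With the form entry [-2] the two moves act unipotently, and the coordinate
    [i] grows linearly. *)
Lemma gen_free i j n : m i j = None -> ((gen i * gen j) ^+ n.+1)%g <> 1%g.
Proof.
move=> mij eq1; pose c : {ffun S -> F} := [ffun u => (u == i)%:R].
have neq_ij : i != j.
  by apply/eqP=> eq_ij; move: mij; rewrite eq_ij cox_diag.
have bij : cox_form i j = - 2 by rewrite /cox_form (negbTE neq_ij) mij.
have bji : cox_form j i = - 2 by rewrite cox_formC.
have bii s : cox_form s s = 2 by rewrite /cox_form eqxx.
pose f := fun y => game j (game i y).
have := congr1 (fun g => cox_act game g c) eq1.
rewrite /= (cox_act_iter _ _ _ _ game_rels) (cox_act1 game_rels).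
rewrite -/f.
have H k : (iter k f c i = 1 + (k.*2)%:R) /\ iter k f c i + iter k f c j = 1.
  elim: k => [|k [IH1 IH2]].
    by rewrite /= !ffunE eqxx eq_sym (negbTE neq_ij) addr0.
  rewrite iterS; set y := iter k f c in IH1 IH2 *.
  have yj : y j = 1 - y i by rewrite -IH2; ring.
  rewrite /f !ffunE bij bji !bii yj IH1 doubleS -addn2 natrD.
  by split; ring.
move/ffunP/(_ i); rewrite (H n.+1).1 ffunE eqxx => /eqP.
by rewrite -subr_eq0 addrAC subrr add0r pnatr_eq0.
Qed.

End Game.

Lemma prim_roots : exists w_ : nat -> algC, forall k, odd k -> (1 < k)%N ->
  [/\ w_ k ^+ k = 1, w_ k ^+ 2 != 1 & w_ k != 0].
Proof.
pose w_ k : algC := if k is k'.+1 then sval (C_prim_root_exists (ltn0Sn k')) else 1.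
exists w_ => -[//|k] k_odd k_gt1.
have w_prim : k.+1.-primitive_root (w_ k.+1) by rewrite /w_; case: C_prim_root_exists.
have wk := prim_expr_order w_prim; split=> //.
  by rewrite -(prim_order_dvd w_prim); apply/negP=> /dvdn_leq; lia.
apply/eqP=> w0; move: wk; rewrite w0 expr0n => /esym/eqP.
by rewrite oner_eq0.
Qed.

Lemma gen_inj : injective gen.
Proof.
have [w_ w_root] := prim_roots.
by move=> s t gst; apply/eqP/negPn/negP=> /(gen_neq w_root).
Qed.

Lemma gen_infinite i j n : m i j = None -> ((gen i * gen j) ^+ n.+1)%g <> 1%g.
Proof. by have [w_ w_root] := prim_roots; apply: (gen_free w_root). Qed.

End Representation.

(** * The chamber of a reflection subgroup *)

Section Exchange.
Local Open Scope group_scope.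
Variables (S : finType) (m : coxeter_matrix S).
Local Notation W := (coxeter_group m).
Local Notation gen := (cox_gen m).

Lemma gen_neq1 s : gen s <> 1.
Proof.
move=> g1; have := crosses_gen s (gen s : W).
by rewrite eqxx {1}g1 crosses1.
Qed.

Definition lprod (l : seq W) : W := \prod_(x <- l) x.

Lemma lprod_nil : lprod [::] = 1.
Proof. by rewrite /lprod big_nil. Qed.

Lemma lprod_cons x l : lprod (x :: l) = x * lprod l.
Proof. by rewrite /lprod big_cons. Qed.

Lemma lprod_cat l1 l2 : lprod (l1 ++ l2) = lprod l1 * lprod l2.
Proof. by rewrite /lprod big_cat. Qed.

Lemma lprod_map l : lprod [seq gen s | s <- l] = gprod m l.
Proof. by rewrite /lprod /gprod big_map. Qed.

Section Deletion.
Variables Delta R : W -> Prop.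
Hypothesis DeltaR : forall d, Delta d -> R d.
Hypothesis Delta_sqr : forall d, Delta d -> d * d = 1.
Hypothesis Delta_crosses : forall d r, Delta d -> R r -> crosses d r = (r == d).
Hypothesis R_conj : forall d r, Delta d -> R r -> R (r ^ d).

(** The exchange argument, for a set [Delta] of reflections which cross, among
    the walls in [R], only their own.  It applies to the simple generators
    of a dihedral subgroup as well as to the walls of a chamber. *)
Lemma exchange l r : {in l, forall d, Delta d} -> R r -> crosses (lprod l) r ->
  exists l1 d l2, l = l1 ++ d :: l2 /\ r = lprod l1 * d * (lprod l1)^-1.
Proof.
elim: l r => [|d l IH] r lD Rr; first by rewrite lprod_nil crosses1.
have Dd : Delta d by apply: lD; rewrite mem_head.
rewrite lprod_cons crossesM (Delta_crosses Dd Rr).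
have [-> _|_ /= cr] := eqVneq r d.
  by exists [::], d, l; rewrite lprod_nil mul1g invg1 mulg1.
have [||l1 [d' [l2 [-> rE]]]] := IH _ _ _ cr.
- by move=> x xl; apply: lD; rewrite inE xl orbT.
- exact: R_conj.
exists (d :: l1), d', l2; split=> //; rewrite lprod_cons invgM.
by rewrite -(conjgK d r) rE conjgE invgK !mulgA.
Qed.

(** If no wall in [R] is crossed then the wall of the first letter is crossed again
    later on; [exchange] finds where, the two letters cancel, and the word shrinks
    to the empty one. *)
Lemma deletion l : {in l, forall d, Delta d} ->
  (forall r, R r -> ~~ crosses (lprod l) r) -> lprod l = 1.
Proof.
have [n] := ubnP (size l); elim: n l => // n IH [|d l] /=.
  by rewrite lprod_nil.
rewrite ltnS => size_l lD noc.
have Dd : Delta d by apply: lD; rewrite mem_head.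
have lD' : {in l, forall d, Delta d}.
  by move=> x xl; apply: lD; rewrite inE xl orbT.
have := noc d (DeltaR Dd); rewrite lprod_cons crossesM.
rewrite Delta_crosses ?eqxx //; last exact: DeltaR.
have -> : d ^ d = d by rewrite conjgE mulgA mulVg mul1g.
rewrite negbK => cd.
have [l1 [d' [l2 [lE dE]]]] := exchange lD' (DeltaR Dd) cd.
have lE' : d * lprod l = lprod (l1 ++ l2).
  have d'2 : d' * d' = 1.
    by apply/Delta_sqr/lD'; rewrite lE mem_cat mem_head orbT.
  rewrite lE !lprod_cat lprod_cons {1}dE !mulgA mulgVK.
  by rewrite -(mulgA _ d' d') d'2 mulg1.
rewrite lE'; apply: IH.
- by move: size_l; rewrite lE !size_cat /=; lia.
- move=> x xl; apply: lD'; rewrite lE mem_cat inE.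
  by move: xl; rewrite mem_cat => /orP[->|->]; rewrite ?orbT.
- by move=> r Rr; rewrite -lE' -lprod_cons; apply: noc.
Qed.

End Deletion.

Lemma word_exchange l r : crosses (gprod m l) r ->
  exists l1 s l2, l = l1 ++ s :: l2 /\ r = gprod m l1 * gen s * (gprod m l1)^-1.
Proof.
elim: l r => [|s l IH] r; first by rewrite gprod_nil crosses1.
rewrite gprod_cons crossesM crosses_gen.
have [-> _|_ /= cr] := eqVneq r (gen s).
  by exists [::], s, l; rewrite gprod_nil mul1g invg1 mulg1.
have [l1 [s' [l2 [-> rE]]]] := IH _ cr.
exists (s :: l1), s', l2; split=> //; rewrite gprod_cons invgM.
by rewrite -(conjgK (gen s) r) rE conjgE invgK !mulgA.
Qed.

Lemma word_length_ex (g : W) : exists n, `[< exists2 l, g = gprod m l & size l = n >].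
Proof. by have [l gE] := gprodP g; exists (size l); apply/asboolP; exists l. Qed.

Definition cox_length (g : W) : nat := ex_minn (word_length_ex g).

Lemma cox_lengthP g : exists2 l, g = gprod m l & size l = cox_length g.
Proof. by rewrite /cox_length; case: ex_minnP => n /asboolP. Qed.

Lemma cox_length_le l : cox_length (gprod m l) <= size l.
Proof.
rewrite /cox_length; case: ex_minnP => n _; apply.
by apply/asboolP; exists l.
Qed.

(** Crossing back a crossed wall deletes a letter from a shortest word. *)
Lemma cox_length_crosses g r : crosses g r -> cox_length (r * g) < cox_length g.
Proof.
have [l gE size_l] := cox_lengthP g; rewrite {1}gE => /word_exchange.
case=> l1 [s [l2 [lE ->]]].
have -> : gprod m l1 * gen s * (gprod m l1)^-1 * g = gprod m (l1 ++ l2).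
  rewrite gE lE !gprod_cat gprod_cons mulgA mulgVK.
  by rewrite mulgA mulgenK.
apply: leq_ltn_trans (cox_length_le _) _.
by rewrite -size_l lE !size_cat /= addnS ltnS.
Qed.

End Exchange.

Section ReflectionSubgroup.
Local Open Scope group_scope.
Variables (S : finType) (m : coxeter_matrix S).
Local Notation W := (coxeter_group m).
Local Notation gen := (cox_gen m).
Local Open Scope classical_set_scope.

Lemma generated_is_subgroup (A : set W) : is_subgroup (generated_subgroup A).
Proof.
split=> [B [[B1 _ _] _] //|x y Hx Hy B BA|x Hx B BA].
  by have [[_ BM _] _] := BA; apply: BM; [apply: Hx|apply: Hy].
by have [[_ _ BV] _] := BA; apply: BV; apply: Hx.
Qed.

Lemma generated_sub (A B : set W) :
  is_subgroup B -> A `<=` B -> generated_subgroup A `<=` B.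
Proof. by move=> sB AB x; apply. Qed.

Lemma sub_generated (A : set W) : A `<=` generated_subgroup A.
Proof. by move=> x Ax B [_]; apply. Qed.

Section Chamber.
Variables (A : set W) (A_refl : A `<=` @is_reflection S m).
Let H := generated_subgroup A.

Let H1 : H 1. Proof. by have [] := generated_is_subgroup A. Qed.
Let HM x y : H x -> H y -> H (x * y).
Proof. by have [_ HM _] := generated_is_subgroup A; apply: HM. Qed.
Let HV x : H x -> H x^-1.
Proof. by have [_ _] := generated_is_subgroup A; apply. Qed.

Lemma reflection_conj (t g : W) : is_reflection t -> is_reflection (t ^ g).
Proof. by case=> s [h ->]; exists s, (h * g); rewrite conjgM. Qed.

Lemma reflection_sqr (t : W) : is_reflection t -> t * t = 1.
Proof. by case=> s [g ->]; rewrite -conjMg gen_sqr conj1g. Qed.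

Definition mirror (r : W) : Prop := is_reflection r /\ H r.

Lemma mirror_conj h r : H h -> mirror r -> mirror (r ^ h).
Proof.
move=> Hh [refl_r Hr]; split; first exact: reflection_conj.
by rewrite conjgE; apply: HM; [apply: HV|apply: HM].
Qed.

Definition chamber : set W := [set p | forall r, mirror r -> ~~ crosses p r].

(** The mirrors of [H] which bound the chamber: those between an element [p] of
    the chamber and a neighbour [p s]. *)
Definition wall (d : W) : Prop :=
  exists p s, [/\ chamber p, d = p * gen s * p^-1 & H d].

Lemma wall_reflection p s : is_reflection (p * gen s * p^-1).
Proof. by apply/is_reflectionP; exists s, p. Qed.

Lemma wall_mirror d : wall d -> mirror d.
Proof. by case=> p [s [_ -> Hd]]; split=> //; apply: wall_reflection. Qed.

Lemma chamber_step p s : chamber p -> ~ H (p * gen s * p^-1) ->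
  chamber (p * gen s).
Proof.
move=> Pp Hn r Rr; rewrite crossesM (negbTE (Pp r Rr)) /= crosses_gen conj_eq.
by apply/eqP=> rE; apply: Hn; rewrite -rE; case: Rr.
Qed.

Lemma chamber1 : chamber 1.
Proof. by move=> r _; rewrite crosses1. Qed.

(** The elements [p] and [p s] on the two sides of a wall [d] differ by the wall
    of [d] only, and [p] is on the side of [1]. *)
Lemma wall_crosses d r : wall d -> mirror r -> crosses d r = (r == d).
Proof.
move=> Wd Rr; have [p [s [Pp dE Hd]]] := Wd.
rewrite {1}dE !crossesM crosses_gen conj_eq -dE (negbTE (Pp r Rr)) /=.
suff -> : crosses p^-1 (r ^ (p * gen s)) = false by rewrite addbF.
rewrite crossesV; apply/negbTE.
have -> : (r ^ (p * gen s)) ^ p^-1 = r ^ d by rewrite -conjgM dE.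
by apply: Pp; apply: mirror_conj.
Qed.

(** Follow a word for [w]; each time it leaves the chamber, reflect the rest of
    it back. *)
Lemma wall_decomp w : exists l p,
  [/\ {in l, forall d, wall d}, chamber p & w = lprod l * p].
Proof.
have [u ->] := gprodP w; elim/last_ind: u => [|u s [l [p [lW Pp uE]]]].
  by exists [::], 1; rewrite gprod_nil lprod_nil mulg1; split=> //; apply: chamber1.
rewrite gprod_rcons uE.
have [Hd|Hd] := pselect (H (p * gen s * p^-1)); last first.
  by exists l, (p * gen s); rewrite mulgA; split=> //; apply: chamber_step.
exists (rcons l (p * gen s * p^-1)), p; split=> //.
  by move=> d; rewrite mem_rcons inE => /orP[/eqP->|/lW//]; exists p, s.
by rewrite -cats1 lprod_cat lprod_cons lprod_nil mulg1 !mulgA mulgVK.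
Qed.

Lemma wallV (l : seq W) : {in l, forall d, wall d} ->
  {in rev l, forall d, wall d} /\ (lprod l)^-1 = lprod (rev l).
Proof.
move=> lW; split=> [d|]; first by rewrite mem_rev; apply: lW.
elim: l lW => [|d l IH] lW; first by rewrite lprod_nil invg1.
have Wd : wall d by apply: lW; rewrite mem_head.
rewrite lprod_cons invgM IH => [|x xl]; last by apply: lW; rewrite inE xl orbT.
rewrite rev_cons -cats1 lprod_cat lprod_cons lprod_nil mulg1; congr (_ * _).
by apply/mulg1_eq/reflection_sqr; have [] := wall_mirror Wd.
Qed.

Lemma lprod_in_H l : {in l, forall d, wall d} -> H (lprod l).
Proof.
elim: l => [|d l IH] lW; first by rewrite lprod_nil.
rewrite lprod_cons; apply: HM.
  by have [] := wall_mirror (lW d (mem_head _ _)).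
by apply: IH => x xl; apply: lW; rewrite inE xl orbT.
Qed.

(** The walls of the chamber generate: carry a reflection [g s g^-1] in [H] back to
    the chamber along the decomposition of [g]; it becomes a wall. *)
Lemma wall_generated h : H h ->
  exists2 l, {in l, forall d, wall d} & h = lprod l.
Proof.
pose B : set W := [set h | exists2 l, {in l, forall d, wall d} & h = lprod l].
apply: (@generated_sub A B) => [|t At].
  split=> [|x y [l1 l1W ->] [l2 l2W ->]|x [l lW ->]].
  - by exists [::] => //; rewrite lprod_nil.
  - exists (l1 ++ l2); last by rewrite lprod_cat.
    by move=> d; rewrite mem_cat => /orP[/l1W|/l2W].
  - by have [lW' ->] := wallV lW; exists (rev l).
have Ht : H t by apply: sub_generated.
have [s [g tE]] := (is_reflectionP t).1 (A_refl At).
have [l [p [lW Pp gE]]] := wall_decomp g.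
have [lW' lV] := wallV lW.
pose d := p * gen s * p^-1.
have tE' : t = lprod l * d * (lprod l)^-1 by rewrite tE gE invgM /d !mulgA.
have Wd : wall d.
  exists p, s; split=> //.
  have -> : d = (lprod l)^-1 * t * lprod l.
    by rewrite tE' (mulgA (lprod l)^-1%g) mulKg mulgVK.
  by apply: HM; [apply: HM => //; apply: HV|]; apply: lprod_in_H.
exists (l ++ d :: rev l); last by rewrite lprod_cat lprod_cons tE' lV !mulgA.
by move=> x; rewrite mem_cat inE => /or3P[/lW|/eqP->|/lW'].
Qed.

(** By [wall_crosses] the walls of the chamber behave in [H] as the simple
    generators do in [W], so that [deletion] applies. *)
Lemma crossed_by_mirror h : H h -> (forall r, mirror r -> ~~ crosses h r) -> h = 1.
Proof.
case/wall_generated=> l lW ->; apply: (@deletion _ _ wall mirror) => //.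
- exact: wall_mirror.
- by move=> d /wall_mirror[/reflection_sqr].
- exact: wall_crosses.
- by move=> d r /wall_mirror[_ Hd]; apply: mirror_conj.
Qed.

(** The chamber meets each coset [H p] once. *)
Lemma chamber_inj h p : H h -> chamber p -> chamber (h * p) -> h = 1.
Proof.
move=> Hh Pp Php; apply: crossed_by_mirror => // r Rr.
have := Php r Rr; rewrite crossesM.
by rewrite (negbTE (Pp _ (mirror_conj Hh Rr))) addbF.
Qed.

Lemma finite_chamber : finite_index H -> finite_set chamber.
Proof.
move=> fin.
(* [finite_index] speaks of the cosets [g H], while the chamber represents the
   cosets [H g]. *)
pose f (p : W) : set W := [set p^-1 * h | h in H].
have fin' : finite_set (f @` chamber).
  by apply: sub_finite_set fin => _ [p _ <-]; exists p^-1.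
pose g C : W := xget 1 [set p | chamber p /\ f p = C].
apply: sub_finite_set (finite_image g fin') => p Pp; exists (f p); first by exists p.
rewrite /g; case: xgetP => [q _ [Pq fqp]|/(_ p)]; last by case.
have : f q q^-1 by exists 1; rewrite ?mulg1.
rewrite fqp => -[h Hh hE].
have qE : q = h^-1 * p by rewrite -[q]invgK -hE invgM invgK.
have h1 : h^-1 = 1 by apply: (chamber_inj (HV Hh) Pp); rewrite -qE.
by rewrite qE h1 mul1g.
Qed.

(** The wall of [r] has all the image of [rho] on one side. *)
Definition crossing_free (X : finType) (rho : X -> W) (r : W) : Prop :=
  forall x, ~~ crosses (rho x) r.

(** The data that all counting arguments use.  The vertices are the elements of
    the chamber, [rho] is their inclusion in [W], the moving points follow the
    Cayley graph, and a fixed point lies at a wall which the chamber does not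
    cross. *)
Lemma chamber_action : finite_index H -> H != setT ->
  exists (X : finType) (sigma : S -> X -> X) (rho : X -> W),
  [/\ cox_rels m sigma, injective rho,
      forall s x, sigma s x != x -> rho (sigma s x) = rho x * gen s,
      forall s x, sigma s x = x ->
        crossing_free rho (rho x * gen s * (rho x)^-1)
    & exists s x, sigma s x != x].
Proof.
move=> /finite_chamber/finite_seqP[e PE] Hproper.
have inP p : chamber p <-> p \in e by rewrite PE.
pose X : finType := seq_sub e.
pose sigma s (x : X) : X := insubd x (ssval x * gen s).
have sigmaE s x : ssval (sigma s x) =
    if ssval x * gen s \in e then ssval x * gen s else ssval x.
  by rewrite /sigma /insubd; case: insubP => [u -> <-|/negbTE ->].
have stay s (x : X) : ssval x * gen s \notin e ->
    H (ssval x * gen s * (ssval x)^-1).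
  move=> /negP xs; apply: contrapT => nH; apply: xs; apply/inP.
  by apply: chamber_step => //; apply/inP/ssvalP.
have sigmaH s (x : X) : exists2 h, H h & ssval (sigma s x) = h * (ssval x * gen s).
  rewrite sigmaE; case: ifPn => [_|/stay Hx]; first by exists 1; rewrite ?mul1g.
  by exists (ssval x * gen s * (ssval x)^-1) => //; rewrite !mulgA mulgVK mulgenK.
have move_val s x : sigma s x != x -> ssval (sigma s x) = ssval x * gen s.
  rewrite sigmaE; case: ifPn => // xs /eqP[]; apply: val_inj => /=.
  by rewrite sigmaE (negbTE xs).
exists X, sigma, (@ssval _ e); split=> //; last 1 first.
(* If nothing moves then all the generators are in [H]. *)
- apply: contrapT => noX; move/eqP: Hproper; apply; apply/seteqP; split=> // w _.
  have e1 : 1 \in e by apply/inP; apply: chamber1.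
  have Hgen s : H (gen s).
    have /negP sx : ~ sigma s (SeqSub e1) != SeqSub e1.
      by move=> sx; apply: noX; exists s, (SeqSub e1).
    have := @stay s (SeqSub e1); rewrite /= mul1g invg1 mulg1; apply.
    apply/negP=> se; move/negPn/eqP/(congr1 (@ssval _ e)): sx.
    by rewrite sigmaE /= mul1g se; apply: gen_neq1.
  have [l ->] := gprodP w; elim: l => [|s l IH]; first by rewrite gprod_nil.
  by rewrite gprod_cons; apply: HM.
(* The action is right multiplication modulo [H], and the chamber represents the
   cosets. *)
- move=> i j k mij x; apply: val_inj => /=.
  pose f := fun y => sigma j (sigma i y); rewrite -/f.
  have itH n : exists2 h, H h & ssval (iter n f x) = h * (ssval x * (gen i * gen j) ^+ n).
    elim: n => [|n [h Hh IH]]; first by exists 1; rewrite ?expg0 ?mulg1 ?mul1g.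
    rewrite iterS /f; have [h1 Hh1 ->] := sigmaH j (sigma i (iter n f x)).
    have [h2 Hh2 ->] := sigmaH i (iter n f x).
    exists (h1 * (h2 * h)); first by do 2!apply: HM => //.
    by rewrite IH expgSr !mulgA.
  have [h Hh itE] := itH k; rewrite gen_rel // mulg1 in itE.
  have Px : chamber (ssval x) by apply/inP/ssvalP.
  suff h1 : h = 1 by rewrite itE h1 mul1g.
  by apply: (chamber_inj Hh Px); rewrite -itE; apply/inP/ssvalP.
- exact: val_inj.
- move=> s x xs y; have Py : chamber (ssval y) by apply/inP/ssvalP.
  apply: Py; split; first exact: wall_reflection.
  apply: stay; apply/negP=> xse; have := sigmaE s x; rewrite xse xs.
  move/(congr1 ( *%g (ssval x)^-1)); rewrite mulKg mulVg => /esym.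
  exact: gen_neq1.
Qed.

End Chamber.
End ReflectionSubgroup.

(** * Words in two generators *)

Section Dihedral.
Local Open Scope group_scope.
Variables (S : finType) (m : coxeter_matrix S).
Local Notation W := (coxeter_group m).
Local Notation gen := (cox_gen m).
Local Notation gp := (gprod m).

Definition in2 (s t : S) (l : seq S) : bool := all (pred2 s t) l.

(** The reflections of the subgroup generated by [s] and [t], given by words,
    which treats a finite and an infinite order of [s t] alike. *)
Definition in2_refl (s t : S) (u : W) : Prop :=
  exists l d, [/\ in2 s t l, pred2 s t d & u = gp l * gen d * (gp l)^-1].

Lemma in2_reflC s t u : in2_refl s t u -> in2_refl t s u.
Proof.
have E : pred2 s t =1 pred2 t s by move=> x; rewrite /= orbC.
by case=> l [d [Hl Hd ->]]; exists l, d; rewrite /in2 -(eq_all E) -E.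
Qed.

Lemma in2_refl_gen s t d : pred2 s t d -> in2_refl s t (gen d).
Proof. by exists [::], d; rewrite gprod_nil mul1g invg1 mulg1. Qed.

Lemma in2_refl_conj s t l u : in2 s t l -> in2_refl s t u ->
  in2_refl s t (u ^ gp l).
Proof.
move=> Hl [l' [d [Hl' Hd ->]]]; exists (rev l ++ l'), d; split=> //.
  by rewrite /in2 all_cat all_rev; apply/andP.
by rewrite conjgE gprod_cat invgM -gprodV invgK !mulgA.
Qed.

Fixpoint altw (s t : S) (n : nat) : seq S :=
  if n is n'.+1 then s :: altw t s n' else [::].

Lemma size_altw s t n : size (altw s t n) = n.
Proof. by elim: n s t => //= n IH s t; rewrite IH. Qed.

Lemma pow_shift (a b : W) k : a * (b * a) ^+ k = (a * b) ^+ k * a.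
Proof.
elim: k => [|k IH]; first by rewrite !expg0 mulg1 mul1g.
by rewrite expgSr mulgA IH expgSr !mulgA.
Qed.

(** The prefix reflections of an alternating word are [s], [s t s], ...: the
    successive powers of [s t] times [s]. *)
Lemma altw_prefix s t n l1 d l2 : altw s t n = l1 ++ d :: l2 ->
  gp l1 * gen d * (gp l1)^-1 = (gen s * gen t) ^+ size l1 * gen s.
Proof.
elim: l1 s t n => [|x l1 IH] s t [|n] //= [].
  by move=> <- _; rewrite gprod_nil mul1g invg1 mulg1.
move=> <- /IH E; rewrite gprod_cons invgM genV.
transitivity (gen s * (gp l1 * gen d * (gp l1)^-1) * gen s).
  by rewrite !mulgA.
by rewrite E expgSr !mulgA pow_shift.
Qed.

(** A word in [s] and [t] that does not alternate contains a square. *)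
Lemma in2_shorten s t l : in2 s t l ->
  [\/ l = altw s t (size l), l = altw t s (size l) |
      exists l', [/\ in2 s t l', gp l' = gp l & size l' < size l]].
Proof.
elim: l => [|d l IH] /=; first by constructor 1.
case/andP=> Hd /IH[lE|lE|[l' [Hl' lE size_l']]]; last first.
- constructor 3; exists (d :: l'); rewrite !gprod_cons lE /= /in2 /=.
  by split=> //; apply/andP.
- case: l lE {IH} => [_|e l] /=.
    by case/orP: Hd => /eqP->; [constructor 1|constructor 2].
  case=> -> lE; case/orP: Hd => /eqP->.
    by constructor 1; rewrite /= -lE.
  constructor 3; exists l; rewrite !gprod_cons genK; split=> //.
  rewrite lE; elim: (size l) (s) (t) => //= n IHn a b.
  rewrite /in2 /= eqxx /=; have := IHn b a; rewrite /in2 => H.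
  by rewrite -(eq_all (_ : pred2 b a =1 pred2 a b)) // => x /=; rewrite orbC.
- case: l lE {IH} => [_|e l] /=.
    by case/orP: Hd => /eqP->; [constructor 1|constructor 2].
  case=> -> lE; case/orP: Hd => /eqP->; last first.
    by constructor 2; rewrite /= -lE.
  constructor 3; exists l; rewrite !gprod_cons genK; split=> //.
  rewrite lE; elim: (size l) (s) (t) => //= n IHn a b.
  rewrite /in2 /= eqxx orbT /=; have := IHn b a; rewrite /in2 => H.
  by rewrite -(eq_all (_ : pred2 b a =1 pred2 a b)) // => x /=; rewrite orbC.
Qed.

Lemma in2_minimal s t l : in2 s t l -> exists l', [/\ in2 s t l', gp l' = gp l &
  forall l'', in2 s t l'' -> gp l'' = gp l -> size l' <= size l''].
Proof.
move=> Hl.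
have ex : exists n, `[< exists l', [/\ in2 s t l', gp l' = gp l & size l' = n] >].
  by exists (size l); apply/asboolP; exists l.
case: (ex_minnP ex) => n /asboolP[l' [Hl' l'E <-]] min.
by exists l'; split=> // l'' H1 H2; apply: min; apply/asboolP; exists l''.
Qed.

(** In a word of minimal length no prefix reflection is repeated, so that its wall
    is crossed exactly once. *)
Lemma minimal_prefix s t l l1 d l2 : in2 s t l ->
  (forall l', in2 s t l' -> gp l' = gp l -> size l <= size l') ->
  l = l1 ++ d :: l2 -> crosses (gp l) (gp l1 * gen d * (gp l1)^-1).
Proof.
move=> Hl min lE; set r := gp l1 * _ * _.
have rl1 : r ^ gp l1 = gen d by apply/eqP; rewrite conj_eq.
move: (Hl); rewrite lE /in2 all_cat /= => /and3P[Hl1 Hd Hl2].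
rewrite gprod_cat gprod_cons !crossesM rl1 crosses_gen eqxx.
have -> : gen d ^ gen d = gen d by rewrite conjgE mulgA mulVg mul1g.
have short l' : in2 s t l' -> gp l' = gp l -> size l' < size l -> False.
  by move=> H1 H2; rewrite ltnNge min.
case c1: (crosses _ r).
  have [m1 [e [m2 [l1E rE]]]] := word_exchange c1.
  case: (short (m1 ++ m2 ++ l2)).
  - by move: Hl1; rewrite /in2 l1E !all_cat /= => /and3P[-> _ ->].
  - rewrite lE !gprod_cat gprod_cons [RHS]mulgA (_ : gp l1 * gen d = r * gp l1); last first.
      by rewrite /r mulgVK.
    rewrite rE l1E gprod_cat gprod_cons !mulgA mulgVK.
    by rewrite mulgenK.
  - by rewrite lE l1E !size_cat /=; lia.
case c2: (crosses _ _) => //.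
have [m1 [e [m2 [l2E dE]]]] := word_exchange c2.
case: (short (l1 ++ m1 ++ m2)).
- by move: Hl2; rewrite /in2 l2E !all_cat Hl1 /= => /and3P[-> _ ->].
- rewrite lE !gprod_cat gprod_cons {1}dE l2E gprod_cat gprod_cons !mulgA mulgVK.
  by rewrite mulgenK.
- by rewrite lE l2E !size_cat /= ?size_cat /=; lia.
Qed.

(** A minimal alternating word beginning with [s] has [t] as a prefix reflection
    only if it runs all the way round: then [s t] has finite order at most the
    length of the word, and all powers of [s t] times [s] are among the prefix
    reflections. *)
Lemma alt_crosses_all s t k : let l := altw s t k in
  (forall l', in2 s t l' -> gp l' = gp l -> size l <= size l') -> in2 s t l ->
  crosses (gp l) (gen t) ->
  (exists n, (gen s * gen t) ^+ n.+1 = 1) /\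
  forall u, in2_refl s t u -> crosses (gp l) u.
Proof.
move=> l min Hl ct.
have [l1 [d [l2 [lE tE]]]] := word_exchange ct.
rewrite (altw_prefix lE) in tE; set i := size l1 in tE.
have i_lt : i < k by rewrite -(size_altw s t k) -/l lE size_cat /= /i; lia.
set z := gen s * gen t in tE.
have zE : z ^+ i.+1 = 1.
  by rewrite expgSr /z mulgA -/z -tE gen_sqr.
split; first by exists i.
have zinv j : exists j', z ^- j = z ^+ j'.
  exists (i * j)%N; apply: mulg1_eq; rewrite -expgnDr.
  by rewrite -mulSn expgnA zE expg1n.
move=> _ [l0 [e [Hl0 He ->]]].
have [j ->] : exists j, gp l0 * gen e * (gp l0)^-1 = z ^+ j * gen s.
  elim: l0 Hl0 => [_|x l0 IH] /=.
    rewrite gprod_nil mul1g invg1 mulg1; case/orP: He => /eqP->.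
      by exists 0%N; rewrite expg0 mul1g.
    by exists i.
  case/andP=> Hx /IH[j E]; rewrite gprod_cons invgM genV.
  have -> : gen x * gp l0 * gen e * ((gp l0)^-1 * gen x) = gen x * (z ^+ j * gen s) * gen x.
    by rewrite -E !mulgA.
  case/orP: Hx => /eqP->.
    have [j' jE] := zinv j; exists j'; rewrite -jE -dihedral_invert -/z.
    by rewrite !mulgA !mulgenK.
  have [j' jE] := zinv j.+2; exists j'; rewrite -jE -dihedral_invert -/z.
  rewrite expgSr expgS [in RHS]/z !mulgA gen_sqr mul1g !mulgenK.
  by [].
have jlt : j %% i.+1 < k by apply: leq_trans i_lt; rewrite ltn_mod.
have -> : z ^+ j = z ^+ (j %% i.+1).
  by rewrite {1}(divn_eq j i.+1) expgnDr mulnC expgnA zE expg1n mul1g.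
have jlt' : j %% i.+1 < size l by rewrite size_altw.
have lE' := cat_take_drop (j %% i.+1) l.
rewrite (drop_nth s jlt') in lE'; have lE2 := esym lE'.
have := minimal_prefix Hl min lE2.
by rewrite (altw_prefix lE2) size_take jlt'.
Qed.

Lemma in2_crosses_all s t g : (exists2 l, in2 s t l & g = gp l) ->
  crosses g (gen s) -> crosses g (gen t) ->
  (exists n, (gen s * gen t) ^+ n.+1 = 1) /\
  forall u, in2_refl s t u -> crosses g u.
Proof.
case=> l0 Hl0 ->; have [l [Hl <- min]] := in2_minimal Hl0 => cs ct.
have min' l' : in2 s t l' -> gp l' = gp l -> size l <= size l'.
  by move=> H1 H2; apply: min => //; rewrite H2 => {min cs ct}; apply/esym; have [] := in2_minimal Hl0.
case: (in2_shorten Hl) => [lE|lE|[l' [Hl' l'E]]]; last by rewrite ltnNge min'.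
- by rewrite lE in min' Hl cs ct *; apply: alt_crosses_all.
rewrite lE in min' Hl cs ct *.
have E : pred2 s t =1 pred2 t s by move=> x; rewrite /= orbC.
have E' l' : in2 s t l' = in2 t s l' by apply: eq_all.
have [||[n nE] H] := @alt_crosses_all t s (size l) _ _ cs.
- by move=> l' Hl'; apply: min'; rewrite E'.
- by rewrite -E'.
split; last by move=> u /in2_reflC/H.
exists n; rewrite -[LHS]invgK; apply/invg_inj; rewrite invgK invg1 -expVgn.
by rewrite invgM !genV.
Qed.

End Dihedral.

(** * Descents in a chamber and the Euler inequality *)

Section Walls.
Local Open Scope group_scope.
Variables (S : finType) (m : coxeter_matrix S).
Hypothesis m_odd : odd_angled m.
Local Notation W := (coxeter_group m).
Local Notation gen := (cox_gen m).
Local Notation gp := (gprod m).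

Variables (X : finType) (sigma : S -> X -> X) (rho : X -> W).
Hypothesis rels : cox_rels m sigma.
Hypothesis rho_inj : injective rho.
Hypothesis rho_move : forall s x, sigma s x != x -> rho (sigma s x) = rho x * gen s.
Hypothesis rho_wall : forall s x, sigma s x = x ->
  crossing_free rho (rho x * gen s * (rho x)^-1).

Let sK s : involutive (sigma s) := sigmaK rels s.

(** The edge of colour [s] at [x] leads towards [1]. *)
Definition descent (s : S) (x : X) : bool :=
  crosses (rho x) (rho x * gen s * (rho x)^-1).

Lemma descent_move s x : descent s x -> sigma s x != x.
Proof. by move=> ds; apply/eqP=> /rho_wall/(_ x); rewrite -[crosses _ _]/(descent s x) ds. Qed.

Lemma descent_sigma s x : sigma s x != x -> descent s (sigma s x) = ~~ descent s x.
Proof.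
move=> sx; rewrite /descent rho_move // invgM genV !mulgA mulgenK.
rewrite crossesM crosses_gen -addbT; congr (_ (+) _).
by rewrite conj_eq eqxx.
Qed.

Lemma descent_shorter s x : descent s x -> cox_length (rho (sigma s x)) < cox_length (rho x).
Proof.
move=> ds; rewrite rho_move ?descent_move //.
by have := cox_length_crosses ds; rewrite mulgVK.
Qed.

Definition walk (x : X) (l : seq S) : X := foldl (fun y s => sigma s y) x l.

(** If [x] is separated from [1] by all the walls of the coset of [s] and [t], none
    of these is a wall of the chamber, so no walk in [s] and [t] gets stuck. *)
Lemma walk_rho s t x l : 
  (forall u, in2_refl s t u -> crosses (rho x) (rho x * u * (rho x)^-1)) ->
  in2 s t l -> rho (walk x l) = rho x * gp l.
Proof.
move=> full; elim/last_ind: l => [|l d IH]; first by rewrite gprod_nil mulg1.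
rewrite /in2 all_rcons => /andP[Hd Hl]; rewrite /walk foldl_rcons -/(walk x l).
have {}IH := IH Hl; rewrite gprod_rcons mulgA -IH rho_move //.
apply/eqP=> /rho_wall/(_ x)/negP; rewrite IH; apply.
rewrite invgM !mulgA -[X in crosses _ X](_ : rho x * (gp l * gen d * (gp l)^-1) * (rho x)^-1 = _).
  by apply: full; exists l, d.
by rewrite !mulgA.
Qed.

Lemma walk_free s t x l d : 
  (forall u, in2_refl s t u -> crosses (rho x) (rho x * u * (rho x)^-1)) ->
  in2 s t l -> pred2 s t d -> sigma d (walk x l) != walk x l.
Proof.
move=> full Hl Hd; apply/eqP=> fixd.
have Hld : in2 s t (rcons l d) by rewrite /in2 all_rcons; apply/andP.
have := walk_rho full Hld; rewrite /walk foldl_rcons -/(walk x l) fixd.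
rewrite (walk_rho full Hl) gprod_rcons => /mulgI /esym.
by rewrite -[RHS]mulg1 => /mulgI; apply: gen_neq1.
Qed.

(** A shortest element of the coset of [p] is on the side of [1] of each of its
    walls. *)
Lemma min_coset s t (p : W) : exists2 l0, in2 s t l0 &
  forall u, in2_refl s t u -> ~~ crosses (p * gp l0) (p * gp l0 * u * (p * gp l0)^-1).
Proof.
have ex : exists n, `[< exists2 l, in2 s t l & cox_length (p * gp l) = n >].
  by exists (cox_length (p * gp [::])); apply/asboolP; exists [::].
case: (ex_minnP ex) => n /asboolP[l0 Hl0 <-] min; exists l0 => // u [l [d [Hl Hd uE]]].
apply/negP=> /cox_length_crosses; rewrite mulgVK.
have -> : p * gp l0 * u = p * gp (l0 ++ l ++ d :: rev l).
  by rewrite uE gprodV !gprod_cat gprod_cons !mulgA.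
rewrite ltnNge min //; apply/asboolP; eexists; last by [].
have Hr : in2 s t (d :: rev l) by rewrite /in2 -rev_rcons all_rev all_rcons; apply/andP.
by rewrite /in2 !all_cat; apply/and3P.
Qed.

Lemma crosses_conjV (g u : W) : crosses g^-1 u = crosses g (g * u * g^-1).
Proof. by rewrite crossesV conjgE invgK mulgA. Qed.

(** Compare [x] with the shortest element of its coset: the walls of the coset that
    separate [x] from [1] are those that the dihedral part of [x] crosses. *)
Lemma descents_full s t x : descent s x -> descent t x ->
  (exists n, (gen s * gen t) ^+ n.+1 = 1) /\
  forall u, in2_refl s t u -> crosses (rho x) (rho x * u * (rho x)^-1).
Proof.
move=> ds dt; have [l0 Hl0 min] := min_coset s t (rho x).
set b := rho x * gp l0 in min.
have E u : in2_refl s t u ->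
    crosses (rho x) (rho x * u * (rho x)^-1) = crosses (gp l0) u.
  move=> Hu; rewrite -crosses_conjV.
  have -> : (rho x)^-1 = gp l0 * b^-1 by rewrite /b invgM mulgA mulgV mul1g.
  rewrite crossesM crosses_conjV (negbTE (min _ _)) ?addbF //.
  exact: in2_refl_conj.
have [|||fin full] := @in2_crosses_all _ _ s t (gp l0).
- by exists l0.
- by rewrite -E //; apply: in2_refl_gen; rewrite /= eqxx.
- by rewrite -E //; apply: in2_refl_gen; rewrite /= eqxx orbT.
by split=> // u Hu; rewrite E ?full.
Qed.

Lemma descents_finite s t x : descent s x -> descent t x -> m s t != None.
Proof.
move=> ds dt; have [[n nE] _] := descents_full ds dt.
by apply/eqP=> /(gen_infinite m_odd); apply; apply: nE.
Qed.

Definition step2 (s t : S) : rel X := fun x y => (sigma s x == y) || (sigma t x == y).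

Lemma step2_walk s t x y : connect (step2 s t) x y -> exists2 l, in2 s t l & y = walk x l.
Proof.
case/connectP=> p; elim: p x => [|z p IH] x /= => [_ ->|]; first by exists [::].
case/andP=> xz /IH{}IH /IH[l Hl ->].
case/orP: xz => /eqP <-; [exists (s :: l)|exists (t :: l)] => //;
  by rewrite /in2 /= eqxx ?orbT.
Qed.

Lemma step2_sym s t : connect_sym (step2 s t).
Proof.
apply: sym_connect_sym => x y; rewrite /step2.
by congr orb; apply/eqP/eqP => <-; rewrite sK.
Qed.

(** Neither colour has a loop in the component of [y], which then is a bicoloured
    cycle. *)
Definition cyclic2 (s t : S) (y : X) : bool :=
  [forall z, connect (step2 s t) y z ==> (sigma s z != z) && (sigma t z != z)].

Lemma descents_cyclic s t x : descent s x -> descent t x -> cyclic2 s t x.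
Proof.
move=> ds dt; have [_ full] := descents_full ds dt.
apply/forallP=> z; apply/implyP=> /step2_walk[l Hl ->].
by apply/andP; split; apply: (walk_free full Hl); rewrite /= eqxx ?orbT.
Qed.

(** Two such points of one component are both on the far side of all the walls of
    the coset, so no wall separates them. *)
Lemma descents_uniq s t x y : descent s x -> descent t x ->
  descent s y -> descent t y -> connect (step2 s t) x y -> x = y.
Proof.
move=> dsx dtx dsy dty /step2_walk[l Hl yE]; apply: rho_inj.
have [_ fullx] := descents_full dsx dtx; have [_ fully] := descents_full dsy dty.
have ryE : rho y = rho x * gp l by rewrite yE (walk_rho fullx Hl).
rewrite ryE -[LHS]mulg1; congr (_ * _).
apply: invg_inj; rewrite invg1 gprodV.
pose Delta (d : W) := exists2 a, pred2 s t a & d = gen a.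
rewrite -lprod_map; apply/esym.
apply: (@deletion _ _ Delta (@in2_refl S m s t)).
- by move=> _ [a Ha ->]; apply: in2_refl_gen.
- by move=> _ [a Ha ->]; apply: gen_sqr.
- by move=> _ r [a Ha ->] _; rewrite crosses_gen.
- move=> _ r [a Ha ->]; have -> : gen a = gp [:: a] by rewrite gprod_cons gprod_nil mulg1.
  by apply: in2_refl_conj; rewrite /in2 /= andbT.
- move=> d /mapP[a]; rewrite mem_rev => al ->; exists a => //.
  by move/allP: Hl; apply.
move=> u Hu; rewrite lprod_map -gprodV.
have := fully u Hu; rewrite -crosses_conjV ryE invgM crossesM.
rewrite [crosses (rho x)^-1 _]crosses_conjV fullx ?addbT //.
by rewrite gprodV; apply: in2_refl_conj => //; rewrite /in2 all_rev.
Qed.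

Section Closed.
Local Open Scope nat_scope.
Variables (n : nat) (v : nat -> S) (Y : {set X}).
Hypothesis Y_closed : forall i x, i < n -> x \in Y -> sigma (v i) x \in Y.

Definition n_descents s := #|[set x in Y | descent s x]|.
Definition n_loops s := #|[set x in Y | sigma s x == x]|.
(** The points with two descents count the full bicoloured cycles, each by its
    point farthest from [1] ([descents_cyclic], [descents_uniq]). *)
Definition n_tops s t := #|[set x in Y | descent s x && descent t x]|.

(** Each edge of colour [v i] has one end from which it leads towards [1]. *)
Lemma double_descents i : i < n -> (n_descents (v i)).*2 + n_loops (v i) = #|Y|.
Proof.
move=> lt_in; set s := v i.
have sY x : (sigma s x \in Y) = (x \in Y).
  by apply/idP/idP => [/(Y_closed lt_in)|/(Y_closed lt_in)//]; rewrite -/s sK.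
rewrite -(cardsID [set x | sigma s x == x] Y) addnC.
have -> : Y :&: [set x | sigma s x == x] = [set x in Y | sigma s x == x].
  by apply/setP=> x; rewrite !inE.
congr addn; rewrite -(cardsID [set x | descent s x] (Y :\: _)) -addnn.
have -> : (Y :\: [set x | sigma s x == x]) :&: [set x | descent s x] = [set x in Y | descent s x].
  apply/setP=> x; rewrite !inE; case dx: (descent s x); rewrite ?andbF ?andbT //.
  by rewrite descent_move.
congr addn; rewrite /n_descents -(card_imset _ (can_inj (sK s))); apply: eq_card => x.
rewrite !inE; apply/imsetP/idP => [[y]|/and3P[dx sx xY]].
  rewrite inE => /andP[yY dy] ->; rewrite sK eq_sym sY yY andbT.
  by rewrite descent_sigma descent_move // dy.
by exists (sigma s x); rewrite ?sK // inE sY xY descent_sigma.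
Qed.

(** A vertex with [c] descents contributes [1 - c + c (c - 1) / 2], which is not
    negative, and is [1] at a vertex nearest to [1], where [c = 0]. *)
Lemma euler_inequality : Y != finset.set0 ->
  \sum_(i < n) n_descents (v i) < #|Y| + \sum_(j < n) \sum_(i < j) n_tops (v i) (v j).
Proof.
case/finset.set0Pn=> x0 x0Y.
case: (arg_minnP (fun x => cox_length (rho x)) x0Y) => x1 x1Y min1.
pose D (i : nat) x : bool := descent (v i) x.
have x1D i : i < n -> ~~ D i x1.
  move=> lt_in; apply/negP=> dx; have := descent_shorter dx.
  by rewrite ltnNge min1 //; apply: Y_closed.
pose c k x : nat := \sum_(i < k) D i x.
pose d k x : nat := \sum_(j < k) \sum_(i < j) (D i x && D j x).
have cd k x : c k x <= (0 < c k x) + d k x.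
  rewrite /c /d; elim: k => [|k IH]; first by rewrite !big_ord0.
  rewrite !big_ord_recr /= -/(c k x) -/(d k x).
  have -> : \sum_(i < k) (D i x && D k x) = c k x * D k x.
    by rewrite /c big_distrl /=; apply: eq_bigr => i _; rewrite mulnb.
  by move: IH; rewrite -/(c k x) -/(d k x); case: (D k x); lia.
have -> : \sum_(i < n) n_descents (v i) = \sum_(x in Y) c n x.
  rewrite exchange_big /=; apply: eq_bigr => i _.
  rewrite /n_descents -sum1dep_card [RHS]big_mkcond /= [LHS]big_mkcond /=.
  by apply: eq_bigr => x _; rewrite /D; case: (x \in Y); case: descent.
have -> : \sum_(j < n) \sum_(i < j) n_tops (v i) (v j) = \sum_(x in Y) d n x.
  rewrite exchange_big /=; apply: eq_bigr => j _.
  rewrite exchange_big /=; apply: eq_bigr => i _.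
  rewrite /n_tops -sum1dep_card [RHS]big_mkcond /= [LHS]big_mkcond /=.
  by apply: eq_bigr => x _; rewrite /D; case: (x \in Y); case: descent; case: descent.
rewrite -sum1_card -big_split /= (bigD1 x1) //= [X in _ < X](bigD1 x1) //=.
have -> : c n x1 = 0%N by rewrite /c big1 // => i _; rewrite (negbTE (x1D i _)).
rewrite add0n -addnA ltnS; apply: leq_trans (leq_addl _ _).
by apply: leq_sum => x _; apply: leq_trans (cd n x) _; rewrite leq_add2r leq_b1.
Qed.

End Closed.
End Walls.

(** * Orbits of two generators with an odd label *)

Section OddDihedral.
Variables (X : finType) (f g : X -> X) (k : nat).
Hypotheses (fK : involutive f) (gK : involutive g).
Hypothesis k_odd : odd k.
Let tau x := g (f x).
Hypothesis tauk : forall x, iter k tau x = x.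

Lemma tau_inj : injective tau.
Proof. exact: (inj_comp (inv_inj gK) (inv_inj fK)). Qed.

(** The involution [f] inverts the rotation [tau]. *)
Lemma tau_reverse i x : iter i tau (f (iter i tau x)) = f x.
Proof.
have tft z : tau (f (tau z)) = f z by rewrite /tau fK gK.
by elim: i => // i IH; rewrite iterSr [iter i.+1 tau x]iterS tft IH.
Qed.

Lemma tau_iterM i x : iter (k * i) tau x = x.
Proof. by elim: i => [|i IH]; rewrite ?muln0 // mulnS iterD IH tauk. Qed.

(** The length of an orbit of [tau] divides [k], and it is not [1]. *)
Lemma tau_order_ge p x : p <= pdiv k -> tau x != x -> p <= order tau x.
Proof.
move=> pk tx; apply: leq_trans pk _; apply: pdiv_min_dvd.
  have := order_gt0 tau x; case E: (order tau x) => [|[|n]] // _.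
  by have := iter_order (@tau_inj) x; rewrite E /= => /eqP; rewrite (negbTE tx).
set n := order tau x.
have itn i : iter (i * n) tau x = x.
  by elim: i => [|i IH] //; rewrite mulSn iterD IH (iter_order (@tau_inj)).
have : iter (k %% n) tau x = x.
  by rewrite -[RHS]tauk {2}(divn_eq k n) addnC iterD itn.
have lt : k %% n < order tau x by rewrite ltn_mod order_gt0.
by move=> E; have := findex_iter lt; rewrite E findex0 => /esym/eqP.
Qed.

(** On an orbit of odd length the reflection [f] fixes at most one point: if it
    fixes [x] and [tau^i x] then [tau^(2 i)] fixes [x]. *)
Lemma fixed_in_orbit_uniq x y : f x = x -> f y = y -> fconnect tau x y -> x = y.
Proof.
move=> fx fy xy; have yE := iter_findex xy; set i := findex _ _ _ in yE.
have E : iter (i + i) tau x = x by rewrite iterD yE -fy -yE tau_reverse.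
rewrite -yE; have kE : k = (k./2).*2.+1 by rewrite -[LHS]odd_double_half k_odd.
have Em j : iter ((i + i) * j) tau x = x.
  by elim: j => [|j IH]; rewrite ?muln0 // mulnS iterD IH E.
rewrite -{1}(tau_iterM i x) (_ : k * i = i + (i + i) * k./2); last by lia.
by rewrite iterD Em.
Qed.

(** A reflection of an orbit of odd length has a fixed point, the midpoint of [x]
    and [f x]; halving is possible modulo the odd [k]. *)
Lemma reflected_orbit x : fconnect tau x (f x) -> exists2 z, fconnect tau x z & f z = z.
Proof.
move=> xfx; have fxE := iter_findex xfx; set i := findex _ _ _ in fxE.
have kE : k = (k./2).*2.+1 by rewrite -[LHS]odd_double_half k_odd.
pose j := i * (k./2).+1; exists (iter j tau x); first exact: fconnect_iter.
have itj n : injective (iter n tau) by elim: n => //= n IH; apply: inj_comp (@tau_inj) IH.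
apply: (itj j); rewrite tau_reverse -fxE -iterD.
rewrite (_ : j + j = i + k * i); last by rewrite /j; lia.
by rewrite iterD tau_iterM.
Qed.

(** A path with an odd number of vertices has a loop of each colour, at opposite
    ends; half a turn of [tau] carries one end to the other. *)
Lemma fixed_points_le (Y : {set X}) : (forall x, x \in Y -> f x \in Y) ->
  (forall x, x \in Y -> g x \in Y) ->
  #|[set x in Y | f x == x]| <= #|[set x in Y | g x == x]|.
Proof.
move=> fY gY; have kE : k = (k./2).*2.+1 by rewrite -[LHS]odd_double_half k_odd.
have itj n : injective (iter n tau) by elim: n => //= n IH; apply: inj_comp (@tau_inj) IH.
pose th x := iter (k./2).+1 tau x.
rewrite -(card_imset _ (itj (k./2).+1)); apply/subset_leq_card/fintype.subsetP=> z /imsetP[x].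
rewrite !inE => /andP[xY /eqP fx] ->; apply/andP; split.
  by elim: _.+1 => //= n IH; apply: gY; apply: fY.
set y := iter _ _ _; apply/eqP.
have fy : iter (k./2).+1 tau (f y) = x by rewrite tau_reverse.
have -> : g y = tau (f y) by rewrite /tau fK.
apply: (itj (k./2).+1); rewrite -iterSr iterS fy.
rewrite /y -iterD (_ : _ + _ = k.+1); last by lia.
by rewrite iterS tauk.
Qed.

End OddDihedral.

Section Pairs.
Variables (S : finType) (m : coxeter_matrix S).
Hypothesis m_odd : odd_angled m.
Local Notation W := (coxeter_group m).
Local Notation gen := (cox_gen m).
Variables (X : finType) (sigma : S -> X -> X) (rho : X -> W).
Hypothesis rels : cox_rels m sigma.
Hypothesis rho_inj : injective rho.
Hypothesis rho_move : forall s x, sigma s x != x -> rho (sigma s x) = (rho x * gen s)%g.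
Hypothesis rho_wall : forall s x, sigma s x = x ->
  crossing_free rho (rho x * gen s * (rho x)^-1)%g.
Let sK s : involutive (sigma s) := sigmaK rels s.

Variables (s t : S) (k p : nat) (Y : {set X}).
Hypotheses (neq_st : s != t) (mst : m s t = Some k) (p_le : p <= pdiv k) (p_gt0 : 0 < p).
Hypothesis sY : forall x, x \in Y -> sigma s x \in Y.
Hypothesis tY : forall x, x \in Y -> sigma t x \in Y.

Let k_odd : odd k := m_odd neq_st mst.
Let tau x := sigma t (sigma s x).
Let tauk x : iter k tau x = x := rels mst x.
Let cyc := cyclic2 sigma s t.
Let step := step2 sigma s t.

(** The paths with at least two vertices, each counted by its end with a loop of
    colour [s]. *)
Definition n_ends := #|[set x in Y | (sigma s x == x) && (sigma t x != x)]|.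
Definition n_cyclic := #|[set x in Y | cyclic2 sigma s t x]|.

Lemma fconnect_step x y : fconnect tau x y -> connect step x y.
Proof.
apply: connect_sub => z _ /eqP <-; apply: (@connect_trans _ _ (sigma s z)).
  by apply: connect1; rewrite /step /step2 eqxx.
by apply: connect1; rewrite /step /step2 eqxx orbT.
Qed.

Lemma step_closed x y : connect step x y -> (x \in Y) = (y \in Y).
Proof.
have step_Y z w : step z w -> z \in Y -> w \in Y.
  by case/orP=> /eqP <-; [apply: sY|apply: tY].
have con_Y z w : connect step z w -> z \in Y -> w \in Y.
  case/connectP=> q; elim: q z => [|u q IH] z /= => [_ ->|] //.
  by case/andP=> zu qu wE zY; apply: IH qu wE _; apply: step_Y zu zY.
move=> xy; apply/idP/idP; apply: con_Y => //.
by rewrite (step2_sym rels).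
Qed.

Lemma cyclic_step x y : connect step x y -> cyc x = cyc y.
Proof.
have H z w : connect step z w -> cyc z -> cyc w.
  move=> zw /forallP cz; apply/forallP=> u; apply/implyP=> wu.
  by apply: (implyP (cz u)); apply: connect_trans zw wu.
by move=> xy; apply/idP/idP; apply: H; rewrite // (step2_sym rels).
Qed.

Lemma cyclic_moves x : cyc x -> (sigma s x != x) && (sigma t x != x).
Proof. by move/forallP/(_ x); rewrite connect0. Qed.

Lemma cyclic_tau x : cyc x -> tau x != x.
Proof.
move=> cx; apply/eqP=> tx.
have /andP[sx _] := cyclic_moves cx.
have /cyclic_moves/andP[_ tsx] : cyc (sigma s x).
  by rewrite -(@cyclic_step x) // connect1 // /step /step2 eqxx.
have := rho_move tsx; rewrite -[sigma t _]/(tau x) tx (rho_move sx) -mulgA.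
rewrite -[LHS]mulg1 => /mulgI /esym/mulg1_eq; rewrite genV => /(gen_inj m_odd)/eqP.
by rewrite (negbTE neq_st).
Qed.

(** The points [x] and [sigma s x] are in different orbits of [tau], as otherwise
    some colour has a loop; each orbit has at least [p] points, because the
    moving points follow the Cayley graph, where [s] and [t] are distinct. *)
Lemma cyclic_component x : cyc x -> 2 * p <= #|connect step x|.
Proof.
move=> cx; have tinj := tau_inj (sK s) (sK t).
have csx : cyc (sigma s x) by rewrite -(@cyclic_step x) // connect1 // /step /step2 eqxx.
have disj : [disjoint fconnect tau x & fconnect tau (sigma s x)].
  apply/pred0P=> y /=; apply/negbTE/negP=> /andP[xy sxy].
  have xsx : fconnect tau x (sigma s x).
    by apply: connect_trans xy _; rewrite (fconnect_sym tinj).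
  have [z xz sz] := reflected_orbit (sK s) (sK t) k_odd tauk xsx.
  have /cyclic_moves/andP[] : cyc z by rewrite -(cyclic_step (fconnect_step xz)).
  by rewrite sz eqxx.
have sub : {subset [predU fconnect tau x & fconnect tau (sigma s x)] <= connect step x}.
  move=> y; rewrite inE => /orP[/fconnect_step//|/fconnect_step].
  by apply: connect_trans; apply: connect1; rewrite /step /step2 eqxx.
apply: leq_trans (subset_leq_card (introT fintype.subsetP sub)).
have disj0 : #|[predI fconnect tau x & fconnect tau (sigma s x)]| = 0 by apply/eqP.
have := cardUI (fconnect tau x) (fconnect tau (sigma s x)).
rewrite disj0 addn0 mul2n -addnn => ->.
have tx z : cyc z -> p <= order tau z.
  move=> cz; apply: (tau_order_ge (sK s) (sK t) tauk p_le). apply: cyclic_tau cz.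
by apply: leq_add; apply: tx.
Qed.

(** A component with a top is a cycle with at least [2 p] points and has only one
    top. *)
Lemma tops_le_cyclic : 2 * p * n_tops rho Y s t <= n_cyclic.
Proof.
set T := [set x in Y | descent rho s x && descent rho t x].
have TP x : x \in T -> [/\ x \in Y, descent rho s x & descent rho t x].
  by rewrite inE => /and3P[].
have Tcyc x : x \in T -> cyc x.
  by case/TP=> _ ds dt; apply: descents_cyclic ds dt.
rewrite mulnC -sum_nat_const.
apply: (@leq_trans (\sum_(x in T) #|connect step x|)).
  by apply: leq_sum => x /Tcyc; apply: cyclic_component.
have E x : #|connect step x| = \sum_y connect step x y.
  by rewrite -sum1_card big_mkcond.
rewrite (eq_bigr _ (fun x _ => E x)) exchange_big /= /n_cyclic -sum1dep_card.
rewrite [X in _ <= X]big_mkcond /=; apply: leq_sum => y _.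
have [/existsP[x /andP[xT xy]]|none] := boolP [exists x, (x \in T) && connect step x y].
  have [xY dsx dtx] := TP x xT.
  rewrite -(step_closed xy) xY -[cyclic2 _ _ _ _]/(cyc y) -(cyclic_step xy) Tcyc //.
  rewrite (bigD1 x) //= xy big1 // => z /andP[zT neq_zx].
  apply/eqP; rewrite eqb0; apply: contra neq_zx => zy; apply/eqP.
  have [zY dsz dtz] := TP z zT.
  apply: (descents_uniq rho_inj rho_move rho_wall dsz dtz dsx dtx).
  by apply: connect_trans zy _; rewrite (step2_sym rels).
rewrite big1 // => x xT; apply/eqP; rewrite eqb0; apply: contra none => xy.
by apply/existsP; exists x; rewrite xT.
Qed.

(** Both sides count the paths. *)
Lemma loops_eq : n_loops sigma Y s = n_loops sigma Y t.
Proof.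
apply/eqP; rewrite eqn_leq; apply/andP; split.
  exact: (fixed_points_le (sK s) (sK t) k_odd tauk sY tY).
have mts : m t s = Some k by rewrite cox_sym.
exact: (fixed_points_le (sK t) (sK s) k_odd (rels mts) tY sY).
Qed.

(** Each loop of colour [s] is the end of one path, which is a single point or has
    at least [p] points; the cycles come on top. *)
Lemma pair_inequality : n_loops sigma Y s + p.-1 * n_ends + n_cyclic <= #|Y|.
Proof.
have tinj := tau_inj (sK s) (sK t).
set Q := [set x in Y | (sigma s x == x) && (sigma t x != x)].
set B := [set x in Y | (sigma s x == x) && (sigma t x == x)].
have QP x : x \in Q -> [/\ x \in Y, sigma s x = x & sigma t x != x].
  by rewrite inE => /and3P[xY /eqP sx tx].
have Qtau x : x \in Q -> tau x != x by case/QP=> _ sx tx; rewrite /tau sx.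
have -> : n_loops sigma Y s = #|B| + n_ends.
  rewrite /n_loops -(cardsID [set x | sigma t x == x]); congr addn.
    by apply: eq_card => x; rewrite !inE andbA.
  by apply: eq_card => x; rewrite !inE; case: (x \in Y); rewrite ?andbF ?andbT //= andbC.
rewrite -(addnA #|B|) -mulSn prednK //.
apply: (@leq_trans (\sum_y ((y \in B) + (\sum_(x in Q) fconnect tau x y)
   + ((y \in Y) && cyc y)))).
  rewrite !big_split /=; apply: leq_add; first apply: leq_add.
  - by rewrite -sum1_card big_mkcond /=; apply: leq_sum => y _; case: (y \in B).
  - rewrite exchange_big /= mulnC -sum_nat_const; apply: leq_sum => x /Qtau tx.
    apply: leq_trans (tau_order_ge (sK s) (sK t) tauk p_le tx) _.
    by rewrite /order -sum1_card big_mkcond.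
  - rewrite /n_cyclic -sum1dep_card [X in X <= _]big_mkcond /=.
    by apply: leq_sum => y _; case: (_ && _).
rewrite -sum1_card [X in _ <= X]big_mkcond /=; apply: leq_sum => y _.
have orb x : x \in Q -> fconnect tau x y -> (y \in Y) && ~~ cyc y && (y \notin B).
  move=> xQ xy; have xy' := fconnect_step xy; have [xY sx tx] := QP x xQ.
  rewrite -(step_closed xy') xY -(cyclic_step xy') /=; apply/andP; split.
    by apply/negP=> /cyclic_moves; rewrite sx eqxx.
  apply/negP; rewrite inE => /and3P[_ /eqP sy /eqP ty].
  have yy : tau y = y by rewrite /tau sy ty.
  have xE : y = x.
    move: xy; rewrite (fconnect_sym tinj) => /iter_findex <-.
    by rewrite (iter_fix _ yy).
  by have := Qtau x xQ; rewrite -xE yy eqxx.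
have [/existsP[x /andP[xQ xy]]|none] := boolP [exists x, (x \in Q) && fconnect tau x y].
  have /andP[/andP[-> /negbTE->] /negbTE->] := orb x xQ xy.
  rewrite addn0 add0n (bigD1 x) //= xy big1 // => z /andP[zQ neq_zx].
  apply/eqP; rewrite eqb0; apply: contra neq_zx => zy; apply/eqP.
  have [_ sz _] := QP z zQ; have [_ sx _] := QP x xQ.
  apply: (fixed_in_orbit_uniq (sK s) (sK t) k_odd tauk) => //.
  by apply: connect_trans zy _; rewrite (fconnect_sym tinj).
rewrite big1 => [|x xQ]; last first.
  apply/eqP; rewrite eqb0; apply: contra none => xy.
  by apply/existsP; exists x; rewrite xQ.
rewrite addn0 inE; case: (y \in Y) => //=.
case cy: (cyc y); last by case: (_ && _).
by have /andP[/negbTE-> _] := cyclic_moves cy.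
Qed.

End Pairs.

(** * Counting arguments on spanning trees of colours *)

Section Counting.
Variables (S : finType) (m : coxeter_matrix S).
Hypothesis m_odd : odd_angled m.
Local Notation W := (coxeter_group m).
Local Notation gen := (cox_gen m).
Variables (X : finType) (sigma : S -> X -> X) (rho : X -> W).
Hypothesis rels : cox_rels m sigma.
Hypothesis rho_inj : injective rho.
Hypothesis rho_move : forall s x, sigma s x != x -> rho (sigma s x) = (rho x * gen s)%g.
Hypothesis rho_wall : forall s x, sigma s x = x ->
  crossing_free rho (rho x * gen s * (rho x)^-1)%g.
Local Notation label := (cox_div m).

Lemma joinedP (P : pred nat) s t : joined label P s t ->
  exists k, [/\ s != t, m s t = Some k, odd k & P (pdiv k)].
Proof.
rewrite /joined /cox_div; have [//|neq_st] := eqVneq s t.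
by case mst: (m s t) => [k|] //= Pk; exists k; split=> //; exact: (m_odd neq_st mst).
Qed.

Lemma joinedC (P : pred nat) s t : joined label P s t = joined label P t s.
Proof. by rewrite /joined /cox_div eq_sym cox_sym. Qed.

Lemma not_joinedP s t : s != t -> not_joined label s t -> m s t = None.
Proof. by move=> neq_st; rewrite /not_joined /cox_div (negbTE neq_st); case: (m s t). Qed.

Lemma sub_joined (P Q : pred nat) s t : subpred P Q ->
  joined label P s t -> joined label Q s t.
Proof. by rewrite /joined => PQ; case: (label s t) => //= k; apply: PQ. Qed.

Lemma joined3 s t : joined label (pred1 3) s t -> joined label (leq 3) s t.
Proof. by apply: sub_joined => k /eqP ->. Qed.

Lemma joined5 s t : joined label (pred1 5) s t -> joined label (leq 5) s t.
Proof. by apply: sub_joined => k /eqP ->. Qed.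

Variable Y : {set X}.
Hypothesis Y_neq0 : Y != finset.set0.

Local Notation L := (n_loops sigma Y).
Local Notation E := (n_descents rho Y).
Local Notation F := (n_tops rho Y).
Local Notation q s t := (n_ends sigma s t Y).
Local Notation C s t := (n_cyclic sigma s t Y).
Local Notation closed s := (forall x, x \in Y -> sigma s x \in Y).

Lemma descents_loops s : closed s -> (E s).*2 + L s = #|Y|.
Proof.
move=> Ys; apply: (@double_descents _ _ _ _ _ rels rho_move rho_wall 1 (fun=> s) Y _ 0 isT).
by move=> i x _; apply: Ys.
Qed.

Lemma joined_loops (P : pred nat) s t : closed s -> closed t ->
  joined label P s t -> L s = L t.
Proof. by move=> Ys Yt /joinedP[k [neq_st mst _ _]]; apply: (loops_eq m_odd rels neq_st mst). Qed.

(** In terms of the number [E] of edges: [2 E] is the number of points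
    without a loop. *)
Lemma ends_cyclic p s t : closed s -> closed t -> 0 < p -> joined label (leq p) s t ->
  p.-1 * q s t + C s t <= (E s).*2 /\ 2 * p * F s t <= C s t.
Proof.
move=> Ys Yt p_gt0 /joinedP[k [neq_st mst _ pk]]; split.
  have := pair_inequality m_odd rels neq_st mst pk p_gt0 Ys Yt.
  by rewrite -(descents_loops Ys); clear; lia.
exact: (tops_le_cyclic m_odd rels rho_inj rho_move rho_wall neq_st mst pk Ys Yt).
Qed.

Lemma joined_bound p s t : closed s -> closed t -> joined label (leq p.+1) s t ->
  p * q s t + 2 * p.+1 * F s t <= (E s).*2.
Proof. by move=> Ys Yt j; have [] := ends_cyclic Ys Yt (ltn0Sn p) j; clear; lia. Qed.

(** A full cycle forces [s t] to have finite order. *)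
Lemma not_joined_tops s t : s != t -> not_joined label s t -> F s t = 0.
Proof.
move=> neq_st /(not_joinedP neq_st) mst; apply: eq_card0 => x; rewrite !inE.
apply/negbTE/negP=> /and3P[_ ds dt].
by have := descents_finite m_odd ds dt; rewrite mst.
Qed.

Lemma ends_loops s t : q s t + #|[set x in Y | (sigma s x == x) && (sigma t x == x)]| = L s.
Proof.
rewrite addnC /n_loops -(cardsID [set x | sigma t x == x] [set x in Y | sigma s x == x]).
congr addn; apply: eq_card => x; rewrite !inE ?andbA //.
by case: (x \in Y); rewrite ?andbF ?andbT //= andbC.
Qed.

Lemma endsC s t : L s = L t -> q s t = q t s.
Proof.
have := ends_loops s t; have := ends_loops t s.
rewrite (eq_card (_ : _ =i [set x in Y | (sigma s x == x) && (sigma t x == x)])); first by clear; lia.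
by move=> x; rewrite !inE [in RHS]andbC [X in _ = X && _]andbC -!andbA andbC -andbA.
Qed.

(** The pairs [es] are the edges of a tree of colours, rooted at [s] and directed
    away from it.  A vertex with a loop of colour [s] but not of all colours has
    a tree edge along which the loops stop, and there it is an end of a
    nontrivial path. *)
Lemma tree_bound s (es : seq (S * S)) :
  (forall x, x \in Y -> sigma s x = x ->
    (forall e, e \in es -> sigma e.1 x = x -> sigma e.2 x = x) -> False) ->
  L s <= \sum_(e <- es) q e.1 e.2.
Proof.
move=> noloop.
have qE e : q e.1 e.2 = \sum_(x in Y) ((sigma e.1 x == x) && (sigma e.2 x != x)).
  by rewrite /n_ends -sum1dep_card big_mkcondr; apply: eq_bigr => x _; case: ifP.
rewrite (eq_bigr _ (fun e _ => qE e)) exchange_big /= /n_loops -sum1dep_card.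
rewrite big_mkcondr /=; apply: leq_sum => x xY; case: ifP => // /eqP sx.
rewrite lt0n sum_nat_seq_neq0; apply/negPn/negP=> /hasPn none; apply: (noloop x xY sx).
move=> e /none /=; rewrite eqb0 negbK negb_and negbK => /orP[/eqP//|/eqP//].
Qed.

Lemma euler3 v1 v2 v3 : closed v1 -> closed v2 -> closed v3 ->
  E v1 + E v2 + E v3 < #|Y| + (F v1 v2 + F v1 v3 + F v2 v3).
Proof.
move=> Y1 Y2 Y3; pose v i := nth v1 [:: v1; v2; v3] i.
have Yv i x : i < 3 -> x \in Y -> sigma (v i) x \in Y.
  by move: i => [|[|[]]] // _; auto.
have := @euler_inequality _ _ _ _ _ rho_move rho_wall 3 v Y Yv Y_neq0.
by rewrite !(big_ord_recr, big_ord0) /= /v /=; lia.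
Qed.

Lemma euler4 v1 v2 v3 v4 : closed v1 -> closed v2 -> closed v3 -> closed v4 ->
  E v1 + E v2 + E v3 + E v4 < #|Y| +
    (F v1 v2 + F v1 v3 + F v2 v3 + F v1 v4 + F v2 v4 + F v3 v4).
Proof.
move=> Y1 Y2 Y3 Y4; pose v i := nth v1 [:: v1; v2; v3; v4] i.
have Yv i x : i < 4 -> x \in Y -> sigma (v i) x \in Y.
  by move: i => [|[|[|[]]]] // _; auto.
have := @euler_inequality _ _ _ _ _ rho_move rho_wall 4 v Y Yv Y_neq0.
by rewrite !(big_ord_recr, big_ord0) /= /v /=; lia.
Qed.

Lemma sum_single n a c : \sum_(i < n) (nat_of_ord i == a) * c = (a < n) * c.
Proof.
elim: n => [|n IH]; first by rewrite big_ord0.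
by rewrite big_ord_recr /= IH -mulnDl; congr (_ * _); lia.
Qed.

Lemma sum_pair n a b c :
  \sum_(j < n) \sum_(i < j) ((nat_of_ord i == a) && (nat_of_ord j == b)) * c <= c.
Proof.
apply: (@leq_trans (\sum_(j < n) (nat_of_ord j == b) * c)).
  apply: leq_sum => j _; case: (_ == b); last by rewrite big1 // => i; rewrite andbF.
  by under eq_bigr => i _ do rewrite andbT; rewrite sum_single; case: (a < j); rewrite !mul1n.
by rewrite sum_single; case: (b < n); rewrite ?mul1n.
Qed.

Lemma sum_adjacent n (f : nat -> nat) :
  \sum_(j < n.+1) \sum_(i < j) (i.+1 == j) * f i = \sum_(i < n) f i.
Proof.
elim: n => [|n IH]; first by rewrite big_ord_recr /= !big_ord0.
rewrite big_ord_recr IH [RHS]big_ord_recr; congr addn => /=.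
under eq_bigr => i _ do rewrite eqSS.
rewrite big_ord_recr /= eqxx mul1n big1 // => i _.
by rewrite ltn_eqF.
Qed.

Section Chain.
Variables (k : nat) (u : nat -> S).
Local Notation n := k.+4.+1.
Hypothesis Yu : forall i, i < n -> closed (u i).
Hypothesis noloop : forall x, x \in Y -> (forall i, i < n -> sigma (u i) x = x) -> False.
Hypothesis u_inj : forall i j, i < n -> j < n -> u i = u j -> i = j.

(** The spanning trees of the chain: the path through all the colours, or the same
    path with the first two or the last two colours exchanged. *)
Lemma chain_bound a a' b b' :
  (a, a') = (0, 1) \/ (a, a') = (1, 0) ->
  (b, b') = (k.+3, k.+4) \/ (b, b') = (k.+4, k.+3) ->
  L (u 2) <= q (u 2) (u a) + q (u a) (u a') +
    \sum_(i < k) q (u i.+2) (u i.+3) + q (u k.+2) (u b) + q (u b) (u b').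
Proof.
move=> aa bb.
pose mid := [seq (u i.+2, u i.+3) | i <- iota 0 k].
have := @tree_bound (u 2) ([:: (u 2, u a); (u a, u a')] ++ mid ++ [:: (u k.+2, u b); (u b, u b')]).
rewrite !big_cat !big_cons !big_nil /= big_map -[k in iota 0 k]subn0 -/(index_iota 0 k) big_mkord.
rewrite !addn0 !addnA; apply=> x xY s2 H.
have sa : sigma (u a) x = x by apply: (H (u 2, u a)); rewrite // mem_head.
have sa' : sigma (u a') x = x by apply: (H (u a, u a')); rewrite // !inE eqxx orbT.
have smid i : i <= k -> sigma (u i.+2) x = x.
  elim: i => [|i IH] // lt_ik; apply: (H (u i.+2, u i.+3)); last exact/IH/ltnW.
  suff emid : (u i.+2, u i.+3) \in mid by rewrite !inE mem_cat emid !orbT.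
  by apply/mapP; exists i; rewrite ?mem_iota.
have sb : sigma (u b) x = x.
  apply: (H (u k.+2, u b)); last exact: smid.
  by rewrite !inE mem_cat !inE eqxx ?orbT.
have sb' : sigma (u b') x = x.
  by apply: (H (u b, u b')); rewrite // !inE mem_cat !inE eqxx ?orbT.
apply: (noloop xY) => i lt_in.
have [i_lt2|i_ge2] := ltnP i 2.
  by case: aa sa sa' => -[-> ->] s0 s1; case: i i_lt2 {lt_in} => [|[|]].
have [i_le|i_gt] := leqP i k.+2.
  by have := smid i.-2; case: i i_ge2 i_le {lt_in} => [|[|i]] // _; rewrite !ltnS => /[swap]; apply.
have /orP[/eqP->|/eqP->] : (i == k.+3) || (i == k.+4) by lia.
  by case: bb sb sb' => -[-> ->].
by case: bb sb sb' => -[-> ->].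
Qed.

(** With all [E] equal, the Euler inequality reads [(n - 2) E < L + F].  The two
    outer edges satisfy [4 q + 10 F <= 2 E] and the others [2 q + 6 F <= 2 E].  The
    four trees of [chain_bound] may avoid the pairs [0 2] and [k+2 k+4], and
    together they bound [L]. *)
Lemma no_F : joined label (leq 5) (u 0) (u 1) -> joined label (leq 5) (u k.+3) (u k.+4) ->
  (forall i, 0 < i < k.+3 -> joined label (pred1 3) (u i) (u i.+1)) ->
  not_joined label (u 0) (u 2) || joined label (pred1 3) (u 0) (u 2) ->
  not_joined label (u k.+2) (u k.+4) || joined label (pred1 3) (u k.+2) (u k.+4) ->
  (forall i j, i < j < n -> j != i.+1 -> (i, j) != (0, 2) -> (i, j) != (k.+2, k.+4) ->
     not_joined label (u i) (u j)) -> False.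
Proof.
move=> j01 jlast j3 j02 jb far.
have k2n : k.+2 < n by lia.
have k3n : k.+3 < n by lia.
have k4n : k.+4 < n by lia.
have j i : i < k.+4 -> joined label (leq 3) (u i) (u i.+1).
  case: (posnP i) => [-> _|i_gt0 lt_ik].
    by apply: sub_joined j01 => z; apply: leq_trans.
  have [lt|ge] := ltnP i k.+3; first by apply/joined3/j3; rewrite i_gt0.
  have -> : i = k.+3 by lia.
  by apply: sub_joined jlast => z; apply: leq_trans.
have Lu i : i < n -> L (u i) = L (u 0).
  elim: i => // i IH lt_in; rewrite -IH; last exact: ltnW.
  by apply/esym; apply: joined_loops (j i _); rewrite // => x; apply: Yu; lia.
have Eu i : i < n -> E (u i) = E (u 0).
  move=> lt_in; have := descents_loops (@Yu i lt_in).
  by have := descents_loops (@Yu 0 isT); rewrite Lu //; lia.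
have e := @euler_inequality _ _ _ _ _ rho_move rho_wall n u Y (fun i x lt => @Yu i lt x) Y_neq0.
have sumE : \sum_(i < n) E (u i) = k * E (u 0) + 5 * E (u 0).
  rewrite (eq_bigr (fun=> E (u 0))) => [|i _]; last exact: Eu.
  by rewrite sum_nat_const card_ord -mulnDl addnC.
pose f i := F (u i) (u i.+1).
have pointwise i j' : i < j' -> j' < n -> F (u i) (u j') <= (i.+1 == j') * f i +
    ((i == 0) && (j' == 2)) * F (u 0) (u 2) +
    ((i == k.+2) && (j' == k.+4)) * F (u k.+2) (u k.+4).
  move=> lt_ij lt_jn; have [<-|neq1] := eqVneq i.+1 j'.
    by rewrite mul1n -addnA leq_addr.
  have [/andP[/eqP-> /eqP->]|n02] := boolP ((i == 0) && (j' == 2)).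
    by rewrite mul1n -addnA addnCA leq_addr.
  have [/andP[/eqP-> /eqP->]|nb] := boolP ((i == k.+2) && (j' == k.+4)).
    by rewrite mul1n leq_addl.
  rewrite not_joined_tops //; last by apply: far; rewrite // ?lt_ij // eq_sym.
  by apply/eqP=> /u_inj; lia.
have sumF : \sum_(j < n) \sum_(i < j) F (u i) (u j) <=
    \sum_(i < k.+4) f i + F (u 0) (u 2) + F (u k.+2) (u k.+4).
  apply: (@leq_trans (\sum_(j < n) \sum_(i < j) ((i.+1 == j) * f i +
    ((nat_of_ord i == 0) && (nat_of_ord j == 2)) * F (u 0) (u 2) +
    ((nat_of_ord i == k.+2) && (nat_of_ord j == k.+4)) * F (u k.+2) (u k.+4)))).
    by apply: leq_sum => j' _; apply: leq_sum => i _; apply: pointwise.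
  under eq_bigr => j' _ do rewrite !big_split /=.
  by rewrite !big_split /= sum_adjacent; apply: leq_add; [apply: leq_add|]; rewrite ?sum_pair.
have Y0 : closed (u 0) by apply: Yu.
have Y1 : closed (u 1) by apply: Yu.
have Y2 : closed (u 2) by apply: Yu.
have Yk2 : closed (u k.+2) by apply: Yu.
have Yk3 : closed (u k.+3) by apply: Yu.
have Yk4 : closed (u k.+4) by apply: Yu.
have b01 := joined_bound Y0 Y1 j01.
have b12 := joined_bound Y1 Y2 (j 1 isT).
have bk2 := joined_bound Yk2 Yk3 (j k.+2 (leqnSn _)).
have bk3 := joined_bound Yk3 Yk4 jlast.
have bmid : \sum_(i < k) q (u i.+2) (u i.+3) + 3 * \sum_(i < k) f i.+2 <= k * E (u 0).
  rewrite big_distrr /= -big_split /= -[k in k * _]card_ord -sum_nat_const.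
  apply: leq_sum => i _; have lt := ltn_ord i.
  have Yi2 : closed (u i.+2) by apply: Yu; lia.
  have Yi3 : closed (u i.+3) by apply: Yu; lia.
  have := joined_bound Yi2 Yi3 (j i.+2 _); rewrite Eu /f; last by lia.
  by move/(_ (leq_trans lt (leqW (leqnSn k)))); clear; lia.
have sumf : \sum_(i < k.+4) f i = f 0 + f 1 + \sum_(i < k) f i.+2 + f k.+2 + f k.+3.
  rewrite big_ord_recr big_ord_recr big_ord_recl big_ord_recl /= !addnA.
  by do 3!congr addn; apply: eq_bigr.
have n02 : u 0 != u 2 by apply/eqP=> /u_inj H; have := H isT isT.
have nk : u k.+2 != u k.+4 by apply/eqP=> /(u_inj k2n k4n); clear; lia.
have b02 : F (u 0) (u 2) = 0 \/ 2 * q (u 0) (u 2) + 6 * F (u 0) (u 2) <= (E (u 0)).*2.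
  case/orP: j02 => [nj|/joined3 j']; first by left; apply: not_joined_tops.
  by right; apply: joined_bound.
have bkk : F (u k.+2) (u k.+4) = 0 \/
    2 * q (u k.+2) (u k.+4) + 6 * F (u k.+2) (u k.+4) <= (E (u k.+2)).*2.
  case/orP: jb => [nj|/joined3 j']; first by left; apply: not_joined_tops.
  by right; apply: joined_bound.
have t11 := chain_bound (or_intror erefl) (or_introl erefl).
have t21 := chain_bound (or_introl erefl) (or_introl erefl).
have t12 := chain_bound (or_intror erefl) (or_intror erefl).
have t22 := chain_bound (or_introl erefl) (or_intror erefl).
have d0 := descents_loops Y0.
have L1 := Lu 1 isT; have L2 := Lu 2 isT.
have Lk2 := Lu _ k2n.
have Lk3 := Lu _ k3n.
have Lk4 := Lu _ k4n.
have Ek2 := Eu _ k2n.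
have Ek3 := Eu _ k3n.
have E1 := Eu 1 isT.
have q21 : q (u 2) (u 1) = q (u 1) (u 2) by apply: endsC; rewrite L1 L2.
have q20 : q (u 2) (u 0) = q (u 0) (u 2) by apply: endsC; rewrite L2.
have q10 : q (u 1) (u 0) = q (u 0) (u 1) by apply: endsC; rewrite L1.
have q43 : q (u k.+4) (u k.+3) = q (u k.+3) (u k.+4) by apply: endsC; rewrite Lk4 Lk3.
rewrite q21 q10 in t11 t12; rewrite q20 in t21 t22; rewrite q43 in t12 t22.
rewrite E1 in b12; rewrite Ek2 in bk2 bkk; rewrite Ek3 in bk3.
rewrite L2 in t11 t12 t21 t22.
have ubound : L (u 0) + \sum_(i < k.+4) f i + F (u 0) (u 2) + F (u k.+2) (u k.+4)
    <= (k + 3) * E (u 0).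
  rewrite sumf /f mulnDl; move: t11 t12 t21 t22 b01 b12 bk2 bk3 bmid b02 bkk; clear.
  move: (\sum_(i < k) _) (\sum_(i < k) _) (k * _) => M MF kE.
  by move=> t11 t12 t21 t22 b01 b12 bk2 bk3 bmid [b02|b02] [bkk|bkk]; lia.
move: e sumF ubound d0; rewrite sumE mulnDl; clear.
move: (\sum_(i < n) _) (\sum_(i < k.+4) _) (k * _) => *; lia.
Qed.

End Chain.

Section Triangle.
Variables v1 v2 v3 : S.
Hypotheses (Y1 : closed v1) (Y2 : closed v2) (Y3 : closed v3).
Hypothesis noloop : forall x, x \in Y -> sigma v1 x = x -> sigma v2 x = x -> sigma v3 x = x -> False.
Hypothesis v13 : v1 != v3.

Lemma tree3 a b c : {subset [:: v1; v2; v3] <= [:: a; b; c]} ->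
  L a = L b -> L b = L c -> L a <= q a b + q b c.
Proof.
move=> abc Lab Lbc; have := @tree_bound b [:: (b, a); (b, c)].
rewrite !big_cons big_nil addn0 /= -Lab -(endsC Lab); apply=> x xY sb H.
have sa := H (b, a) (mem_head _ _) sb.
have sc : sigma c x = x by apply: (H (b, c)) => //; rewrite !inE eqxx orbT.
have all v : v \in [:: v1; v2; v3] -> sigma v x = x.
  by move/abc; rewrite !inE => /or3P[]/eqP->.
by apply: (noloop xY); apply: all; rewrite !inE eqxx ?orbT.
Qed.

(** Each edge satisfies [4 q + 10 F <= 2 E].  For a path its only spanning
    tree gives the contradiction, for a triangle the three of them together. *)
Lemma no_A : joined label (leq 5) v1 v2 -> joined label (leq 5) v2 v3 ->
  not_joined label v1 v3 || joined label (leq 5) v1 v3 -> False.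
Proof.
move=> j12 j23 j13.
have e := euler3 Y1 Y2 Y3.
have d1 := descents_loops Y1; have d2 := descents_loops Y2; have d3 := descents_loops Y3.
have L12 := joined_loops Y1 Y2 j12; have L23 := joined_loops Y2 Y3 j23.
have b12 := joined_bound Y1 Y2 j12; have b23 := joined_bound Y2 Y3 j23.
have t1 := @tree3 v1 v2 v3 (fun _ => id) L12 L23.
case/orP: j13 => j13.
  by rewrite (not_joined_tops v13 j13) in e; lia.
have b13 := joined_bound Y1 Y3 j13.
have t2 : L v1 <= q v1 v3 + q v3 v2.
  by apply: tree3; rewrite -?L23 // => x; rewrite !inE => /or3P[]->; rewrite ?orbT.
have t3 : L v2 <= q v2 v1 + q v1 v3.
  by apply: tree3; rewrite ?L12 -?L23 // => x; rewrite !inE => /or3P[]->; rewrite ?orbT.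
rewrite -(endsC L12) in t3; rewrite -(endsC L23) in t2.
lia.
Qed.

(** The label [7] makes [6 q + 14 F <= 2 E] on the first edge, and the two
    spanning trees that contain this edge suffice. *)
Lemma no_B : joined label (leq 7) v1 v2 -> joined label (leq 5) v2 v3 ->
  joined label (pred1 3) v1 v3 -> False.
Proof.
clear v13; move=> j12 j23 /joined3 j13.
have e := euler3 Y1 Y2 Y3.
have d1 := descents_loops Y1; have d2 := descents_loops Y2; have d3 := descents_loops Y3.
have L12 := joined_loops Y1 Y2 j12; have L23 := joined_loops Y2 Y3 j23.
have b12 := joined_bound Y1 Y2 j12; have b23 := joined_bound Y2 Y3 j23.
have b13 := joined_bound Y1 Y3 j13.
have t1 := @tree3 v1 v2 v3 (fun _ => id) L12 L23.
have t3 : L v2 <= q v2 v1 + q v1 v3.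
  by apply: tree3; rewrite ?L12 -?L23 // => x; rewrite !inE => /or3P[]->; rewrite ?orbT.
rewrite -(endsC L12) in t3.
lia.
Qed.

End Triangle.

Section Quadruple.
Variables v1 v2 v3 v4 : S.
Hypotheses (Y1 : closed v1) (Y2 : closed v2) (Y3 : closed v3) (Y4 : closed v4).
Hypothesis noloop : forall x, x \in Y -> sigma v1 x = x -> sigma v2 x = x ->
  sigma v3 x = x -> sigma v4 x = x -> False.
Hypothesis v_uniq : uniq [:: v1; v2; v3; v4].

Let all4 a b c d x : {subset [:: v1; v2; v3; v4] <= [:: a; b; c; d]} -> x \in Y ->
  sigma a x = x -> sigma b x = x -> sigma c x = x -> sigma d x = x -> False.
Proof.
move=> sub xY sa sb sc sd.
have all v : v \in [:: v1; v2; v3; v4] -> sigma v x = x.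
  by move/sub; rewrite !inE => /or4P[]/eqP->.
by apply: (noloop xY); apply: all; rewrite !inE eqxx ?orbT.
Qed.

Lemma path4 a b c d : {subset [:: v1; v2; v3; v4] <= [:: a; b; c; d]} ->
  L a <= q a b + q b c + q c d.
Proof.
move=> sub; have := @tree_bound a [:: (a, b); (b, c); (c, d)].
rewrite !big_cons big_nil addn0 /= !addnA; apply=> x xY sa H.
have sb : sigma b x = x by apply: (H (a, b)); rewrite // !inE eqxx.
have sc : sigma c x = x by apply: (H (b, c)); rewrite // !inE eqxx ?orbT.
by apply: (all4 sub xY) => //; apply: (H (c, d)); rewrite // !inE eqxx ?orbT.
Qed.

Lemma star4 a b c d : {subset [:: v1; v2; v3; v4] <= [:: a; b; c; d]} ->
  L a <= q a b + q a c + q a d.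
Proof.
move=> sub; have := @tree_bound a [:: (a, b); (a, c); (a, d)].
rewrite !big_cons big_nil addn0 /= !addnA; apply=> x xY sa H.
by apply: (all4 sub xY) => //; [apply: (H (a, b))|apply: (H (a, c))|apply: (H (a, d))];
  rewrite // !inE eqxx ?orbT.
Qed.

Let sub4 a b c d : [/\ v1 \in [:: a; b; c; d], v2 \in [:: a; b; c; d],
  v3 \in [:: a; b; c; d] & v4 \in [:: a; b; c; d]] ->
  {subset [:: v1; v2; v3; v4] <= [:: a; b; c; d]}.
Proof. by move=> [H1 H2 H3 H4] x; rewrite !inE in H1 H2 H3 H4 *; case/or4P=> /eqP->. Qed.

(** As soon as one of the pairs between the two edges [v1 v2] and [v3 v4] is not
    joined, it has no full cycles, and averaging the spanning paths that contain
    these two edges gives the contradiction. *)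
Lemma no_C_sparse : joined label (leq 5) v1 v2 -> joined label (leq 5) v3 v4 ->
  joined label (pred1 3) v2 v3 ->
  not_joined label v1 v3 || joined label (pred1 3) v1 v3 ->
  not_joined label v1 v4 || joined label (pred1 3) v1 v4 ->
  not_joined label v2 v4 || joined label (pred1 3) v2 v4 ->
  [|| not_joined label v1 v3, not_joined label v1 v4 | not_joined label v2 v4] -> False.
Proof.
move: v_uniq; rewrite /= !inE !negb_or => /and4P[/and3P[_ n13 n14] /andP[_ n24] _ _].
move=> j12 j34 /joined3 j23 j13 j14 j24 sparse.
have e := euler4 Y1 Y2 Y3 Y4.
have d1 := descents_loops Y1; have d2 := descents_loops Y2.
have d3 := descents_loops Y3; have d4 := descents_loops Y4.
have L12 := joined_loops Y1 Y2 j12; have L34 := joined_loops Y3 Y4 j34.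
have L23 := joined_loops Y2 Y3 j23.
have b12 := joined_bound Y1 Y2 j12; have b34 := joined_bound Y3 Y4 j34.
have b23 := joined_bound Y2 Y3 j23.
have t23 : L v1 <= q v1 v2 + q v2 v3 + q v3 v4.
  by apply: path4; apply: sub4; rewrite !inE !eqxx ?orbT.
have t13 : L v2 <= q v1 v2 + q v1 v3 + q v3 v4.
  by rewrite (endsC L12); apply: path4; apply: sub4; rewrite !inE !eqxx ?orbT.
have t14 : L v2 <= q v1 v2 + q v1 v4 + q v3 v4.
  by rewrite (endsC L12) (endsC L34); apply: path4; apply: sub4; rewrite !inE !eqxx ?orbT.
have t24 : L v1 <= q v1 v2 + q v2 v4 + q v3 v4.
  by rewrite (endsC L34); apply: path4; apply: sub4; rewrite !inE !eqxx ?orbT.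
have F3 s t : s != t -> closed s -> closed t -> not_joined label s t || joined label (pred1 3) s t ->
    (not_joined label s t -> F s t = 0) /\ (F s t = 0 \/ 2 * q s t + 6 * F s t <= (E s).*2).
  move=> neq Ys Yt /orP[nj|/joined3 j]; first by rewrite (not_joined_tops neq nj); split; auto.
  by split; [move/(not_joined_tops neq)|right; apply: joined_bound].
have [z13 b13] := F3 _ _ n13 Y1 Y3 j13.
have [z14 b14] := F3 _ _ n14 Y1 Y4 j14.
have [z24 b24] := F3 _ _ n24 Y2 Y4 j24.
by case/or3P: sparse => [/z13|/z14|/z24] z; case: b13 => b13; case: b14 => b14;
  case: b24 => b24; clear - e d1 d2 d3 d4 L12 L34 L23 b12 b34 b23 t23 t13 t14 t24 b13 b14 b24 z; lia.
Qed.

Lemma no_D : joined label (pred1 5) v1 v2 -> joined label (pred1 5) v2 v3 ->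
  joined label (pred1 5) v3 v4 ->
  joined label (pred1 3) v1 v3 -> joined label (pred1 3) v2 v4 ->
  not_joined label v1 v4 || joined label (pred2 3 5) v1 v4 -> False.
Proof.
move: v_uniq; rewrite /= !inE !negb_or => /and4P[/and3P[_ n13 n14] /andP[_ n24] _ _].
move=> /joined5 j12 /joined5 j23 /joined5 j34 /joined3 j13 /joined3 j24 j14.
have e := euler4 Y1 Y2 Y3 Y4.
have d1 := descents_loops Y1; have d2 := descents_loops Y2.
have d3 := descents_loops Y3; have d4 := descents_loops Y4.
have L12 := joined_loops Y1 Y2 j12; have L34 := joined_loops Y3 Y4 j34.
have L23 := joined_loops Y2 Y3 j23.
have b12 := joined_bound Y1 Y2 j12; have b34 := joined_bound Y3 Y4 j34.
have b23 := joined_bound Y2 Y3 j23; have b13 := joined_bound Y1 Y3 j13.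
have b24 := joined_bound Y2 Y4 j24.
have t13 : L v2 <= q v1 v2 + q v1 v3 + q v3 v4.
  by rewrite (endsC L12); apply: path4; apply: sub4; rewrite !inE !eqxx ?orbT.
have t24 : L v2 <= q v1 v2 + q v2 v3 + q v2 v4.
  by rewrite (endsC L12); apply: star4; apply: sub4; rewrite !inE !eqxx ?orbT.
have t14 : L v1 <= q v1 v4 + q v3 v4 + q v2 v3.
  by rewrite (endsC L34) (endsC L23); apply: path4; apply: sub4; rewrite !inE !eqxx ?orbT.
case/orP: j14 => [/(not_joined_tops n14) F14|j14].
  by clear - e d1 d2 d3 d4 L12 L34 L23 b12 b34 b23 b13 b24 t13 t24 F14; lia.
have b14 : 2 * q v1 v4 + 6 * F v1 v4 <= (E v1).*2 \/
    4 * q v1 v4 + 10 * F v1 v4 <= (E v1).*2.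
  move: j14; rewrite /joined; case E14: (label v1 v4) => [k|] //= /orP[]/eqP k_eq.
    by left; apply: joined_bound; rewrite // /joined E14 /= k_eq.
  by right; apply: joined_bound; rewrite // /joined E14 /= k_eq.
by case: b14 => b14; clear - e d1 d2 d3 d4 L12 L34 L23 b12 b34 b23 b13 b24 t13 t24 t14 b14; lia.
Qed.

Lemma no_E : joined label (pred1 5) v1 v2 -> joined label (pred1 5) v1 v3 ->
  joined label (pred1 5) v1 v4 ->
  joined label (pred1 3) v2 v3 -> joined label (pred1 3) v2 v4 ->
  joined label (pred1 3) v3 v4 -> False.
Proof.
clear v_uniq; move=> /joined5 j12 /joined5 j13 /joined5 j14 /joined3 j23 /joined3 j24 /joined3 j34.
have e := euler4 Y1 Y2 Y3 Y4.
have d1 := descents_loops Y1; have d2 := descents_loops Y2.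
have d3 := descents_loops Y3; have d4 := descents_loops Y4.
have L12 := joined_loops Y1 Y2 j12; have L34 := joined_loops Y3 Y4 j34.
have L23 := joined_loops Y2 Y3 j23; have L13 := joined_loops Y1 Y3 j13.
have L14 := joined_loops Y1 Y4 j14; have L24 := joined_loops Y2 Y4 j24.
have b12 := joined_bound Y1 Y2 j12; have b34 := joined_bound Y3 Y4 j34.
have b23 := joined_bound Y2 Y3 j23; have b13 := joined_bound Y1 Y3 j13.
have b24 := joined_bound Y2 Y4 j24; have b14 := joined_bound Y1 Y4 j14.
have t23 : L v3 <= q v2 v3 + q v1 v2 + q v1 v4.
  by rewrite (endsC L23) (endsC L12); apply: path4; apply: sub4; rewrite !inE !eqxx ?orbT.
have t24 : L v2 <= q v2 v4 + q v1 v4 + q v1 v3.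
  by rewrite (endsC L14); apply: path4; apply: sub4; rewrite !inE !eqxx ?orbT.
have t34 : L v4 <= q v3 v4 + q v1 v3 + q v1 v2.
  by rewrite (endsC L34) (endsC L13); apply: path4; apply: sub4; rewrite !inE !eqxx ?orbT.
lia.
Qed.

End Quadruple.

End Counting.

(** * Discharging for a complete diagram on four vertices *)

Section Discharging.
Variables (S : finType) (m : coxeter_matrix S).
Hypothesis m_odd : odd_angled m.
Local Notation W := (coxeter_group m).
Local Notation gen := (cox_gen m).
Variables (X : finType) (sigma : S -> X -> X) (rho : X -> W).
Hypothesis rels : cox_rels m sigma.
Hypothesis rho_inj : injective rho.
Hypothesis rho_move : forall s x, sigma s x != x -> rho (sigma s x) = (rho x * gen s)%g.
Hypothesis rho_wall : forall s x, sigma s x = x ->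
  crossing_free rho (rho x * gen s * (rho x)^-1)%g.
Let sK s : involutive (sigma s) := sigmaK rels s.
Local Notation label := (cox_div m).

(** A path with two vertices is impossible, as [2] does not divide an odd number. *)
Lemma next_moves (P : pred nat) s t x : joined label P s t -> sigma s x != x ->
  sigma t x = x -> sigma t (sigma s x) != sigma s x.
Proof.
case/(joinedP m_odd)=> k [_ mst k_odd _] sx tx; apply/eqP=> ty.
pose tau y := sigma t (sigma s y).
have t2 : tau (tau x) = x by rewrite /tau ty sK tx.
have it h : iter h.*2 tau x = x by elim: h => // h IH; rewrite doubleS !iterS IH.
have := rels mst x; rewrite -(odd_double_half k) k_odd iterS it => /= xs.
by move: ty xs sx => -> ->; rewrite eqxx.
Qed.

(** A label at least [5] excludes orbits of rotation of length below [5]; the next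
    two lemmas exclude paths with three and four vertices. *)
Lemma order_ge5 s t x i : joined label (leq 5) s t ->
  sigma t (sigma s x) != x ->
  iter i.+1 (fun y => sigma t (sigma s y)) x = x -> 5 <= i.+1.
Proof.
case/(joinedP m_odd)=> k [_ mst k_odd pk] tx itx.
have := tau_order_ge (sK s) (sK t) (rels mst) pk tx.
set tau := (fun y => _) in itx *; move=> le5.
rewrite leqNgt; apply/negP=> lt; have lt' := leq_trans lt le5.
by have := findex_iter lt'; rewrite itx findex0.
Qed.

Lemma long_path3 s t x : joined label (leq 5) s t -> sigma s x != x -> sigma t x != x ->
  sigma t (sigma s x) = sigma s x -> sigma s (sigma t x) != sigma t x.
Proof.
move=> j sx tx ty; apply/eqP=> sz.
by have := @order_ge5 s t x 2 j; rewrite /= !(ty, sz, sK) => /(_ sx erefl).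
Qed.

Lemma long_path4 s t x : joined label (leq 5) s t -> sigma s x != x ->
  sigma t (sigma s x) = sigma s x ->
  sigma t (sigma s (sigma t x)) != sigma s (sigma t x).
Proof.
move=> j sx ty; apply/eqP=> tw.
by have := @order_ge5 s t x 3 j; rewrite /= !(ty, tw, sK) => /(_ sx erefl).
Qed.

Variable Y : {set X}.
Hypothesis Y_neq0 : Y != finset.set0.
Variable v : bool * bool -> S.
Hypothesis v_closed : forall l x, x \in Y -> sigma (v l) x \in Y.
Hypothesis noloop : forall x, x \in Y -> (forall l, sigma (v l) x = x) -> False.

Local Notation letter := (bool * bool)%type.
(** The four colours are the pairs of booleans; the first component names one of
    the two big edges, those with a label at least [5], the second an end of it.
    The three other colours are the other end of the same big edge and the two
    ends of the opposite one. *)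
Definition mate (l : letter) : letter := (l.1, ~~ l.2).
Definition across (l : letter) : letter := (~~ l.1, l.2).
Definition diagonal (l : letter) : letter := (~~ l.1, ~~ l.2).

Hypothesis j1 : forall l, joined label (leq 5) (v l) (v (mate l)).
Hypothesis j2 : forall l, joined label (leq 3) (v l) (v (across l)).
Hypothesis j3 : forall l, joined label (leq 3) (v l) (v (diagonal l)).

Lemma mateK : involutive mate. Proof. by case=> a i; rewrite /mate /= negbK. Qed.

Definition moves (l : letter) (x : X) : bool := sigma (v l) x != x.
Definition cyc_pair (l l' : letter) (x : X) : bool := cyclic2 sigma (v l) (v l') x.
Definition degree (x : X) : nat := \sum_l moves l x.
(** The far end of the edge of colour [l] has no other edge. *)
Definition leaf (l : letter) (x : X) : bool :=
  [&& moves l x, ~~ moves (mate l) (sigma (v l) x), ~~ moves (across l) (sigma (v l) x) &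
      ~~ moves (diagonal l) (sigma (v l) x)].
(** The weight of the edge in the cycles.  In units of [1 / 60], a full cycle counts
    [60] in the Euler inequality and has at least [10] points on a big edge and
    at least [6] on any other one; so [6] or [10] for each of its points pays for
    it, and half of this falls on each of the two colours. *)
Definition cyc_weight l x : nat :=
  3 * cyc_pair l (mate l) x + 5 * cyc_pair l (across l) x + 5 * cyc_pair l (diagonal l) x.
(** The one situation in which a point of degree [4] has too much weight: two
    leaves, necessarily on different big edges, and a cycle through the two other
    colours, of which [l] is one. *)
Definition sender l x : bool := [&& degree x == 4, leaf (mate l) x &
   (leaf (across l) x && cyc_pair l (diagonal l) x) || (leaf (diagonal l) x && cyc_pair l (across l) x)].
(** The weight moved along the edge: a point with one edge gives it [30], a point
    on a cycle without other edges divides the weight of the cycle between its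
    two edges, and a sender gives [5] to each of its two edges that are not
    leaves. *)
Definition sent l x : nat := moves l x *
  (if degree x == 1 then 30 else if degree x == 2 then cyc_weight l x else 5 * sender l x).
(** What the edge of colour [l] brings to [x]: its share of the cycles and the
    weight from its far end. *)
Definition received l x : nat := cyc_weight l x + sent l (sigma (v l) x).

Lemma sum_letters (f : letter -> nat) l : \sum_l' f l' = f l + f (mate l) + f (across l) + f (diagonal l).
Proof.
transitivity (\sum_a \sum_i f (a, i)); first by rewrite pair_big; apply: eq_bigr => -[].
rewrite !big_bool /=.
by case: l => -[] []; rewrite /mate /across /diagonal /=; lia.
Qed.

Lemma cyc_pair_moves l l' x : cyc_pair l l' x -> moves l x && moves l' x.
Proof. by move/forallP/(_ x); rewrite connect0. Qed.

Lemma cyc_pair_sigma l l' x : cyc_pair l l' (sigma (v l) x) = cyc_pair l l' x.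
Proof.
apply/esym/(cyclic_step rels); rewrite connect1 //.
by rewrite /step2 eqxx.
Qed.

Lemma cyc_pairC l l' x : cyc_pair l l' x = cyc_pair l' l x.
Proof.
have E a b : step2 sigma a b =2 step2 sigma b a by move=> y z; rewrite /step2 orbC.
by apply: eq_forallb => z; rewrite (eq_connect (E _ _)) andbC.
Qed.

Lemma leaf_acyclic l x : leaf l x ->
  [/\ cyc_pair l (mate l) x = false, cyc_pair l (across l) x = false & cyc_pair l (diagonal l) x = false].
Proof.
case/and4P=> _ n1 n2 n3; split; apply/negbTE/negP; rewrite -cyc_pair_sigma => /cyc_pair_moves/andP[_].
- by rewrite (negbTE n1).
- by rewrite (negbTE n2).
- by rewrite (negbTE n3).
Qed.

(** On a big edge paths have at least five vertices; this is why a leaf of colour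
    [mate l] at [x] forces the mate at the far end [y] and excludes a second leaf
    there. *)
Lemma edge_facts l x (y := sigma (v l) x) : moves l x ->
  [/\ moves l y,
      [/\ ~~ moves (mate l) y -> moves (mate l) x, ~~ moves (across l) y -> moves (across l) x &
          ~~ moves (diagonal l) y -> moves (diagonal l) x],
      leaf (mate l) x -> moves (mate l) y &
      leaf (mate l) x -> ~~ leaf (mate l) y].
Proof.
move=> lx; have ly : moves l y by rewrite /moves sK eq_sym.
have nxt P l' : joined label P (v l) (v l') -> ~~ moves l' y -> moves l' x.
  move=> j /negPn/eqP l'y; have := next_moves j ly l'y.
  by rewrite /y sK.
have jo1 : joined label (leq 5) (v (mate l)) (v l) by rewrite -{2}[l]mateK; apply: j1.
split=> //; first by split; apply: nxt.
  case/and4P=> ox; rewrite mateK => /negPn/eqP lz _ _.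
  exact: (long_path3 jo1 ox lx lz).
case/and4P=> ox; rewrite mateK => /negPn/eqP lz _ _.
apply/negP=> /and4P[_ ]; rewrite mateK => /negPn/eqP lw _ _.
by have := long_path4 jo1 ox lz; rewrite lw eqxx.
Qed.

Lemma degreeE l x : moves l x -> degree x = (moves (mate l) x + moves (across l) x + moves (diagonal l) x).+1.
Proof. by move=> lx; rewrite /degree (sum_letters _ l) lx. Qed.

Lemma cyc_weight_sigma l x : cyc_weight l (sigma (v l) x) = cyc_weight l x.
Proof. by rewrite /cyc_weight !cyc_pair_sigma. Qed.

(** The weight which the far end sends, as a function of the colours [p] that move
    it, of the cycles [c] and of its leaves [L], for the three colours other than
    that of the edge.  The four lemmas below are finite checks on this function;
    the hypotheses are what [edge_facts] and [leaf_acyclic] say about the two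
    ends. *)
Definition delivery (p1 p2 p3 c1 c2 c3 L1 L2 L3 : bool) : nat :=
  if [&& ~~ p1, ~~ p2 & ~~ p3] then 30 else
  if p1 + p2 + p3 == 1 then 3 * c1 + 5 * c2 + 5 * c3
  else 5 * [&& [&& p1, p2 & p3], L1 & (L2 && c3) || (L3 && c2)].

Lemma delivery_leaf (p1 p2 p3 c1 c2 c3 : bool) :
  (c1 -> p1) -> (c2 -> p2) -> (c3 -> p3) -> [&& ~~ p1, ~~ p2 & ~~ p3] ->
  3 * c1 + 5 * c2 + 5 * c3 + 30 = 30.
Proof.
by case: c1 => [->|_] //; case: c2 => [->|_] //=; [rewrite andbF|
   case: c3 => [->|_] //=; rewrite !andbF].
Qed.

Lemma delivery_bound (p1 p2 p3 c1 c2 c3 L1 L2 L3 : bool) :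
  (c1 -> p1) -> (c2 -> p2) -> (c3 -> p3) ->
  (L1 -> c1 = false) -> (L2 -> c2 = false) -> (L3 -> c3 = false) ->
  ~~ [&& ~~ p1, ~~ p2 & ~~ p3] ->
  3 * c1 + 5 * c2 + 5 * c3 + delivery p1 p2 p3 c1 c2 c3 L1 L2 L3 <= 10 + 3 * [&& c1, c2 & c3].
Proof.
by case: p1 p2 p3 c1 c2 c3 L1 L2 L3 => -[] [] [] [] [] [] [] [] h1 h2 h3 h4 h5 h6 h7;
  first [done|discriminate h7|discriminate (h1 isT)|discriminate (h2 isT)
        |discriminate (h3 isT)|discriminate (h4 isT)|discriminate (h5 isT)
        |discriminate (h6 isT)].
Qed.

Lemma delivery_low (p1 p2 p3 r1 r2 r3 c1 c2 c3 L1 L2 L3 : bool) :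
  (c1 -> r1) -> (c2 -> r2) -> (c3 -> r3) ->
  (~~ p1 -> r1) -> (~~ p2 -> r2) -> (~~ p3 -> r3) -> (L1 -> r1) ->
  r1 + r2 + r3 <= 1 -> delivery p1 p2 p3 c1 c2 c3 L1 L2 L3 = 0.
Proof.
by case: p1 p2 p3 r1 r2 r3 => -[] [] [] [] [] h1 h2 h3 h4 h5 h6 h7 //= _;
  first [discriminate (h4 isT)|discriminate (h5 isT)|discriminate (h6 isT)|idtac];
  move: h1 h2 h3 h7; rewrite /delivery /=; case: c1 => h1; case: c2 => h2; case: c3 => h3; case: L1 => h7;
  rewrite /= ?andbF //;
  first [discriminate (h1 isT)|discriminate (h2 isT)|discriminate (h3 isT)|discriminate (h7 isT)].
Qed.

Lemma delivery_pair (p1 p2 p3 c1 c2 c3 L1 L2 L3 M2 M3 : bool) :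
  (c1 -> p1) -> (c2 -> p2) -> (c3 -> p3) -> p1 -> ~~ L1 -> c1 = false ->
  (M2 -> c2 = false) -> (M3 -> c3 = false) -> M2 || M3 ->
  3 * c1 + 5 * c2 + 5 * c3 + delivery p1 p2 p3 c1 c2 c3 L1 L2 L3 <=
  5 * ((M2 && c3) || (M3 && c2)).
Proof.
move=> h1 h2 h3 -> /negbTE -> -> h4 h5; rewrite /delivery /= andbF.
case: M2 h4 => [/(_ isT) c2F|_]; case: M3 h5 => [/(_ isT) c3F|_] //= _; rewrite ?c2F ?c3F;
 rewrite ?c2F ?c3F /= in h2 h3 *; case: p2 h2 => h2; case: p3 h3 => h3 //=;
 by case: (c3) (c2) h2 h3 => -[] // h2 h3; first [discriminate (h2 isT)|discriminate (h3 isT)].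
Qed.

(** The bounds that balance the weights at [x]: a leaf brings exactly [30], any other
    edge at most [13], and only [10] unless it is in three cycles; points of
    degree at most [2] receive nothing from their neighbours, and at a point of
    degree [4] with two leaves the two other edges bring no more than [x] sends
    along them. *)
Lemma delivery_facts l x (y := sigma (v l) x) : moves l x ->
  [/\ leaf l x -> received l x = 30,
      ~~ leaf l x -> received l x <=
        10 + 3 * [&& cyc_pair l (mate l) x, cyc_pair l (across l) x & cyc_pair l (diagonal l) x],
      degree x <= 2 -> sent l y = 0 &
      degree x = 4 -> leaf (mate l) x -> leaf (across l) x || leaf (diagonal l) x -> received l x <= sent l x].
Proof.
move=> lx; have [ly [n1 n2 n3] near1 apart1] := edge_facts lx.
rewrite -/y in ly n1 n2 n3 near1 apart1.
have near1' : leaf (mate l) y -> moves (mate l) x.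
  by move=> H; have [_ _] := edge_facts ly; rewrite /y sK => /(_ H).
have leafE : leaf l x = [&& ~~ moves (mate l) y, ~~ moves (across l) y & ~~ moves (diagonal l) y].
  by rewrite /leaf lx.
have dy := degreeE ly; have dx := degreeE lx.
have cx1 := @cyc_pair_moves l (mate l) x; have cx2 := @cyc_pair_moves l (across l) x.
have cx3 := @cyc_pair_moves l (diagonal l) x.
have cy1 := @cyc_pair_moves l (mate l) y; have cy2 := @cyc_pair_moves l (across l) y.
have cy3 := @cyc_pair_moves l (diagonal l) y.
rewrite !cyc_pair_sigma lx ly /= in cx1 cx2 cx3 cy1 cy2 cy3.
have l1y : leaf (mate l) y -> cyc_pair l (mate l) x = false.
  by move/leaf_acyclic=> []; rewrite mateK cyc_pairC cyc_pair_sigma.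
have o22 : across (across l) = l by case: (l) => a i; rewrite /across /= negbK.
have o33 : diagonal (diagonal l) = l by case: (l) => a i; rewrite /diagonal /= !negbK.
have l2y : leaf (across l) y -> cyc_pair l (across l) x = false.
  by move/leaf_acyclic=> [_]; rewrite o22 cyc_pairC cyc_pair_sigma.
have l3y : leaf (diagonal l) y -> cyc_pair l (diagonal l) x = false.
  by move/leaf_acyclic=> [_ _]; rewrite o33 cyc_pairC cyc_pair_sigma.
have l1x : leaf (mate l) x -> cyc_pair l (mate l) x = false.
  by move/leaf_acyclic=> []; rewrite mateK cyc_pairC.
have l2x : leaf (across l) x -> cyc_pair l (across l) x = false.
  by move/leaf_acyclic=> [_]; rewrite o22 cyc_pairC.
have l3x : leaf (diagonal l) x -> cyc_pair l (diagonal l) x = false.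
  by move/leaf_acyclic=> [_ _]; rewrite o33 cyc_pairC.
have outy : sent l y = if [&& ~~ moves (mate l) y, ~~ moves (across l) y & ~~ moves (diagonal l) y] then 30 else
   if moves (mate l) y + moves (across l) y + moves (diagonal l) y == 1 then cyc_weight l x
   else 5 * [&& [&& moves (mate l) y, moves (across l) y & moves (diagonal l) y], leaf (mate l) y &
     (leaf (across l) y && cyc_pair l (diagonal l) x) || (leaf (diagonal l) y && cyc_pair l (across l) x)].
  rewrite /sent ly mul1n cyc_weight_sigma /sender !cyc_pair_sigma dy !eqSS.
  by case: (moves _ y); case: (moves _ y); case: (moves _ y).
have outx : degree x = 4 -> sent l x = 5 * (leaf (mate l) x &&
     ((leaf (across l) x && cyc_pair l (diagonal l) x) || (leaf (diagonal l) x && cyc_pair l (across l) x))).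
  by move=> d4; rewrite /sent lx mul1n /sender d4.
rewrite /received outy leafE; split.
- by move=> E; have := delivery_leaf cy1 cy2 cy3 E; rewrite E.
- by move=> E; exact: (delivery_bound cy1 cy2 cy3 l1y l2y l3y E).
- by rewrite dx ltnS => d2; exact: (delivery_low _ _ cx1 cx2 cx3 n1 n2 n3 near1' d2).
- move=> d4 M1 M23; rewrite (outx d4) M1 /=.
  apply: delivery_pair cy1 cy2 cy3 (near1 M1) (apart1 M1) (l1x M1) l2x l3x M23.
Qed.

Lemma fixed_no_charge l x : ~~ moves l x -> received l x = 0 /\ sent l x = 0.
Proof.
move=> /[dup] nl /negbTE nl'; rewrite /received /sent (eqP (negPn nl)) nl' mul0n addn0; split=> //.
by rewrite /cyc_weight; do 3!(case: (boolP (cyc_pair l _ x)) => [/cyc_pair_moves|_]; rewrite ?nl' //).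
Qed.

Lemma leaf_degree l x : leaf l x -> degree x = 4.
Proof.
case/and4P=> lx n1 n2 n3; have [_ [h1 h2 h3] _ _] := edge_facts lx.
by rewrite (degreeE lx) h1 ?h2 ?h3.
Qed.

(** After the weights have moved, no vertex has a positive share of
    [60 (V - E + F)].  The cases are the degrees [1], [2], [3] and [4]; degree [0]
    is excluded because no vertex carries all the loops. *)
Lemma local_charge x : x \in Y -> 60 + \sum_l received l x <= 30 * degree x + \sum_l sent l x.
Proof.
move=> xY.
have cmv l l' : cyc_pair l l' x -> moves l' x by move/cyc_pair_moves/andP=> [].
have deg_le : degree x <= 4.
  by rewrite /degree (sum_letters _ (true, true)); do 4!case: (moves _ x).
have csum0 l : (forall l', l' != l -> ~~ moves l' x) -> cyc_weight l x = 0.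
  move=> none; have cF l' : l' != l -> cyc_pair l l' x = false.
    by move=> /none; apply: contraNF => /cmv.
  by rewrite /cyc_weight !cF //; case: (l) => -[] [].
case E : (degree x) deg_le => [|[|[|[|[]]]]] // _.
- case: (noloop xY) => l; apply/eqP; rewrite -[_ == _]negbK -/(moves l x).
  by apply/negP=> lx; rewrite (degreeE lx) in E.
- suff le l : received l x + 30 * moves l x <= sent l x.
    have := @leq_sum _ (index_enum _) xpredT _ _ (fun l _ => le l).
    rewrite big_split -big_distrr /= -/(degree x) E.
    by rewrite muln1; move: (\sum_l _) (\sum_l _) => a b; clear; lia.
  case: (boolP (moves l x)) => lx; last by have [-> ->] := fixed_no_charge lx.
  have [_ _ /(_ _) in0 _] := delivery_facts lx; rewrite /received in0 ?E // addn0.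
  rewrite csum0 /sent ?lx ?E // => l'.
  have := E; rewrite (degreeE lx) => -[/eqP]; rewrite !addn_eq0 !eqb0 => /andP[/andP[n1 n2] n3].
  by case: (l) l' n1 n2 n3 => -[] [] [[] []]; rewrite /mate /across /diagonal /=.
- suff le l : received l x <= sent l x by rewrite leq_add2l; apply: leq_sum.
  case: (boolP (moves l x)) => lx; last by have [-> ->] := fixed_no_charge lx.
  have [_ _ /(_ _) in0 _] := delivery_facts lx; rewrite /received in0 ?E // addn0.
  by rewrite /sent lx E mul1n.
- suff le l : received l x <= 10 * moves l x.
    apply: leq_trans (leq_addr _ _); rewrite (@leq_add2l 60 _ 30).
    apply: leq_trans (@leq_sum _ (index_enum _) xpredT _ _ (fun l _ => le l)) _.
    by rewrite -big_distrr /= -/(degree x) E.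
  case: (boolP (moves l x)) => lx; last by have [-> _] := fixed_no_charge lx.
  have [_ bound _ _] := delivery_facts lx; apply: leq_trans (bound _) _.
    by apply/negP=> /leaf_degree; rewrite E.
  rewrite [X in 3 * nat_of_bool X](_ : _ = false) //.
  apply/negP=> /and3P[/cmv r1 /cmv r2 /cmv r3].
  by move: E; rewrite (degreeE lx) r1 r2 r3.
have mvx l : moves l x.
  move: E; rewrite /degree (sum_letters _ l); case: (moves l x) => //.
  by do 3!case: (moves _ x).
have partner l : leaf l x -> ~~ leaf (mate l) x.
  move=> Hl; have [_ _ near _] := edge_facts (mvx (mate l)).
  by rewrite mateK in near; apply/negP=> /and4P[_ ]; rewrite mateK near.
have bound l : ~~ leaf l x -> received l x <=
    10 + 3 * [&& cyc_pair l (mate l) x, cyc_pair l (across l) x & cyc_pair l (diagonal l) x].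
  by have [] := delivery_facts (mvx l).
have [l0 Hl0|none] := pickP (fun l => leaf l x); last first.
  have le l : received l x <= 13.
    by apply: leq_trans (bound l _) _; rewrite ?none //; case: [&& _, _ & _].
  rewrite (sum_letters _ (true, true)).
  have := le (true, true); have := le (mate (true, true)); have := le (across (true, true)).
  have := le (diagonal (true, true)); clear; move: (\sum_l _) => a; lia.
have v0 : received l0 x = 30 by have [-> //] := delivery_facts (mvx l0).
have [c1 c2 c3] := leaf_acyclic Hl0.
have o22 l : across (across l) = l by case: l => a i; rewrite /across /= negbK.
have o33 l : diagonal (diagonal l) = l by case: l => a i; rewrite /diagonal /= !negbK.
have o12 l : mate (across l) = diagonal l by [].
have o13 l : mate (diagonal l) = across l by case: l => a i; rewrite /mate /across /= negbK.
have o21 l : across (mate l) = diagonal l by [].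
have o31 l : diagonal (mate l) = across l by case: l => a i; rewrite /diagonal /across /= negbK.
have le1 : received (mate l0) x <= 10.
  apply: leq_trans (bound _ (partner _ Hl0)) _.
  by rewrite mateK cyc_pairC c1 /=.
have le2 : ~~ leaf (across l0) x -> received (across l0) x <= 10.
  by move=> n; apply: leq_trans (bound _ n) _; rewrite o22 [cyc_pair (across l0) l0 x]cyc_pairC c2 /= andbF.
have le3 : ~~ leaf (diagonal l0) x -> received (diagonal l0) x <= 10.
  by move=> n; apply: leq_trans (bound _ n) _; rewrite o33 [cyc_pair (diagonal l0) l0 x]cyc_pairC c3 /= !andbF.
have pair l : leaf (mate l) x -> leaf (across l) x || leaf (diagonal l) x -> received l x <= sent l x.
  by have [_ _ _] := delivery_facts (mvx l); apply.
rewrite !(sum_letters _ l0) v0.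
have [L2|/le2 {}le2] := boolP (leaf (across l0) x).
  have p1 : received (mate l0) x <= sent (mate l0) x by apply: pair; rewrite ?mateK ?o31 ?L2 ?orbT.
  have p3 : received (diagonal l0) x <= sent (diagonal l0) x by apply: pair; rewrite ?o13 ?o33 ?Hl0 ?orbT.
  have v2 : received (across l0) x = 30 by have [-> //] := delivery_facts (mvx (across l0)).
  by rewrite v2; clear - p1 p3; lia.
have [L3|/le3 {}le3] := boolP (leaf (diagonal l0) x); last by clear - le1 le2 le3; lia.
have p1 : received (mate l0) x <= sent (mate l0) x by apply: pair; rewrite ?mateK ?o21 ?L3.
have p2 : received (across l0) x <= sent (across l0) x by apply: pair; rewrite ?o12 ?o22 ?Hl0.
have v3 : received (diagonal l0) x = 30 by have [-> //] := delivery_facts (mvx (diagonal l0)).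
by rewrite v3; clear - p1 p2; lia.
Qed.

Lemma sum_card (P : pred X) : \sum_(x in Y) P x = #|[set x in Y | P x]|.
Proof. by rewrite -sum1dep_card [RHS]big_mkcondr; apply: eq_bigr => x _; case: (P x). Qed.

(** Summed over all vertices, what is sent is what is received, so that
    [local_charge] contradicts the Euler inequality. *)
Lemma no_full_C : False.
Proof.
pose v1 := v (false, false); pose v2 := v (false, true).
pose v3 := v (true, false); pose v4 := v (true, true).
have cl l : forall x, x \in Y -> sigma (v l) x \in Y by move=> x; apply: v_closed.
have euler := euler4 rho_move rho_wall Y_neq0
  (cl (false, false)) (cl (false, true)) (cl (true, false))
  (cl (true, true)).
have total : \sum_(x in Y) (60 + \sum_l received l x) <=
    \sum_(x in Y) (30 * degree x + \sum_l sent l x).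
  by apply: leq_sum => x; apply: local_charge.
have outE : \sum_(x in Y) \sum_l sent l (sigma (v l) x) = \sum_(x in Y) \sum_l sent l x.
  rewrite exchange_big [RHS]exchange_big /=; apply: eq_bigr => l _.
  rewrite [RHS](reindex_inj (inv_inj (sK (v l)))) /=; apply: eq_bigl => x.
  by apply/idP/idP => [/v_closed//|/(v_closed l)]; rewrite sK.
have valE : \sum_(x in Y) \sum_l received l x =
    \sum_(x in Y) \sum_l cyc_weight l x + \sum_(x in Y) \sum_l sent l x.
  by rewrite -outE -big_split; apply: eq_bigr => x _; rewrite -big_split.
have degS : \sum_(x in Y) degree x = (n_descents rho Y v1).*2 + (n_descents rho Y v2).*2 +
    (n_descents rho Y v3).*2 + (n_descents rho Y v4).*2.
  have mvE l : \sum_(x in Y) moves l x = (n_descents rho Y (v l)).*2.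
    have := descents_loops rels rho_move rho_wall (cl l).
    rewrite /n_loops -sum_card -sum1_card => H.
    have : \sum_(x in Y) (moves l x + (sigma (v l) x == x)) = \sum_(x in Y) 1.
      by apply: eq_bigr => x _; rewrite /moves; case: eqP.
    by rewrite big_split /= -H; apply: addIn.
  rewrite /degree exchange_big /= (sum_letters _ (false, false)) /mate /across /diagonal /=.
  by rewrite !mvE.
have csumE : \sum_(x in Y) \sum_l cyc_weight l x =
    6 * n_cyclic sigma v1 v2 Y + 6 * n_cyclic sigma v3 v4 Y +
    10 * n_cyclic sigma v1 v3 Y + 10 * n_cyclic sigma v1 v4 Y +
    10 * n_cyclic sigma v2 v3 Y + 10 * n_cyclic sigma v2 v4 Y.
  rewrite /n_cyclic -!sum_card !big_distrr -!big_split /=; apply: eq_bigr => x _.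
  rewrite (sum_letters _ (false, false)) /cyc_weight /mate /across /diagonal /=.
  rewrite [cyc_pair (false, true) (false, false) x]cyc_pairC
    [cyc_pair (true, false) (false, false) x]cyc_pairC.
  rewrite [cyc_pair (true, true) (false, true) x]cyc_pairC
    [cyc_pair (true, true) (false, false) x]cyc_pairC.
  rewrite [cyc_pair (true, false) (false, true) x]cyc_pairC
    [cyc_pair (true, true) (true, false) x]cyc_pairC.
  rewrite /cyc_pair -/v1 -/v2 -/v3 -/v4; clear.
  do 6!move: (nat_of_bool (cyclic2 _ _ _ _)) => ?; lia.
have fc p l l' : joined label (leq p.+1) (v l) (v l') ->
    2 * p.+1 * n_tops rho Y (v l) (v l') <= n_cyclic sigma (v l) (v l') Y.
  by move=> j; have [] := ends_cyclic m_odd rels rho_inj rho_move rho_wall (cl l) (cl l') (ltn0Sn p) j.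
have f12 := fc 4 _ _ (j1 (false, false)); have f34 := fc 4 _ _ (j1 (true, false)).
have f13 := fc 2 _ _ (j2 (false, false)); have f14 := fc 2 _ _ (j3 (false, false)).
have f23 := fc 2 _ _ (j3 (false, true)); have f24 := fc 2 _ _ (j2 (false, true)).
move: total; have deg30 : \sum_(x in Y) 30 * degree x = 30 * \sum_(x in Y) degree x by rewrite big_distrr.
rewrite [leqLHS]big_split [leqRHS]big_split valE csumE deg30 degS sum_nat_const.
rewrite /mate /across /diagonal /= -/v1 -/v2 -/v3 -/v4 in euler f12 f34 f13 f14 f23 f24 *.
by clear - euler f12 f34 f13 f14 f23 f24; lia.
Qed.

End Discharging.

(** * Components on which every chamber action is trivial *)

Section Components.
Variables (S : finType) (m : coxeter_matrix S).
Local Notation label := (cox_div m).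

Definition edge (s t : S) : bool := isSome (label s t).

Lemma edge_sym : symmetric edge.
Proof. by move=> s t; rewrite /edge /cox_div eq_sym cox_sym. Qed.

Lemma edge_equiv : {in [set: S] & &, equivalence_rel (connect edge)}.
Proof.
move=> s t u _ _ _; split; first exact: connect0.
by move=> st; apply: same_connect => //; apply: sym_connect_sym edge_sym.
Qed.

Lemma component_of s : exists2 C, C \in components label & s \in C.
Proof.
exists (finset.pblock (components label) s).
  rewrite finset.pblock_mem // (finset.cover_partition (finset.equivalence_partitionP edge_equiv)) inE //.
by rewrite finset.mem_pblock (finset.cover_partition (finset.equivalence_partitionP edge_equiv)) inE.
Qed.

Lemma componentP C s t : C \in components label -> s \in C ->
  (t \in C) = connect edge s t.
Proof.
move=> CC sC; have trivC := finset.partition_trivIset (finset.equivalence_partitionP edge_equiv).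
rewrite -(finset.def_pblock trivC CC sC) finset.pblock_equivalence_partition ?inE //.
exact: edge_equiv.
Qed.

End Components.

Section Rigidity.
Variables (S : finType) (m : coxeter_matrix S).
Hypothesis m_odd : odd_angled m.
Local Notation W := (coxeter_group m).
Local Notation gen := (cox_gen m).
Variables (X : finType) (sigma : S -> X -> X) (rho : X -> W).
Hypothesis rels : cox_rels m sigma.
Hypothesis rho_inj : injective rho.
Hypothesis rho_move : forall s x, sigma s x != x -> rho (sigma s x) = (rho x * gen s)%g.
Hypothesis rho_wall : forall s x, sigma s x = x ->
  crossing_free rho (rho x * gen s * (rho x)^-1)%g.
Let sK s : involutive (sigma s) := sigmaK rels s.
Local Notation label := (cox_div m).

(** If [s] moves [x], no point of the orbit of [x] is fixed by all of [D], as such a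
    point would be the whole orbit. *)
Lemma moving_orbit (D : seq S) s x : s \in D -> sigma s x != x ->
  exists Y : {set X}, [/\ Y != finset.set0,
    forall d y, d \in D -> y \in Y -> sigma d y \in Y &
    forall y, y \in Y -> (forall d, d \in D -> sigma d y = y) -> False].
Proof.
move=> sD sx; pose e y z := has (fun d => sigma d y == z) D.
have e_sym : connect_sym e.
  by apply: sym_connect_sym => y z; apply: eq_has => d; apply/eqP/eqP=> <-; rewrite sK.
exists [set y | connect e x y]; split.
- by apply/finset.set0Pn; exists x; rewrite inE connect0.
- move=> d y dD; rewrite !inE => xy; apply: connect_trans xy (connect1 _).
  by apply/hasP; exists d.
move=> y; rewrite inE e_sym => /connectP[p] + xE fixy.
move=> py; have xy : x = y.
  rewrite xE; elim: p py {xE} => //= z p IH /andP[/hasP[d dD /eqP]].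
  by rewrite (fixy d dD) => <- /IH.
by move: sx; rewrite xy fixy ?eqxx.
Qed.

(** One colour suffices: [rigid_component] spreads it over a component. *)
Definition rigid (C : {set S}) : Prop :=
  exists2 s, s \in C & forall x, sigma s x = x.

Lemma rigidI (D : seq S) s (C : {set S}) : s \in D -> s \in C ->
  (forall Y : {set X}, Y != finset.set0 ->
     (forall d y, d \in D -> y \in Y -> sigma d y \in Y) ->
     (forall y, y \in Y -> (forall d, d \in D -> sigma d y = y) -> False) -> False) ->
  rigid C.
Proof.
move=> sD sC noY; exists s => // x; apply/eqP/negPn/negP=> sx.
by have [Y [Y0 clY nlY]] := moving_orbit sD sx; apply: (noY Y).
Qed.

Lemma closed_mem (D : seq S) (Y : {set X}) d :
  (forall d y, d \in D -> y \in Y -> sigma d y \in Y) -> d \in D ->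
  forall y, y \in Y -> sigma d y \in Y.
Proof. by move=> cl dD y; apply: cl. Qed.

Lemma rigid_A C : contains_A label C -> rigid C.
Proof.
case=> v1 [v2 [v3 [Hu sub j12 j23 j13]]].
apply: (@rigidI [:: v1; v2; v3] v1) => [||Y Y0 clY nlY]; first by rewrite mem_head.
  by apply: sub; rewrite mem_head.
have cl := closed_mem clY.
have c1 := cl v1 _; have c2 := cl v2 _; have c3 := cl v3 _.
rewrite !inE !eqxx ?orbT in c1 c2 c3.
apply: (no_A m_odd rels rho_inj rho_move rho_wall Y0 (c1 isT) (c2 isT) (c3 isT) _ _ j12 j23 j13).
  move=> x xY s1 s2 s3; apply: (nlY x xY) => d; rewrite !inE.
  by case/or3P=> /eqP->.
by move: Hu; rewrite /= !inE negb_or => /andP[/andP[]].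
Qed.

Lemma rigid_B C : contains_B label C -> rigid C.
Proof.
case=> v1 [v2 [v3 [Hu sub j12 j23 j13]]].
apply: (@rigidI [:: v1; v2; v3] v1) => [||Y Y0 clY nlY]; first by rewrite mem_head.
  by apply: sub; rewrite mem_head.
have cl := closed_mem clY.
have c1 := cl v1 _; have c2 := cl v2 _; have c3 := cl v3 _.
rewrite !inE !eqxx ?orbT in c1 c2 c3.
apply: (no_B m_odd rels rho_inj rho_move rho_wall Y0 (c1 isT) (c2 isT) (c3 isT) _ j12 j23 j13).
move=> x xY s1 s2 s3; apply: (nlY x xY) => d; rewrite !inE.
by case/or3P=> /eqP->.
Qed.

Let quad v1 v2 v3 v4 (C : {set S}) :
  {subset [:: v1; v2; v3; v4] <= C} ->
  (forall Y : {set X}, Y != finset.set0 ->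
    (forall x, x \in Y -> sigma v1 x \in Y) -> (forall x, x \in Y -> sigma v2 x \in Y) ->
    (forall x, x \in Y -> sigma v3 x \in Y) -> (forall x, x \in Y -> sigma v4 x \in Y) ->
    (forall x, x \in Y -> sigma v1 x = x -> sigma v2 x = x -> sigma v3 x = x ->
       sigma v4 x = x -> False) -> False) ->
  rigid C.
Proof.
move=> sub noY; apply: (@rigidI [:: v1; v2; v3; v4] v1) => [||Y Y0 clY nlY].
- by rewrite mem_head.
- by apply: sub; rewrite mem_head.
have cl := closed_mem clY.
have c1 := cl v1 _; have c2 := cl v2 _; have c3 := cl v3 _; have c4 := cl v4 _.
rewrite !inE !eqxx ?orbT in c1 c2 c3 c4.
apply: (noY Y Y0 (c1 isT) (c2 isT) (c3 isT) (c4 isT)).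
move=> x xY s1 s2 s3 s4; apply: (nlY x xY) => d; rewrite !inE.
by case/or4P=> /eqP->.
Qed.

Lemma rigid_C C : contains_C label C -> rigid C.
Proof.
case=> v1 [v2 [v3 [v4 [Hu sub /and3P[j12 j34 j23] j13 /andP[j14 j24]]]]].
apply: (quad sub) => Y Y0 c1 c2 c3 c4 nl.
have [sparse|] := boolP [|| not_joined label v1 v3, not_joined label v1 v4 | not_joined label v2 v4].
  exact: (no_C_sparse m_odd rels rho_inj rho_move rho_wall Y0 c1 c2 c3 c4 nl Hu
            j12 j34 j23 j13 j14 j24 sparse).
rewrite !negb_or => /and3P[/negbTE n13 /negbTE n14 /negbTE n24].
rewrite n13 /= in j13; rewrite n14 /= in j14; rewrite n24 /= in j24.
pose v (l : bool * bool) := if l.1 then if l.2 then v4 else v3 else if l.2 then v2 else v1.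
apply: (@no_full_C _ _ m_odd _ _ _ rels rho_inj rho_move rho_wall Y Y0 v) => [[[] []]|x xY H|||] //=.
- by apply: (nl x xY); [apply: (H (false, false))|apply: (H (false, true))
     |apply: (H (true, false))|apply: (H (true, true))].
- by case=> -[] []; rewrite /v /=; [rewrite joinedC| |rewrite joinedC|].
- by case=> -[] []; rewrite /v /=; apply: joined3; rewrite // joinedC.
- by case=> -[] []; rewrite /v /=; apply: joined3; rewrite // joinedC.
Qed.

Lemma rigid_D C : contains_D label C -> rigid C.
Proof.
case=> v1 [v2 [v3 [v4 [Hu sub /and3P[j12 j23 j34] /andP[j13 j24] j14]]]].
apply: (quad sub) => Y Y0 c1 c2 c3 c4 nl.
exact: (no_D m_odd rels rho_inj rho_move rho_wall Y0 c1 c2 c3 c4 nl Hu j12 j23 j34 j13 j24 j14).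
Qed.

Lemma rigid_E C : contains_E label C -> rigid C.
Proof.
case=> v1 [v2 [v3 [v4 [Hu sub /and3P[j12 j13 j14] /and3P[j23 j24 j34]]]]].
apply: (quad sub) => Y Y0 c1 c2 c3 c4 nl.
exact: (no_E m_odd rels rho_inj rho_move rho_wall Y0 c1 c2 c3 c4 nl j12 j13 j14 j23 j24 j34).
Qed.

Lemma rigid_F C : contains_F label C -> rigid C.
Proof.
case=> n [w [n_ge5 [w_inj w_C] /andP[j12 jlast] j3 [j13 jb far]]].
have [k nE] : exists k, n = k.+4.+1 by exists (n - 5); lia.
rewrite {}nE {n n_ge5} in w_inj w_C jlast j3 jb far *.
(* The vertices of the diagram are numbered from [1]. *)
pose u i := w i.+1.
have uD i : i < k.+4.+1 -> u i \in [seq u i | i <- iota 0 k.+4.+1].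
  by move=> lt; apply/mapP; exists i; rewrite // mem_iota.
apply: (@rigidI [seq u i | i <- iota 0 k.+4.+1] (u 0)) => [||Y Y0 clY nlY].
- exact: uD.
- exact: w_C.
have sub2 : k.+4.+1 - 2 = k.+3 by rewrite !subSS subn0.
rewrite sub2 in j3 jb far.
apply: (@no_F _ _ m_odd _ _ _ rels rho_inj rho_move rho_wall Y Y0 k u) => //.
- by move=> i lt x xY; apply: clY => //; apply: uD.
- move=> x xY H; apply: (nlY x xY) => d /mapP[i]; rewrite mem_iota /= => lt ->.
  exact: H.
- by move=> i j lti ltj /w_inj; rewrite !inE /= => /(_ lti ltj) [].
- by move=> i /andP[i0 lt]; apply: j3; rewrite ltnS i0.
- move=> i j /andP[lt ltj] n1 n2 n3; apply: far => //.
Qed.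

(** If [s] acts trivially and [k] is odd then [(s t)^k = 1] makes [t] trivial. *)
Lemma rigid_component C : C \in components label -> rigid C ->
  forall s, s \in C -> forall x, sigma s x = x.
Proof.
move=> CC [s0 s0C fix0] s; rewrite (componentP s CC s0C) => /connectP[p].
elim: p s0 {s0C} fix0 => [|t p IH] s0 fix0 /= => [_ ->|/andP[s0t pt] sE] //.
apply: (IH t) => // x.
move: s0t; rewrite /edge /cox_div; case: eqP => // /eqP neq.
case mE: (m s0 t) => [k|] //= _; have k_odd := m_odd neq mE.
have := rels mE x; rewrite -(odd_double_half k) k_odd -muln2.
have it h : iter (h * 2) (fun y => sigma t (sigma s0 y)) x = x.
  by elim: h => // h IHh; rewrite mulSn iterD IHh /= !fix0 sK.
by rewrite iterS it fix0.
Qed.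

End Rigidity.

(** The action on the chamber moves some point, by some colour [s]; the component of
    [s] contradicts this. *)
Lemma no_reflection_subgroup (S : finType) (m : coxeter_matrix S) (m_odd : odd_angled m) :
  (forall C : {set S}, C \in components (cox_div m) ->
     contains_A (cox_div m) C \/ contains_B (cox_div m) C \/
     contains_C (cox_div m) C \/ contains_D (cox_div m) C \/
     contains_E (cox_div m) C \/ contains_F (cox_div m) C) ->
  ~ exists H : set (coxeter_group m), reflection_subgroup H /\ finite_index H.
Proof.
move=> diag [H [[Hproper [A A_refl HE]] fin]]; rewrite {}HE in Hproper fin.
have [X [sigma [rho [rels rho_inj rho_move rho_wall [s [x]]]]]] := chamber_action A_refl fin Hproper.
have [C CC sC] := component_of m s.
suff rC : rigid sigma C.
  by rewrite (rigid_component m_odd rels CC rC sC) eqxx.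
case: (diag C CC) => [|[|[|[|[|]]]]].
- exact: (rigid_A m_odd rels rho_inj rho_move rho_wall).
- exact: (rigid_B m_odd rels rho_inj rho_move rho_wall).
- exact: (rigid_C m_odd rels rho_inj rho_move rho_wall).
- exact: (rigid_D m_odd rels rho_inj rho_move rho_wall).
- exact: (rigid_E m_odd rels rho_inj rho_move rho_wall).
- exact: (rigid_F m_odd rels rho_inj rho_move rho_wall).
Qed.

(** * Point stabilizers as reflection subgroups *)

Section Stabilizer.
Local Open Scope group_scope.
Variables (S : finType) (m : coxeter_matrix S).
Local Notation W := (coxeter_group m).
Local Notation gen := (cox_gen m).
Local Open Scope classical_set_scope.
Variables (X : finType) (sigma : S -> X -> X) (rho : X -> W).
Hypothesis rels : cox_rels m sigma.
Hypothesis rho_move : forall s x, sigma s x != x -> rho (sigma s x) = rho x * gen s.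
Variables (s0 : S) (x0 : X).
Hypothesis x0_moves : sigma s0 x0 != x0.

Let act := cox_act (m := m) sigma.
Let act1 := cox_act1 rels.
Let actM := cox_actM rels.

Definition point_stabilizer : set W := [set g | act g x0 = x0].
Local Notation H := point_stabilizer.

Lemma actV g x y : act g x = y -> act g^-1 y = x.
Proof. by move=> <-; rewrite /act -actM mulgV act1. Qed.

Lemma stabilizer_subgroup : is_subgroup H.
Proof.
split=> [|g h Hg Hh|g Hg]; first exact: act1.
  by rewrite /point_stabilizer /= /act actM -/act Hg.
exact: actV.
Qed.

(** Follow a word for an element of the stabilizer from [x0], and let [u] be the
    element [(rho x0)^-1 rho y] at the current point [y].  Moving steps change
    [u] as they change the word; a step [s] which fixes [y] contributes the
    reflection [u s u^-1], which is in the stabilizer.  Back at [x0], [u] is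
    [1]. *)
Lemma stabilizer_reflections :
  H = generated_subgroup ((@is_reflection S m) `&` H).
Proof.
set G := generated_subgroup _; have [G1 GM GV] : is_subgroup G by apply: generated_is_subgroup.
have GH : G `<=` H by apply: generated_sub stabilizer_subgroup _ => r [].
apply/seteqP; split=> // g; have [l ->] := gprodP g => Hl.
have [h Gh lE] : exists2 h, G h & gprod m l = h * (rho x0)^-1 * rho (act (gprod m l) x0).
  elim/last_ind: l {Hl} => [|l s [h Gh lE]].
    by exists 1; rewrite // gprod_nil /act act1 mul1g mulVg.
  rewrite gprod_rcons /act actM (cox_act_gen rels) -/act; set y := act _ x0 in lE *.
  have [ys|ys] := eqVneq (sigma s y) y; last first.
    by exists h; rewrite // rho_move // mulgA -lE.
  have Hr u : act u x0 = y -> H (u * gen s * u^-1).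
    move=> uE; rewrite /point_stabilizer /= /act !actM (cox_act_gen rels) -/act uE ys.
    exact: actV.
  rewrite ys; have [u uE] : exists u, u = (rho x0)^-1 * rho y by exists ((rho x0)^-1 * rho y).
  have lE' : gprod m l = h * u by rewrite lE uE mulgA.
  have uy : act u x0 = y.
    have -> : u = h^-1 * gprod m l by rewrite lE' mulKg.
    have Hh : act h^-1 x0 = x0 by apply/actV/GH.
    by rewrite /act actM -/act Hh.
  exists (h * (u * gen s * u^-1)).
    apply: GM => //; apply: sub_generated; split; last exact: Hr.
    by apply/is_reflectionP; exists s, u.
  by rewrite lE' -[RHS]mulgA -uE -[RHS]mulgA mulgVK mulgA.
rewrite lE; have -> : act (gprod m l) x0 = x0 by [].
by rewrite mulgVK.
Qed.

(** The coset of [g] is determined by the point [g^-1 x0]. *)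
Lemma stabilizer_finite_index : finite_index H.
Proof.
pose f y : set W := [set w | act w^-1 x0 = y].
apply: (@sub_finite_set _ _ (f @` [set: X])); last exact/finite_image/finite_finset.
move=> _ [g _ <-].
exists (act g^-1 x0) => //; apply/seteqP; split=> w /=.
  move=> wE; exists (g^-1 * w); last by rewrite mulVKg.
  by rewrite /point_stabilizer /= /act actM -/act -wE; have := @actV w^-1 x0 _ erefl; rewrite invgK.
case=> h Hh <-; rewrite /f /= invgM /act actM -/act.
by congr act; apply: actV.
Qed.

Lemma stabilizer_proper : H != setT.
Proof.
apply/eqP=> HT; have : H (gen s0) by rewrite HT.
rewrite /point_stabilizer /= /act (cox_act_gen rels) => /eqP.
by rewrite (negbTE x0_moves).
Qed.

(** The subgroup is the stabilizer of a point which moves. *)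
Lemma reflection_subgroup_of_action :
  exists H : set W, reflection_subgroup H /\ finite_index H.
Proof.
exists H; split; last exact: stabilizer_finite_index.
split; first exact: stabilizer_proper.
by exists (@is_reflection S m `&` H); [move=> r []|apply: stabilizer_reflections].
Qed.

End Stabilizer.

(** * Star, path and wheel actions *)

Lemma iter_ordS q (j : 'I_q.+1) : iter q.+1 (@ordS q.+1) j = j.
Proof.
apply: val_inj; rewrite /=.
have it i : iter i (@ordS q.+1) j = (j + i) %% q.+1 :> nat.
  elim: i => [|i IH]; first by rewrite addn0 modn_small.
  by rewrite iterS /= IH -addn1 modnDml addn1 addnS.
by rewrite -[LHS]/(nat_of_ord (iter q.+1 (@ordS q.+1) j)) it modnDr modn_small.
Qed.

Lemma iter_ord_pred q (j : 'I_q.+1) : iter q.+1 (@ord_pred q.+1) j = j.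
Proof.
rewrite -[RHS](iter_ordS j); apply/esym; rewrite -{1}[j]iter_ordS.
have it i x : iter i (@ordS q.+1) (iter i (@ord_pred q.+1) x) = x.
  by elim: i x => // i IH x; rewrite iterSr [iter i.+1 (@ord_pred _) x]iterS ord_predK IH.
by rewrite -{1}(it q.+1 j) !iter_ordS.
Qed.

Section Constructions.
Variables (S : finType) (m : coxeter_matrix S).
Hypothesis m_odd : odd_angled m.
Local Notation W := (coxeter_group m).
Local Notation gen := (cox_gen m).
Local Notation label := (cox_div m).
Variable C : {set S}.
Hypothesis CC : C \in components label.

(** A relation joins its two generators, so it may be checked inside the component
    [C], while the generators outside [C] act trivially. *)
Lemma edge_component s t k : s != t -> m s t = Some k -> (s \in C) = (t \in C).
Proof.
move=> neq mst; have st : connect (edge m) s t.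
  by apply: connect1; rewrite /edge /cox_div (negbTE neq) mst.
apply/idP/idP => [sC|tC]; first by rewrite (componentP t CC sC).
by rewrite (componentP s CC tC) (sym_connect_sym (edge_sym m)).
Qed.

Section Rels.
Variables (X : finType) (sigma : S -> X -> X).
Hypothesis sigma_invol : forall s, involutive (sigma s).
Hypothesis sigma_out : forall s x, s \notin C -> sigma s x = x.

Definition braid (n : nat) (s t : S) : Prop :=
  forall x, iter n (fun y => sigma t (sigma s y)) x = x.

Lemma braid_dvd d n s t : d %| n -> braid d s t -> braid n s t.
Proof.
case/dvdnP=> q -> bd x; elim: q => // q IH.
by rewrite mulSn iterD IH bd.
Qed.

Lemma braid_sym n s t : braid n s t -> braid n t s.
Proof.
move=> bn x; pose f y := sigma t (sigma s y); pose g y := sigma s (sigma t y).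
have fg i y : iter i g (iter i f y) = y.
  elim: i y => // i IH y; rewrite iterSr [iter i.+1 f y]iterS.
  by rewrite {2}/g /f !sigma_invol IH.
by rewrite -[RHS](fg n) (bn x).
Qed.

Lemma braid_rels : (forall s t k, s \in C -> t \in C -> s != t -> m s t = Some k ->
    braid k s t \/ braid k t s) -> cox_rels m sigma.
Proof.
move=> H i j k mij x; have [eq_ij|neq] := eqVneq i j.
  by move: mij; rewrite eq_ij cox_diag => -[<-]; apply: sigma_invol.
have [iC|iC] := boolP (i \in C).
  have jC : j \in C by rewrite -(edge_component neq mij).
  by case: (H i j k iC jC neq mij) => // /braid_sym; apply.
have jC : j \notin C by rewrite -(edge_component neq mij).
by elim: k {mij} => //= k ->; rewrite !sigma_out.
Qed.

End Rels.

Section Star.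
Hypothesis all3 : forall s t k, s \in C -> t \in C -> s != t -> m s t = Some k -> 3 %| k.

(** The centre [None] has one edge of each colour in [C], with a leaf at its end.
    The orbits of two colours are paths with three vertices. *)
Definition star_act (s : S) (x : option S) : option S :=
  if s \in C then
    if x is Some t then if t == s then None else x else Some s
  else x.

Definition star_rho (x : option S) : W := if x is Some s then gen s else 1%g.

Lemma star_subgroup : (exists s, s \in C) ->
  exists H : set W, reflection_subgroup H /\ finite_index H.
Proof.
case=> s0 s0C; have invol s : involutive (star_act s).
  rewrite /star_act => x; case: (s \in C) => //.
  case: x => [t|] /=; last by rewrite eqxx.
  by have [->|/negbTE /= ->] := eqVneq t s.
apply: (@reflection_subgroup_of_action _ m _ star_act star_rho _ _ s0 None); last first.
- by rewrite /star_act s0C.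
- move=> s [t|]; rewrite /star_act; case: ifP => sC; rewrite ?eqxx //=.
    by have [-> _|] := eqVneq t s; rewrite ?eqxx //= gen_sqr.
  by rewrite mul1g.
apply: braid_rels => // [s x|s t k sC tC neq mst]; first by rewrite /star_act => /negbTE->.
left; apply: braid_dvd (all3 sC tC neq mst) _ => x.
have sN r : r \in C -> star_act r None = Some r by rewrite /star_act => ->.
have sS r : r \in C -> star_act r (Some r) = None by rewrite /star_act eqxx => ->.
have sO r u : u != r -> star_act r (Some u) = Some u.
  by rewrite /star_act => /negbTE->; case: ifP.
have neq' : t != s by rewrite eq_sym.
case: x => [u|] /=; last by rewrite sN // (sO t s) // sS // sN // (sO s t) // sS.
have [->|us] := eqVneq u s; first by rewrite sS // sN // (sO s t) // sS // sN // sO.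
have [->|ut] := eqVneq u t; first by rewrite (sO s t) // sS // sN // (sO t s) // sS // sN.
by rewrite !sO.
Qed.

End Star.

Section Path.
Variables (a b : S) (k0 q : nat).
Hypotheses (aC : a \in C) (bC : b \in C) (neq_ab : a != b).
Local Notation p := q.+1.
Hypotheses (p_odd : odd p) (mab : m a b = Some k0) (p_dvd : p %| k0) (q_gt0 : 0 < q).
Hypothesis others3 : forall s t k, s \in C -> t \in C -> s != t ->
  ~~ [|| (s == a) && (t == b) | (s == b) && (t == a)] -> m s t = Some k -> 3 %| k.

Definition path_a (n : nat) : nat :=
  if odd n then n.-1 else if n.+1 < p then n.+1 else n.
Definition path_b (n : nat) : nat := if odd n then n.+1 else n.-1.

(** A path with [p] vertices coloured [a], [b], [a], ... in turn, and a leaf of each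
    further colour at the vertices of odd index.  The two ends have even index,
    and no two neighbours have leaves; so a further colour makes paths with three
    vertices with any other colour. *)
Definition path_act (s : S) (x : 'I_p * option S) : 'I_p * option S :=
  if s == a then if x.2 is None then (inord (path_a x.1), None) else x
  else if s == b then if x.2 is None then (inord (path_b x.1), None) else x
  else if (s \in C) && odd x.1 then
    match x.2 with
    | Some t => if t == s then (x.1, None) else x
    | None => (x.1, Some s)
    end
  else x.

Fixpoint path_word (n : nat) : W :=
  if n is n'.+1 then (path_word n' * (if odd n' then gen b else gen a))%g else 1%g.

Definition path_rho (x : 'I_p * option S) : W :=
  (path_word x.1 * (if x.2 is Some d then gen d else 1))%g.

Lemma path_a_lt n : n < p -> path_a n < p.
Proof. by rewrite /path_a; case: ifP => _; [lia|case: ifP]. Qed.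

Lemma path_b_lt n : n < p -> path_b n < p.
Proof.
rewrite /path_b; case: ifP => n_odd; last by lia.
rewrite !ltnS leq_eqVlt => /orP[/eqP nq|//].
by move: p_odd; rewrite /= -nq n_odd.
Qed.

Lemma path_aK n : n < p -> path_a (path_a n) = n.
Proof.
move=> lt; rewrite {2}/path_a; case n_odd: (odd n).
  have n0 : 0 < n by case: (n) n_odd.
  by rewrite /path_a -[n]prednK //= in n_odd *; rewrite (negbTE n_odd) prednK // lt.
by case lt' : (n.+1 < p); rewrite /path_a /= n_odd ?lt'.
Qed.

Lemma path_bK n : n < p -> path_b (path_b n) = n.
Proof.
move=> lt; rewrite {2}/path_b; case n_odd: (odd n); first by rewrite /path_b /= n_odd.
by case: n n_odd {lt} => // n; rewrite /path_b /= => /negbFE ->.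
Qed.

(** The rotation runs up the even vertices and down the odd ones. *)
Lemma path_rotation i : i < p ->
  iter i (fun n => path_b (path_a n)) 0 = if i.*2 < p then i.*2 else (p + p - i.*2).-1.
Proof.
elim: i => // i IH lt_ip; rewrite iterS IH; last exact: ltnW.
have p_half := odd_double_half p; rewrite p_odd in p_half.
have [lt2|ge2] := ltnP i.*2 p.
  rewrite {1}/path_a odd_double; have [lt3|ge3] := ltnP i.*2.+1 p.
    rewrite /path_b /= odd_double /=.
    by have -> : i.+1.*2 < p by lia.
  have ip : i.*2 = q by lia.
  rewrite /path_b odd_double; have -> : (i.+1.*2 < p) = false by lia.
  by lia.
have odd1 : odd (p + p - i.*2).-1 by lia.
rewrite {1}/path_a odd1 /path_b.
have -> : odd (p + p - i.*2).-1.-1 = false by lia.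
have -> : (i.+1.*2 < p) = false by lia.
by lia.
Qed.

Lemma path_rotate n : n < p -> iter p (fun n => path_b (path_a n)) n = n.
Proof.
move=> lt; have p_half := odd_double_half p; rewrite p_odd in p_half.
have it0 : iter p (fun n => path_b (path_a n)) 0 = 0.
  rewrite iterS path_rotation //; have -> : (q.*2 < p) = false by lia.
  by rewrite (_ : (p + p - q.*2).-1 = 1); last lia.
have [i lti nE] : exists2 i, i < p & n = iter i (fun n => path_b (path_a n)) 0.
  case n_odd: (odd n).
    exists ((p + p).-1 - n)./2; first by lia.
    rewrite path_rotation; last by lia.
    have n_half := odd_double_half n; rewrite n_odd in n_half.
    have -> : ((p + p).-1 - n)./2.*2 = (p + p).-1 - n by lia.
    have -> : ((p + p).-1 - n < p) = false by lia.
    by lia.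
  exists n./2; first by lia.
  rewrite path_rotation; last by lia.
  have n_half := odd_double_half n; rewrite n_odd in n_half.
  by rewrite (_ : n./2.*2 = n) ?lt //; lia.
by rewrite nE -iterD addnC iterD it0.
Qed.

Lemma path_a_odd n : n < p -> if odd n then ~~ odd (path_a n) else (path_a n == n) || odd (path_a n).
Proof.
rewrite /path_a; case n_odd: (odd n) => lt.
  by case: n n_odd {lt} => //= n ->.
by case: ifP; rewrite /= ?n_odd ?eqxx ?orbT.
Qed.

Lemma path_b_odd n : n < p -> if odd n then ~~ odd (path_b n) else (path_b n == n) || odd (path_b n).
Proof.
rewrite /path_b; case n_odd: (odd n) => lt; first by rewrite /= n_odd.
by case: n n_odd {lt} => //= n /negbFE ->; rewrite orbT.
Qed.

(** A colour [s] along the path against the colour [d] of a leaf.  By the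
    hypothesis on parities, each of their orbits is a fixed point or consists of a
    leaf, an odd vertex and an even vertex. *)
Lemma spine_leaf (f : nat -> nat) s d : d \in C -> d != a -> d != b ->
  (forall n, n < p -> f n < p) -> (forall n, n < p -> f (f n) = n) ->
  (forall n, n < p -> if odd n then ~~ odd (f n) else (f n == n) || odd (f n)) ->
  (forall x, path_act s x = if x.2 is None then (inord (f x.1), None) else x) ->
  braid path_act 3 s d.
Proof.
move=> dC da db f_lt fK f_odd sE [i o].
have dE (j : 'I_p) o' : path_act d (j, o') = if odd j then
    match o' with Some t => if t == d then (j, None) else (j, o') | None => (j, Some d) end
    else (j, o').
  by rewrite /path_act (negbTE da) (negbTE db) dC /=; case: (odd j).
have lt := ltn_ord i; have ff := fK i lt; have odd_f := f_odd i lt.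
have vf : (inord (f i) : 'I_p) = f i :> nat by rewrite inordK ?f_lt.
have vff : inord (f (inord (f i) : 'I_p)) = i by rewrite vf ff inord_val.
have sN (j : 'I_p) : path_act s (j, None) = (inord (f j), None) by rewrite sE.
have sfix' j t : path_act s (j, Some t) = (j, Some t) by rewrite sE.
rewrite /=; case: o => [t|].
  have [->|td] := eqVneq t d; last first.
    have sfix : path_act s (i, Some t) = (i, Some t) by rewrite sE.
    have dfix : path_act d (i, Some t) = (i, Some t) by rewrite dE (negbTE td) if_same.
    by rewrite !(sfix, dfix).
  have sfix : path_act s (i, Some d) = (i, Some d) by rewrite sE.
  case i_odd: (odd i) odd_f => odd_f; last first.
    have dfix : path_act d (i, Some d) = (i, Some d) by rewrite dE i_odd.
    by rewrite !(sfix, dfix).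
  by rewrite sfix dE i_odd eqxx sN dE vf (negbTE odd_f) sN vff dE i_odd.
rewrite sN dE vf; case i_odd: (odd i) odd_f => /= odd_f; last case/orP: odd_f => [/eqP fi|odd_f].
- by rewrite (negbTE odd_f) sN vff dE i_odd sfix' dE i_odd eqxx.
- have fi' : inord (f i) = i by rewrite fi inord_val.
  by rewrite fi' fi i_odd sN fi' dE i_odd sN fi' dE i_odd.
- by rewrite odd_f sfix' dE vf odd_f eqxx sN vff dE i_odd.
Qed.

Lemma path_subgroup : exists H : set W, reflection_subgroup H /\ finite_index H.
Proof.
have aE x : path_act a x = if x.2 is None then (inord (path_a x.1), None) else x.
  by rewrite /path_act eqxx.
have bE x : path_act b x = if x.2 is None then (inord (path_b x.1), None) else x.
  by rewrite /path_act eq_sym (negbTE neq_ab) eqxx.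
have dE d (j : 'I_p) o' : d != a -> d != b -> path_act d (j, o') =
    if (d \in C) && odd j then
    match o' with Some t => if t == d then (j, None) else (j, o') | None => (j, Some d) end
    else (j, o').
  by move=> da db; rewrite /path_act (negbTE da) (negbTE db).
have invol s : involutive (path_act s).
  move=> [i o]; have lt := ltn_ord i.
  have [->|sa] := eqVneq s a.
    by rewrite !aE; case: o => //=; rewrite inordK ?path_a_lt // path_aK ?inord_val.
  have [->|sb] := eqVneq s b.
    by rewrite !bE; case: o => //=; rewrite inordK ?path_b_lt // path_bK ?inord_val.
  rewrite !dE //; case si: (_ && _); last by rewrite dE // si.
  case: o => [t|]; last by rewrite dE // si eqxx.
  by have [->|ts] := eqVneq t s; rewrite dE // si // (negbTE ts).
have ab_braid : braid path_act p a b.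
  case=> i [t|].
    by rewrite iter_fix // aE bE.
  have itE n : iter n (fun y => path_act b (path_act a y)) (i, None) =
      (inord (iter n (fun n => path_b (path_a n)) i), None) /\
      iter n (fun n => path_b (path_a n)) i < p.
    elim: n => [|n [IH lt]]; first by rewrite /= inord_val ltn_ord.
    rewrite !iterS IH aE bE /= inordK // inordK ?path_a_lt //.
    by split=> //; apply/path_b_lt/path_a_lt.
  by rewrite (itE p).1 path_rotate ?ltn_ord // inord_val.
have leaves s d : s \in C -> d \in C -> s != d -> d != a -> d != b -> braid path_act 3 s d.
  move=> sC dC sd da db.
  have [->|sa] := eqVneq s a.
    by apply: spine_leaf aE => //; [apply: path_a_lt|apply: path_aK|apply: path_a_odd].
  have [->|sb] := eqVneq s b.
    by apply: spine_leaf bE => //; [apply: path_b_lt|apply: path_bK|apply: path_b_odd].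
  case=> i o /=; case i_odd: (odd i); last first.
    have still r : r != a -> r != b -> path_act r (i, o) = (i, o).
      by move=> ra rb; rewrite dE // i_odd andbF.
    by rewrite !still.
  have sN r : r != a -> r != b -> r \in C -> path_act r (i, None) = (i, Some r).
    by move=> ra rb rC; rewrite dE // rC i_odd.
  have sS r : r != a -> r != b -> r \in C -> path_act r (i, Some r) = (i, None).
    by move=> ra rb rC; rewrite dE // rC i_odd eqxx.
  have sO r u : r != a -> r != b -> u != r -> path_act r (i, Some u) = (i, Some u).
    by move=> ra rb /negbTE ur; rewrite dE // ur; case: ifP.
  have ds : d != s by rewrite eq_sym.
  case: o => [u|]; last by rewrite sN // (sO d s) // sS // sN // (sO s d) // sS.
  have [->|us] := eqVneq u s; first by rewrite sS // sN // (sO s d) // sS // sN // sO.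
  have [->|ud] := eqVneq u d; first by rewrite (sO s d) // sS // sN // (sO d s) // sS // sN.
  by rewrite !sO.
apply: (@reflection_subgroup_of_action _ m _ path_act path_rho _ _ a (ord0, None)); last first.
- rewrite aE /path_a /= ltnS q_gt0; apply/eqP=> -[/(congr1 val)].
  by rewrite /= inordK.
- move=> s [i o] move_s; have lt := ltn_ord i; move: move_s.
  have wE n : path_word n.+1 = (path_word n * (if odd n then gen b else gen a))%g by [].
  have [->|sa] := eqVneq s a.
    rewrite aE; case: o => [t|]; first by rewrite eqxx.
    rewrite /path_rho /= !mulg1 inordK ?path_a_lt // /path_a.
    case i_odd: (odd i).
      case: (nat_of_ord i) i_odd => //= n /negbTE n_odd _.
      by rewrite n_odd mulgenK.
    by case: ifP => [_ _|_]; rewrite ?wE ?i_odd // inord_val eqxx.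
  have [->|sb] := eqVneq s b.
    rewrite bE; case: o => [t|]; first by rewrite eqxx.
    rewrite /path_rho /= !mulg1 inordK ?path_b_lt // /path_b.
    case i_odd: (odd i); first by rewrite wE i_odd.
    case E : (nat_of_ord i) i_odd => [|n] /= i_odd; first by rewrite -[X in inord X]E inord_val eqxx.
    by rewrite (negbFE i_odd) mulgenK.
  rewrite dE //; case: ifP => _; last by rewrite eqxx.
  case: o => [t|] /=; last by rewrite /path_rho /= mulg1.
  by have [->|_] := eqVneq t s; rewrite ?eqxx // /path_rho /= mulg1 mulgenK.
apply: braid_rels => // [s x sC|s t k sC tC neq mst].
  have sa : s != a by apply: contraNneq sC => ->.
  have sb : s != b by apply: contraNneq sC => ->.
  by case: x => i o; rewrite dE // (negbTE sC).
have [Hab|] := boolP [|| (s == a) && (t == b) | (s == b) && (t == a)].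
  case/orP: Hab mst => /andP[/eqP-> /eqP->]; [left|right].
    by apply: braid_dvd ab_braid; move: mst; rewrite mab => -[<-].
  by apply: braid_dvd ab_braid; move: mst; rewrite cox_sym mab => -[<-].
move=> /[dup] nab; rewrite negb_or !negb_and => /andP[n1 n2].
have d3 := others3 sC tC neq nab mst.
have [ta|ta] := boolP ((t == a) || (t == b)); last first.
  by left; apply: braid_dvd d3 _; move: ta; rewrite negb_or => /andP[? ?]; apply: leaves.
have [sa sb] : s != a /\ s != b.
  by split; apply/eqP=> sE; case/orP: ta => /eqP tE; move: n1 n2 neq; rewrite sE tE !eqxx.
by right; apply: braid_dvd d3 _; apply: leaves; rewrite // eq_sym.
Qed.

End Path.

Section Wheel.
Variables (a b c : S) (kab kbc q : nat).
Hypotheses (aC : a \in C) (bC : b \in C) (cC : c \in C).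
Hypotheses (neq_ab : a != b) (neq_bc : b != c) (neq_ac : a != c).
Local Notation n := q.+1.
Hypotheses (mab : m a b = Some kab) (mbc : m b c = Some kbc) (mac : m a c = Some n).
Hypotheses (ab5 : 5 %| kab) (bc5 : 5 %| kbc) (ac3 : 3 %| n).
Hypothesis others3 : forall s t k, s \in C -> t \in C -> s != t ->
  ~~ (s \in [:: a; b; c]) || ~~ (t \in [:: a; b; c]) -> m s t = Some k -> 3 %| k.

(** The wheel is a cycle of length [2 n] coloured [a] and [c], with [n] the
    entry of [a c]; its vertices are [Even] and [Odd].  A vertex [Even] has an edge of
    colour [b] to [Up], which has leaves of colours [a] and [c]; a vertex [Odd]
    has a leaf of colour [b].  Both [Odd] and [Up] have a leaf of each further
    colour.  The orbits are: for [a] and [b] the path LeafA, Up, Even, Odd,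
    LeafB with five vertices; for [b] and [c] the path LeafC, Up, Even, Odd,
    LeafB likewise; for [a] and [c] the cycle and the paths LeafA, Up, LeafC; for
    a further colour paths with three vertices. *)
Inductive spoke := Even | Odd | Up | LeafA | LeafB | LeafC.

Definition spoke_code (x : spoke) : bool * bool * bool :=
  match x with
  | Even => (false, false, false) | Odd => (false, false, true)
  | Up => (false, true, false) | LeafA => (false, true, true)
  | LeafB => (true, false, false) | LeafC => (true, false, true)
  end.

Definition spoke_decode (x : bool * bool * bool) : option spoke :=
  match x with
  | (false, false, false) => Some Even | (false, false, true) => Some Odd
  | (false, true, false) => Some Up | (false, true, true) => Some LeafA
  | (true, false, false) => Some LeafB | (true, false, true) => Some LeafC
  | _ => None
  end.

Lemma spoke_codeK : pcancel spoke_code spoke_decode.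
Proof. by case. Qed.

HB.instance Definition _ := Finite.copy spoke (pcan_type spoke_codeK).

(** The boolean in the second summand tells whether the leaf is at [Up] or at
    [Odd]. *)
Definition wheel : Type := ('I_n * (spoke + bool * S))%type.

Definition wheel_a (x : wheel) : wheel :=
  match x with
  | (j, inl Even) => (j, inl Odd) | (j, inl Odd) => (j, inl Even)
  | (j, inl Up) => (j, inl LeafA) | (j, inl LeafA) => (j, inl Up)
  | _ => x
  end.

Definition wheel_b (x : wheel) : wheel :=
  match x with
  | (j, inl Even) => (j, inl Up) | (j, inl Up) => (j, inl Even)
  | (j, inl Odd) => (j, inl LeafB) | (j, inl LeafB) => (j, inl Odd)
  | _ => x
  end.

Definition wheel_c (x : wheel) : wheel :=
  match x with
  | (j, inl Odd) => (ordS j, inl Even) | (j, inl Even) => (ord_pred j, inl Odd)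
  | (j, inl Up) => (j, inl LeafC) | (j, inl LeafC) => (j, inl Up)
  | _ => x
  end.

Definition wheel_leaf (d : S) (x : wheel) : wheel :=
  match x with
  | (j, inl Odd) => (j, inr (false, d)) | (j, inl Up) => (j, inr (true, d))
  | (j, inr (u, e)) => if e == d then (j, inl (if u then Up else Odd)) else x
  | _ => x
  end.

Definition wheel_act (s : S) (x : wheel) : wheel :=
  if s == a then wheel_a x else if s == b then wheel_b x
  else if s == c then wheel_c x else if s \in C then wheel_leaf s x else x.

Definition wheel_rho (x : wheel) : W :=
  ((gen a * gen c) ^+ x.1 *
  match x.2 with
  | inl Even => 1 | inl Odd => gen a | inl Up => gen b
  | inl LeafA => gen b * gen a | inl LeafC => gen b * gen c
  | inl LeafB => gen a * gen b
  | inr (u, d) => (if u then gen b else gen a) * gen d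
  end)%g.

Lemma wheel_subgroup : exists H : set W, reflection_subgroup H /\ finite_index H.
Proof.
have aE : wheel_act a =1 wheel_a by move=> x; rewrite /wheel_act eqxx.
have bE : wheel_act b =1 wheel_b by move=> x; rewrite /wheel_act eq_sym (negbTE neq_ab) eqxx.
have cE : wheel_act c =1 wheel_c.
  by move=> x; rewrite /wheel_act eq_sym (negbTE neq_ac) eq_sym (negbTE neq_bc) eqxx.
have dE d : d \in C -> d \notin [:: a; b; c] -> wheel_act d =1 wheel_leaf d.
  move=> dC; rewrite !inE !negb_or => /and3P[da db dc] x.
  by rewrite /wheel_act (negbTE da) (negbTE db) (negbTE dc) dC.
have cases s : [\/ s = a, s = b, s = c | s \notin [:: a; b; c]].
  rewrite !inE; case: eqP => [->|_]; first by constructor 1.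
  case: eqP => [->|_]; first by constructor 2.
  by case: eqP => [->|_]; [constructor 3|constructor 4].
have invol s : involutive (wheel_act s).
  case: (cases s) => [->|->|->|sabc] x; rewrite ?(aE, bE, cE).
  - by case: x => j [[]|[u e]].
  - by case: x => j [[]|[u e]].
  - by case: x => j [[]|[u e]]; rewrite /= ?ordSK ?ord_predK.
  have [sC|sC] := boolP (s \in C); last first.
    move: sabc; rewrite !inE !negb_or => /and3P[sa sb sc].
    by rewrite /wheel_act (negbTE sa) (negbTE sb) (negbTE sc) (negbTE sC).
  rewrite !dE //; case: x => j [[]|[u e]] /=; rewrite ?eqxx //.
  by have [->|es] := eqVneq e s; [case: u|rewrite /= (negbTE es)].
have br (f g : wheel -> wheel) s t k : wheel_act s =1 f -> wheel_act t =1 g ->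
    (forall x, iter k (fun y => g (f y)) x = x) -> braid wheel_act k s t.
  move=> sf tg fg x; rewrite -[RHS]fg; apply: eq_iter => y.
  by rewrite sf tg.
have br_ab : braid wheel_act 5 a b by apply: br aE bE _ => -[j [[]|[u e]]].
have br_bc : braid wheel_act 5 b c.
  by apply: br bE cE _ => -[j [[]|[u e]]]; rewrite /= ?ordSK ?ord_predK.
have br_ac : braid wheel_act n a c.
  apply: br aE cE _ => -[j x]; pose f y := wheel_c (wheel_a y).
  have fix3 y : iter 3 f y = y -> iter n f y = y.
    by move=> y3; case/dvdnP: ac3 => h ->; elim: h => // h IH; rewrite mulSn iterD IH.
  case: x => [[]|[u e]]; try exact: fix3.
    have it i : iter i f (j, inl Even) = (iter i (@ordS n) j, inl Even).
      by elim: i => // i IH; rewrite iterS IH.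
    by rewrite it iter_ordS.
  have it i : iter i f (j, inl Odd) = (iter i (@ord_pred n) j, inl Odd).
    by elim: i => // i IH; rewrite iterS IH.
  by rewrite it iter_ord_pred.
have br_leaf s d : s \in C -> d \in C -> s != d -> d \notin [:: a; b; c] ->
    braid wheel_act 3 s d.
  move=> sC dC sd dabc; have dE' := dE d dC dabc.
  case: (cases s) => [sE|sE|sE|sabc]; rewrite ?sE.
  - apply: br aE dE' _ => -[j [[]|[u e]]]; rewrite /= ?eqxx /= ?eqxx //.
    by have [->|ed] := eqVneq e d; [case: u; rewrite /= ?eqxx /= ?eqxx|do 3!rewrite /= ?(negbTE ed)].
  - apply: br bE dE' _ => -[j [[]|[u e]]]; rewrite /= ?eqxx /= ?eqxx //.
    by have [->|ed] := eqVneq e d; [case: u; rewrite /= ?eqxx /= ?eqxx|do 3!rewrite /= ?(negbTE ed)].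
  - apply: br cE dE' _ => -[j [[]|[u e]]]; rewrite /= ?eqxx /= ?ordSK ?ord_predK //.
    have [->|ed] := eqVneq e d; last by do 3!rewrite /= ?(negbTE ed).
    by case: u; rewrite /= ?eqxx /= ?ordSK ?ord_predK.
  have ds : d != s by rewrite eq_sym.
  apply: br (dE s sC sabc) dE' _ => -[j [[]|[u e]]] //.
  - by do 4!rewrite /= ?eqxx ?(negbTE sd) ?(negbTE ds).
  - by do 4!rewrite /= ?eqxx ?(negbTE sd) ?(negbTE ds).
  have [->|es] := eqVneq e s; first by case: u; do 4!rewrite /= ?eqxx ?(negbTE sd) ?(negbTE ds).
  have [->|ed] := eqVneq e d; first by case: u; do 4!rewrite /= ?eqxx ?(negbTE sd) ?(negbTE ds).
  by do 6!rewrite /= ?(negbTE es) ?(negbTE ed).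
apply: (@reflection_subgroup_of_action _ m _ wheel_act wheel_rho _ _ a (ord0, inl Even)); last first.
- by rewrite aE.
- have zn : ((gen a * gen c) ^+ n = 1)%g by apply: gen_rel.
  have zS (j : 'I_n) : ((gen a * gen c) ^+ ordS j = (gen a * gen c) ^+ j * gen a * gen c)%g.
    rewrite /= -mulgA -expgSr [in RHS](divn_eq j.+1 n) expgnDr mulnC expgnA zn expg1n.
    by rewrite mul1g.
  move=> s x; case: (cases s) => [->|->|->|sabc]; rewrite ?(aE, bE, cE).
  - by case: x => j [[]|[u e]]; rewrite /wheel_rho ?eqxx //= ?mulg1 ?mulgA ?mulgenK.
  - by case: x => j [[]|[u e]]; rewrite /wheel_rho ?eqxx //= ?mulg1 ?mulgA ?mulgenK.
  - case: x => j [[]|[u e]]; rewrite /wheel_rho ?eqxx //=; try by rewrite ?mulg1 ?mulgA ?mulgenK.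
      by rewrite -[in RHS](ord_predK j) (zS (ord_pred j)) mulg1 mulgenK.
    by rewrite mulg1 -(zS j).
  have [sC|sC] := boolP (s \in C); last first.
    move: sabc; rewrite !inE !negb_or => /and3P[sa sb sc].
    by rewrite /wheel_act (negbTE sa) (negbTE sb) (negbTE sc) (negbTE sC) eqxx.
  rewrite dE //; case: x => j [[]|[u e]]; rewrite /wheel_rho ?eqxx //= ?mulgA //.
  by have [-> _|] := eqVneq e s; rewrite ?eqxx //=; case: u; rewrite ?mulgA mulgenK.
apply: braid_rels => // [s x sC|s t k sC tC neq mst].
  by rewrite /wheel_act (negbTE sC); do 3![case: eqP => [sE|_]; first by rewrite sE ?aC ?bC ?cC in sC].
have [nabc|/norP[/negPn sabc /negPn tabc]] := boolP (~~ (s \in [:: a; b; c]) || ~~ (t \in [:: a; b; c])).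
  have d3 := others3 sC tC neq nabc mst.
  case/orP: nabc => ?; [right|left]; apply: braid_dvd d3 _; apply: br_leaf => //.
  by rewrite eq_sym.
move: sabc tabc neq mst; rewrite !inE => /or3P[]/eqP-> /or3P[]/eqP->; rewrite ?eqxx //= => _.
- by rewrite mab => -[<-]; left; apply: braid_dvd br_ab.
- by rewrite mac => -[<-]; left.
- by rewrite cox_sym mab => -[<-]; right; apply: braid_dvd br_ab.
- by rewrite mbc => -[<-]; left; apply: braid_dvd br_bc.
- by rewrite cox_sym mac => -[<-]; right.
- by rewrite cox_sym mbc => -[<-]; right; apply: braid_dvd br_bc.
Qed.

End Wheel.
End Constructions.

(** * Components without the six subdiagrams *)

Section Diagrams.
Variables (S : finType) (m : coxeter_matrix S).
Hypothesis m_odd : odd_angled m.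
Local Notation W := (coxeter_group m).
Local Notation label := (cox_div m).
Local Notation big := (joined label (leq 5)).
Local Notation five := (joined label (pred1 5)).
Local Notation three := (joined label (pred1 3)).

Lemma joined_neq (P : pred nat) s t : joined label P s t -> s != t.
Proof. by case/(joinedP m_odd) => k []. Qed.

Lemma joined_edge (P : pred nat) s t : joined label P s t -> edge m s t.
Proof. by rewrite /joined /edge; case: (label s t). Qed.

(** So a label is either [3] or at least [5]. *)
Lemma label_odd s t k : s != t -> m s t = Some k ->
  [/\ odd (pdiv k), 3 <= pdiv k & label s t = Some (pdiv k)].
Proof.
move=> neq mst; have k_gt1 := cox_ge2 neq mst.
have k_odd := dvdn_odd (pdiv_dvd k) (m_odd neq mst).
have := prime_gt1 (pdiv_prime k_gt1); rewrite /cox_div (negbTE neq) mst /=.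
by case: (pdiv k) k_odd => [|[|[]]].
Qed.

Lemma not_big s t : s != t -> ~~ big s t -> not_joined label s t || three s t.
Proof.
move=> neq; rewrite /joined /not_joined.
case mst: (m s t) => [k|]; last by rewrite /cox_div (negbTE neq) mst.
have [k_odd k3 ->] := label_odd neq mst; rewrite /= -ltnNge => k5.
by move: k_odd k3 k5; case: (pdiv k) => [|[|[|[|[]]]]].
Qed.

Lemma not_big_dvd s t k : s != t -> ~~ big s t -> m s t = Some k -> 3 %| k.
Proof.
move=> neq nbig mst; case/orP: (not_big neq nbig).
  by move/(not_joinedP neq); rewrite mst.
by case/(joinedP m_odd) => k' []; rewrite mst => _ [<-] _ /eqP <-; apply: pdiv_dvd.
Qed.

Variable C : {set S}.
Hypothesis CC : C \in components label.

Lemma edge_in s t : edge m s t -> s \in C -> t \in C.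
Proof. by move=> st sC; rewrite (componentP t CC sC) connect1. Qed.

Lemma big_in s t : big s t -> s \in C -> t \in C.
Proof. by move/joined_edge; apply: edge_in. Qed.

Section Adjacent.
Hypotheses (noA : ~ contains_A label C) (noB : ~ contains_B label C).

(** The third pair is not big by A and it is joined, also by A; then B bounds the
    two labels by [5]. *)
Lemma adjacent_big s t u : t \in C -> s != u -> big s t -> big t u ->
  [/\ five s t, five t u & three s u].
Proof.
have half x y z : y \in C -> x != z -> big x y -> big y z -> three x z /\ five x y.
  move=> yC neq xy yz; have xC : x \in C by apply: big_in yC; rewrite joinedC.
  have zC : z \in C by apply: big_in yC.
  have xyz : uniq [:: x; y; z] by rewrite /= !inE negb_or (joined_neq xy) neq (joined_neq yz).
  have sub : {subset [:: x; y; z] <= C} by move=> w; rewrite !inE => /or3P[]/eqP->.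
  have nbig : ~~ big x z.
    by apply/negP=> xz; apply: noA; exists x, y, z; split=> //; rewrite xz orbT.
  have xz3 : three x z.
    case/orP: (not_big neq nbig) => // nj; case: noA.
    by exists x, y, z; split=> //; rewrite nj.
  split=> //; case/(joinedP m_odd): (xy) => k [neq_xy mxy _ k5].
  have [k_odd _ lab] := label_odd neq_xy mxy.
  have : ~~ joined label (leq 7) x y.
    by apply/negP=> xy7; apply: noB; exists x, y, z.
  rewrite /joined lab /= -ltnNge; move: k_odd k5.
  by case: (pdiv k) => [|[|[|[|[|[|[|]]]]]]].
move=> tC neq st tu; have [su st5] := half s t u tC neq st tu.
by split=> //; have [] := half u t s tC; rewrite 1?eq_sym // joinedC // => _; rewrite joinedC.
Qed.

End Adjacent.

Definition step (A : {set S}) : {set S} := [set t | [exists s in A, edge m s t]].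
(** The ends of the walks with [i] edges which start in [A]. *)
Definition sphere (A : {set S}) (i : nat) : {set S} := iter i step A.

Lemma sphereS A i s t : s \in sphere A i -> edge m s t -> t \in sphere A i.+1.
Proof. by move=> si st; rewrite inE; apply/exists_inP; exists s. Qed.

Lemma sphere_meet A B i j s : s \in sphere A i -> s \in sphere B j ->
  exists2 t, t \in B & t \in sphere A (i + j).
Proof.
elim: j i s => [|j IH] i s si; first by rewrite addn0 => sB; exists s.
rewrite inE => /exists_inP[t tj ts]; rewrite addnS -addSn; apply: IH tj.
by apply: sphereS si _; rewrite edge_sym.
Qed.

Lemma sphere_path A i s : s \in sphere A i -> exists v : nat -> S,
  [/\ v i = s, forall k, k <= i -> v k \in sphere A k &
      forall k, k < i -> edge m (v k) (v k.+1)].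
Proof.
elim: i s => [|i IH] s si.
  by exists (fun=> s); split=> // k; rewrite leqn0 => /eqP->.
have /[!inE]/exists_inP[t ti ts] := si; have [v [vi vk ve]] := IH t ti.
exists (fun k => if k <= i then v k else s); split=> [|k|k]; rewrite ?ltnn //.
  by rewrite leq_eqVlt ltnS => /orP[/eqP->|ki]; rewrite ?ltnn // ki; apply: vk.
rewrite ltnS => /[dup]; rewrite {1}leq_eqVlt => /orP[/eqP->|ki] _; first by rewrite leqnn ltnn vi.
by rewrite (ltnW ki) ki; apply: ve.
Qed.

Lemma sphere_connect (A : {set S}) s t : s \in A -> connect (edge m) s t ->
  exists i, t \in sphere A i.
Proof.
move=> sA /connectP[p + ->]; suff H q x i : x \in sphere A i -> path (edge m) x q ->
    exists i, last x q \in sphere A i by move=> pp; apply: (H p s 0).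
elim: q x i => [|y q IH] x i xi /=; first by exists i.
by case/andP=> xy; apply: IH (sphereS xi xy).
Qed.

Section Connected.
Hypotheses (noC : ~ contains_C label C) (noF : ~ contains_F label C).
Variables a b : S.
Hypotheses (aC : a \in C) (ab : big a b).

Let K : {set S} := [set s | connect big a s].
Let K' : {set S} := [set s | (s \notin K) && [exists t, big s t]].

Lemma big_sym : connect_sym big.
Proof. by apply: sym_connect_sym => s t; rewrite joinedC. Qed.

Lemma bigK s t : big s t -> (s \in K) = (t \in K).
Proof.
move=> st; rewrite !inE ![connect _ a _]big_sym.
by apply: (same_connect big_sym); apply: connect1.
Qed.

Lemma K_big s : s \in K -> exists t, big s t.
Proof.
rewrite inE big_sym => /connectP[[|t p] /=]; first by move=> _ <-; exists b.
by case/andP=> st _ _; exists t.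
Qed.

Lemma sphere_in i s : s \in sphere K i -> s \in C.
Proof.
elim: i s => [|i IH] s; last first.
  by rewrite inE => /exists_inP[t /IH tC ts]; apply: edge_in tC.
rewrite inE (componentP s CC aC); apply: connect_sub => x y /joined_edge.
exact: connect1.
Qed.

Section Bridge.
Variables (l : nat).
Hypothesis l_gt0 : 0 < l.
Hypothesis l_min : forall i t, t \in sphere K i -> t \in K' -> l <= i.
Variables (v : nat -> S) (u w : S).
Hypothesis v_sphere : forall k, k <= l -> v k \in sphere K k.
Hypothesis v_edge : forall k, k < l -> edge m (v k) (v k.+1).
Hypotheses (vl : v l \in K') (uv : big u (v 0)) (vw : big (v l) w).
Local Notation n := l.+3.

(** The candidate for a subdiagram C or F: a shortest walk [v 0], ..., [v l] from the
    big component [K] of [a] to the set [K'] of the ends of big edges outside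
    [K], extended by a big edge at either end.  The vertices are numbered from [1] to
    [n = l + 3]. *)
Definition bridge (j : nat) : S :=
  if j == 1 then u else if j == n then w else v (j - 2).
Local Notation x := bridge.

Lemma bridge_sphere i : i < n -> x i \in sphere K (i - 2).
Proof.
move=> lt; rewrite /x; have [->|i1] := eqVneq i 1.
  by rewrite -[sphere K _]/K (bigK uv); apply: (v_sphere (leq0n l)).
by rewrite ltn_eqF // v_sphere //; lia.
Qed.

Lemma v_cosphere k : k <= l -> v (l - k) \in sphere K' k.
Proof.
elim: k => [|k IH] kl; first by rewrite subn0.
apply: sphereS (IH (ltnW kl)) _; rewrite edge_sym.
have -> : l - k = (l - k.+1).+1 by lia.
by apply: v_edge; lia.
Qed.

Lemma w_K' : w \in K'.
Proof.
rewrite inE -(bigK vw); have := vl; rewrite inE => /andP[-> _] /=.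
by apply/existsP; exists (v l); rewrite joinedC.
Qed.

Lemma bridge_cosphere j : 1 < j <= n -> x j \in sphere K' (n - 1 - j).
Proof.
move=> /andP[j1 jn]; rewrite /x; have [j_1|_] := eqVneq j 1; first by lia.
have [->|jn'] := eqVneq j n.
  have -> : n - 1 - n = 0 by clear; lia.
  exact: w_K'.
have <- : l - (n - 1 - j) = j - 2 by lia.
by apply: v_cosphere; lia.
Qed.

(** If [x i] and [x j] were joined too far apart, one could walk from [K] to [x i],
    across, and on to [K'], in less than [l] steps. *)
Lemma bridge_far i j : 0 < i -> i < j <= n -> edge m (x i) (x j) ->
  n - 3 <= (i - 2).+1 + (n - 1 - j).
Proof.
move=> i_gt0 /andP[ij jn] xij.
have xj : x j \in sphere K (i - 2).+1 by apply: sphereS xij; apply: bridge_sphere; lia.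
have [|t tK' tK] := sphere_meet xj (@bridge_cosphere j _); first by lia.
have -> : n - 3 = l by clear; lia.
exact: l_min tK tK'.
Qed.

(** The ends of a big edge are both in [K] or both outside; in either case the walk
    could be shortened unless the edge is the first or the last one. *)
Lemma bridge_big i j : 0 < i -> i < j <= n -> big (x i) (x j) ->
  j = 2 \/ i = n - 1.
Proof.
move=> i_gt0 /andP[ij jn] xij.
have xjs : x j \in sphere K' (n - 1 - j) by apply: bridge_cosphere; lia.
have xis : x i \in sphere K (i - 2) by apply: bridge_sphere; clear -ij jn; lia.
have [xiK|xiK] := boolP (x i \in K).
  have xjK : x j \in sphere K 0 by rewrite -[sphere K 0]/K -(bigK xij).
  have [t tK' tK] := sphere_meet xjK xjs.
  by left; have := l_min tK tK'; clear -ij jn i_gt0 l_gt0; lia.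
have xiK' : x i \in K' by rewrite inE xiK; apply/existsP; exists (x j).
by right; have := l_min xis xiK'; clear -ij jn i_gt0 l_gt0; lia.
Qed.

Lemma bridge_ends : big (x 1) (x 2) /\ big (x (n - 1)) (x n).
Proof.
split; rewrite /x /=; first by rewrite subnn.
rewrite eqxx; have -> : n - 1 = l.+2 by lia.
by rewrite eqSS (ltn_eqF (ltnSn _)) subSS subSS subn0.
Qed.

Lemma bridge_neq i j : 0 < i -> i < j <= n -> x i != x j.
Proof.
move=> i_gt0 /andP[ij jn]; have [x12 xn] := bridge_ends.
have [[-> ->]|neq2] := pselect (i = 1 /\ j = 2); first exact: joined_neq x12.
have [[-> ->]|neqn] := pselect (i = n - 1 /\ j = n); first exact: joined_neq xn.
apply/eqP=> xij; have xjs : x j \in sphere K' (n - 1 - j) by apply: bridge_cosphere; lia.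
have xis : x i \in sphere K (i - 2) by apply: bridge_sphere; clear -ij jn; lia.
rewrite xij in xis; have [t tK' tK] := sphere_meet xis xjs.
by have := l_min tK tK'; clear -ij jn i_gt0 l_gt0 neq2 neqn; lia.
Qed.

Lemma bridge_three i : 1 < i < n - 1 -> three (x i) (x i.+1).
Proof.
move=> /andP[i1 iN]; have xij : x i != x i.+1 by apply: bridge_neq; lia.
have nbig : ~~ big (x i) (x i.+1).
  by apply/negP=> /bridge_big[]; clear -i1 iN; lia.
case/orP: (not_big xij nbig) => //.
have : edge m (x i) (x i.+1).
  rewrite /x !ifN; try by apply/eqP; clear -i1 iN; lia.
  have -> : i.+1 - 2 = (i - 2).+1 by lia.
  by apply: v_edge; lia.
by rewrite /edge /not_joined; case: (label _ _).
Qed.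

Lemma bridge_chord i j : 0 < i -> i.+1 < j <= n ->
  not_joined label (x i) (x j) || three (x i) (x j).
Proof.
move=> i_gt0 /andP[ij jn]; apply: not_big; first by apply: bridge_neq; lia.
by apply/negP=> /bridge_big[]; clear -i_gt0 ij jn; lia.
Qed.

Lemma bridge_C i : 0 < i <= n -> x i \in C.
Proof.
move=> /andP[i_gt0 lein]; have [iN|] := ltnP i n; first exact: sphere_in (bridge_sphere iN).
move=> nlei; have -> : i = n by lia.
have [_ xn] := bridge_ends; apply: big_in xn _.
by apply: (@sphere_in (n - 1 - 2)); apply: bridge_sphere; lia.
Qed.

Lemma no_bridge : False.
Proof.
have [x12 xn] := bridge_ends.
(* A walk with one edge gives four vertices, hence the diagram C. *)
have [l1|l2] := leqP l 1.
  have l_1 : l = 1 by lia.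
  move: bridge_neq bridge_three bridge_chord bridge_C xn; rewrite l_1 => neq e3 chord inC xn.
  apply: noC; exists (x 1), (x 2), (x 3), (x 4); split.
  - by rewrite /= !inE !negb_or !neq.
  - by move=> s; rewrite !inE => /or4P[]/eqP->; apply: inC.
  - by rewrite x12 xn e3.
  - exact: chord.
  by rewrite !chord.
apply: noF; exists n, x; split.
- by clear -l2; lia.
- split=> [i j|i]; last exact: bridge_C.
  rewrite !inE => /andP[i_gt0 iN] /andP[j_gt0 jN] xij.
  case: (ltngtP i j) => // ij; have := @bridge_neq _ _ _; last first.
    by move=> /(_ j i j_gt0); rewrite ij iN xij eqxx => /(_ isT).
  by move=> /(_ i j i_gt0); rewrite ij jN xij eqxx => /(_ isT).
- by rewrite x12; move: xn; rewrite subn1.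
- by move=> i /andP[i2 iN]; apply: bridge_three; lia.
split; first by apply: bridge_chord; clear; lia.
  by apply: bridge_chord; clear -l2; lia.
move=> i j /andP[i_gt0 ij] jN ji1 ij13 ijn; apply/eqP.
case E: (label (x i) (x j)) => [k|] //; have xij : edge m (x i) (x j) by rewrite /edge E.
have := @bridge_far i j i_gt0; rewrite ij jN => /(_ isT xij).
move/eqP: ji1 => ji1; have n13 : ~ (i = 1 /\ j = 3) by move=> [iE jE]; rewrite iE jE eqxx in ij13.
have nn : ~ (i = n - 2 /\ j = n) by move=> [iE jE]; rewrite iE jE eqxx in ijn.
by clear -i_gt0 ij jN ji1 n13 nn l2; lia.
Qed.

End Bridge.

(** Otherwise a shortest walk between two components of big edges would give a
    subdiagram C or F. *)
Lemma big_connected s t : s \in C -> big s t -> connect big a s.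
Proof.
move=> sC st; have [/[!inE]//|sK] := boolP (s \in K).
have sK' : s \in K' by rewrite inE sK; apply/existsP; exists t.
have aK : a \in K by rewrite inE connect0.
have [i si] : exists i, s \in sphere K i.
  by apply: sphere_connect aK _; rewrite -(componentP s CC aC).
have ex : exists i, K' :&: sphere K i != finset.set0.
  by exists i; apply/finset.set0Pn; exists s; rewrite inE sK'.
case: (ex_minnP ex) => l /finset.set0Pn[z /setIP[zK' zl]] l_min.
have [v [vl v_sphere v_edge]] := sphere_path zl.
have l_gt0 : 0 < l.
  by case: l zl {l_min vl v_sphere v_edge} => //; rewrite -[sphere K 0]/K => zK; rewrite inE zK in zK'.
have [u v0u] := K_big (v_sphere 0 (leq0n l)).
have [w vlw] : exists w, big z w by move: zK'; rewrite inE => /andP[_ /existsP].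
case: (@no_bridge l l_gt0 _ v u w v_sphere v_edge); rewrite ?vl //; last by rewrite joinedC.
move=> j y yj yK'; apply: l_min; apply/finset.set0Pn; exists y.
by rewrite inE yK'.
Qed.

End Connected.

(** Let [a b] be a big edge.  If it is the only one there is a path action.  A second
    one can be taken adjacent to the first, as big edges are connected; then D
    excludes a third one at an outer end, E at the middle, and there is a wheel
    action. *)
Lemma reflection_subgroup_of_component :
  ~ contains_A label C -> ~ contains_B label C -> ~ contains_C label C ->
  ~ contains_D label C -> ~ contains_E label C -> ~ contains_F label C ->
  exists H : set W, reflection_subgroup H /\ finite_index H.
Proof.
move=> noA noB noC noD noE noF; have adj := adjacent_big noA noB.
have bigC s t : big s t = big t s by apply: joinedC.
have [[a [b [aC ab]]]|nobig] := pselect (exists a b, a \in C /\ big a b); last first.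
  apply: (star_subgroup CC).
    move=> s t k sC tC neq; apply: not_big_dvd neq _; apply/negP=> st.
    by apply: nobig; exists s, t.
  by apply/finset.set0Pn; case/and3P: (finset.equivalence_partitionP (@edge_equiv _ m)) => _ _ /memPn; apply.
have bC := big_in ab aC; have neq_ab := joined_neq ab.
(* Big edges are connected, so they lie in any set that contains an end of one of
   them and is closed under big edges. *)
have only (a' b' : S) (A : {set S}) : a' \in C -> big a' b' -> a' \in A ->
    (forall s t, s \in A -> big s t -> t \in A) ->
    forall s t, s \in C -> big s t -> s \in A /\ t \in A.
  move=> a'C a'b' a'A clA s t sC st; suff sA : s \in A by split=> //; apply: clA st.
  have a's := big_connected noC noF a'C a'b' sC st.
  rewrite -(@closed_connect _ big (mem A) _ _ _ a's) // => y z yz.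
  by apply/idP/idP=> h; apply: clA h _; rewrite // bigC.
have wheel x y z : y \in C -> x != z -> big x y -> big y z ->
    exists H : set W, reflection_subgroup H /\ finite_index H.
  move=> yC xz xy yz; have [xy5 yz5 xz3] := adj x y z yC xz xy yz.
  have xC : x \in C by apply: big_in yC; rewrite bigC.
  have zC : z \in C by apply: big_in yC.
  have neq_xy := joined_neq xy; have neq_yz := joined_neq yz.
  have nD p q r d : uniq [:: p; q; r] -> q \in C -> big p q -> big q r -> big p d -> d \in [:: p; q; r].
    move=> pqr qC pq qr pd; apply/negPn/negP; rewrite !inE !negb_or => /and3P[dp dq dr].
    have pr : p != r by move: pqr; rewrite /= !inE !negb_or => /andP[/andP[]].
    have pC : p \in C by apply: big_in qC; rewrite bigC.
    have dC : d \in C by apply: big_in pC.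
    have dp' : big d p by rewrite bigC.
    have [dp5 _ dq3] := adj d p q pC dq dp' pq; have [pq5 qr5 pr3] := adj p q r qC pr pq qr.
    apply: noD; exists d, p, q, r; split; rewrite ?dp5 ?pq5 ?qr5 ?dq3 ?pr3 //.
    - by rewrite cons_uniq pqr !inE !negb_or dp dq dr.
    - by move=> s; rewrite !inE => /or4P[]/eqP-> //; apply: big_in qr qC.
    have [dr_big|dr_small] := boolP (big d r).
      have rC : r \in C by apply: big_in qC.
      have rq : big r q by rewrite bigC.
      have [dr5 _ _] := adj d r q rC dq dr_big rq.
      by apply/orP; right; apply: sub_joined dr5 => k /eqP ->.
    case/orP: (not_big dr dr_small) => [->//|dr3].
    by apply/orP; right; apply: sub_joined dr3 => k /eqP ->.
  have nE d : big y d -> d \in [:: x; y; z].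
    move=> yd; apply/negPn/negP; rewrite !inE !negb_or => /and3P[dx dy dz].
    have dC : d \in C by apply: big_in yC.
    have zd : z != d by rewrite eq_sym.
    have xd : x != d by rewrite eq_sym.
    have zy : big z y by rewrite bigC.
    have [_ yd5 zd3] := adj z y d yC zd zy yd; have [_ _ xd3] := adj x y d yC xd xy yd.
    apply: noE; exists y, x, z, d; split.
    - by rewrite /= !inE !negb_or (eq_sym y x) neq_xy neq_yz (eq_sym y d) dy xz xd zd.
    - by move=> s; rewrite !inE => /or4P[]/eqP->.
    - by rewrite joinedC xy5 yz5.
    by rewrite xz3 xd3 zd3.
  have in3 s t : s \in C -> big s t -> s \in [:: x; y; z] /\ t \in [:: x; y; z].
    pose A : {set S} := [set p | p \in [:: x; y; z]].
    have inA p : (p \in A) = (p \in [:: x; y; z]) by rewrite inE.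
    move=> sC st; rewrite -!inA; apply: (only x y A xC xy _ _ s t sC st); first by rewrite inA !inE eqxx.
    move=> p q; rewrite !inA => pA pq.
    have /or3P[/eqP pE|/eqP pE|/eqP pE] : [|| p == x, p == y | p == z]; rewrite ?pE in pq *.
    - by move: pA; rewrite !inE.
    - by apply: nD pq => //; rewrite /= !inE !negb_or neq_xy neq_yz xz.
    - exact: nE.
    have : q \in [:: z; y; x].
      apply: nD pq => //; rewrite ?(bigC z) ?(bigC y x) //= !inE !negb_or.
      by rewrite (eq_sym z y) neq_yz (eq_sym z x) xz (eq_sym y x) neq_xy.
    by rewrite -(mem_rev [:: z; y; x]).
  case/(joinedP m_odd): xy5 => kxy [_ mxy _ /eqP kxy5].
  case/(joinedP m_odd): yz5 => kyz [_ myz _ /eqP kyz5].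
  case/(joinedP m_odd): xz3 => kxz [_ mxz kxz_odd /eqP kxz3].
  case: kxz mxz kxz_odd kxz3 => // q mxz _ q3.
  apply: (@wheel_subgroup _ m _ CC x y z kxy kyz q) => //.
  - by rewrite -kxy5 pdiv_dvd.
  - by rewrite -kyz5 pdiv_dvd.
  - by rewrite -q3 pdiv_dvd.
  move=> s t k sC tC neq out; apply: not_big_dvd neq _.
  by apply: contraL out => /(in3 s t sC)[-> ->].
have [[c [ac cb]]|a_only] := pselect (exists c, big a c /\ c != b).
  by apply: (wheel c a b) => //; rewrite bigC.
have [[c [bc ca]]|b_only] := pselect (exists c, big b c /\ c != a).
  by apply: (wheel a b c) => //; rewrite eq_sym.
have in2 s t : s \in C -> big s t -> (s == a) && (t == b) || (s == b) && (t == a).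
  have aN t' : big a t' -> t' = b by move=> at'; apply/eqP/negPn/negP=> t'b; apply: a_only; exists t'.
  have bN t' : big b t' -> t' = a by move=> at'; apply/eqP/negPn/negP=> t'b; apply: b_only; exists t'.
  move=> sC st; have [|p q|] := only a b [set a; b] aC ab _ _ s t sC st; rewrite !inE ?eqxx //.
    by case/orP=> /eqP-> pq; [rewrite (aN q pq)|rewrite (bN q pq)]; rewrite eqxx ?orbT.
  by case/orP=> /eqP sE _; rewrite sE in st *; [rewrite (aN t st)|rewrite (bN t st)]; rewrite !eqxx ?orbT.
case/(joinedP m_odd): (ab) => k [_ mab k_odd k5].
have p_odd := dvdn_odd (pdiv_dvd k) k_odd.
case E: (pdiv k) k5 p_odd (pdiv_dvd k) => [|q] // q5 p_odd p_dvd.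
apply: (@path_subgroup _ m _ CC a b k q) => //; first by lia.
move=> s t k' sC tC neq out; apply: not_big_dvd neq _.
by apply: contra out; apply: in2.
Qed.

End Diagrams.

Theorem theorem6p4 (S : finType) (S_nonempty : (0 < #|S|)%N)
    (m : coxeter_matrix S) (m_odd : odd_angled m) :
  (~ exists H : set (coxeter_group m),
       reflection_subgroup H /\ finite_index H)
  <->
  (forall C : {set S}, C \in components (cox_div m) ->
     contains_A (cox_div m) C \/ contains_B (cox_div m) C \/
     contains_C (cox_div m) C \/ contains_D (cox_div m) C \/
     contains_E (cox_div m) C \/ contains_F (cox_div m) C).
Proof.
split=> [noH C CC|]; last exact: no_reflection_subgroup.
apply/not_notP=> none; apply: noH; apply: (reflection_subgroup_of_component m_odd CC); tauto.
Qed.
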